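(* Let $p>1$. Let $\Omega\subset\mathbb{R}^N$, $N\ge 1$, be a bounded domain of class $C^{1,\delta}$, $\delta\in(0,1)$, and let $f\in L^\infty(\Omega)$ satisfy $f\ge 0$ and $f\not\equiv 0$. If $\lambda<\lambda_f^*$, then $(\mathcal{D}_\lambda)$ has no solution $u$ such that $E_\lambda(u)=0$. Moreover, the following assertions hold: (i) If $\lambda<\lambda_1$, then, in addition to the (known) maximum principle $u>0$ in $\Omega$, any solution $u$ of $(\mathcal{D}_\lambda)$ satisfies $E_\lambda(u)<0$. (ii) If $\lambda_1<\lambda<\lambda_f^*$, then any solution $u$ of $(\mathcal{D}_\lambda)$ satisfies $E_\lambda(u)>0$.
   Context: For $\lambda\in\mathbb{R}$, problem $(\mathcal{D}_\lambda)$ is $-\Delta_p u=\lambda|u|^{p-2}u+f(x)$ in $\Omega$, $u=0$ on $\partial\Omega$, where $\Delta_p u=\operatorname{div}(|\nabla u|^{p-2}\nabla u)$; solutions are weak solutions in $W_0^{1,p}(\Omega)$ (known to belong to $C^{1,\gamma}(\overline\Omega)$ for some $\gamma\in(0,1)$), equivalently critical points of the energy functional $E_\lambda\in C^1(W_0^{1,p}(\Omega),\mathbb{R})$, $$E_\lambda(u):=\frac1pH_\lambda(u)-\int_\Omega fu\,dx,\qquad H_\lambda(u):=\int_\Omega|\nabla u|^p\,dx-\lambda\int_\Omega|u|^p\,dx.$$ $\lambda_1:=\inf\{\int_\Omega|\nabla u|^p\,dx/\int_\Omega|u|^p\,dx:\ u\in W_0^{1,p}(\Omega)\setminus\{0\}\}$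 is the first eigenvalue of the Dirichlet $p$-Laplacian. The critical value $\lambda_f^*$ is defined by $$\lambda_f^*:=\inf\left\{\frac{\int_\Omega|\nabla u|^p\,dx}{\int_\Omega|u|^p\,dx}:\ \int_\Omega fu\,dx=0,\ u\in W_0^{1,p}(\Omega)\setminus\{0\}\right\}.$$ *)

(* Defs.v *)
From HB Require Import structures.
From mathcomp Require Import all_boot all_order all_algebra.
From mathcomp Require Import all_classical all_reals all_analysis.
From mathcomp Require Import measurable_realfun.

Set Implicit Arguments.
Unset Strict Implicit.
Unset Printing Implicit Defensive.
Import Order.TTheory GRing.Theory Num.Theory.
Import numFieldNormedType.Exports.

Local Open Scope classical_set_scope.
Local Open Scope ring_scope.

(* The sigma-algebra of R^n generated by the coordinates (the Borel one, see
   [open_measurable_rV]), exactly as the library does for [n.-tuple T]. *)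
Definition measure_rV_display : measure_display. Proof. exact: default_measure_display. Qed.

Section measurable_rV.
Context {R : realType} (n : nat).

Definition rV_coord (i : 'I_n) (v : 'rV[R]_n) : R := v ord0 i.

Let rV_set0 : g_sigma_preimage rV_coord set0.
Proof. exact: sigma_algebra0. Qed.

Let rV_setC A : g_sigma_preimage rV_coord A -> g_sigma_preimage rV_coord (~` A).
Proof. exact: sigma_algebraC. Qed.

Let rV_bigcup (F : _^nat) : (forall i, g_sigma_preimage rV_coord (F i)) ->
  g_sigma_preimage rV_coord (\bigcup_i (F i)).
Proof. exact: sigma_algebra_bigcup. Qed.

HB.instance Definition _ := @isMeasurable.Build measure_rV_display
  'rV[R]_n (g_sigma_preimage rV_coord) rV_set0 rV_setC rV_bigcup.

Lemma measurable_rV_coord (i : 'I_n) : measurable_fun setT (rV_coord i).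
Proof.
move=> _ Y mY; rewrite setTI; apply: sub_sigma_algebra => /=.
rewrite -bigcup_seq/=; exists i => /=; first by rewrite mem_index_enum.
by exists Y => //; rewrite setTI.
Qed.

Lemma measurable_fun_rV d (T : measurableType d) (f : T -> 'rV[R]_n) :
  (forall i, measurable_fun setT (rV_coord i \o f)) -> measurable_fun setT f.
Proof.
move=> mf.
suff : g_sigma_preimage (fun i => rV_coord i \o f) `<=` measurable.
  rewrite g_sigma_preimage_comp => h _ A mA.
  by apply: h; exists A.
apply: smallest_sub; first exact: sigma_algebra_measurable.
rewrite -bigcup_seq; apply: bigcup_sub => i Ii.
by move=> A [B mB <-]; exact: mf.
Qed.

Lemma measurable_ball_rV (c : 'rV[R]_n) (e : R) : measurable (ball c e).
Proof.
have [e0|e0] := leP e 0.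
  by rewrite (_ : ball c e = set0)//; apply/seteqP; split => // v [/lt_le_trans/(_ e0)]; rewrite ltxx.
have -> : ball c e = \big[setI/setT]_(i < n) (rV_coord i @^-1` ball (c ord0 i) e).
  rewrite -bigcap_seq; apply/seteqP; split => v /=.
    by move=> [_ h] i _; exact: h.
  move=> h; split => // i j; rewrite ord1; apply: h => /=.
  by rewrite mem_index_enum.
apply: bigsetI_measurable => i _.
rewrite -[X in measurable X]setTI; apply: measurable_rV_coord => //.
exact: measurable_ball.
Qed.

Lemma open_measurable_rV (A : set 'rV[R]_n) : open A -> measurable A.
Proof.
move=> oA.
pose q2r (q : 'rV[rat]_n) : 'rV[R]_n := map_mx ratr q.
pose F (z : 'rV[rat]_n * nat) : set 'rV[R]_n :=
  if pselect (ball (q2r z.1) z.2.+1%:R^-1 `<=` A)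
  then ball (q2r z.1) z.2.+1%:R^-1 else set0.
have -> : A = \bigcup_k (if unpickle k is Some z then F z else set0).
  apply/seteqP; split => [v Av|v [k _]]; last first.
    by case: unpickle => // z; rewrite /F; case: pselect => //= sub; exact: sub.
  have [e /= e0 eA] : nbhs_ball v A by apply/nbhs_ballP/open_nbhs_nbhs.
  have [k ke] : exists k : nat, k.+1%:R^-1 < e / 2 :> R.
    have e2 : 0 < e / 2 by rewrite divr_gt0.
    exists (Num.truncn (e / 2)^-1); rewrite invf_plt ?posrE//.
    exact: truncnS_gt.
  have k0 : 0 < k.+1%:R^-1 :> R by rewrite invr_gt0.
  have /choice[q hq] : forall i : 'I_n, exists q : rat,
      ball (ratr q : R) k.+1%:R^-1 (v ord0 i).
    move=> i.
    have /rat_in_itvoo[q] : v ord0 i - k.+1%:R^-1 < v ord0 i + k.+1%:R^-1.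
      by rewrite ltrBlDr -addrA ltrDl addr_gt0.
    rewrite in_itv/= => /andP[q1 q2]; exists q.
    by rewrite /ball/= ltr_distlC; rewrite ltrBlDr q2 -ltrBlDr q1.
  have vq : ball (q2r (\row_i q i)) k.+1%:R^-1 v.
    by split => // i j; rewrite ord1 !mxE; exact: hq.
  exists (pickle (\row_i q i, k)) => //; rewrite pickleK /F.
  case: pselect => //= -[] w qw; apply: eA.
  rewrite [e]splitr; apply: (@ball_triangle _ _ (q2r (\row_i q i))).
    by apply: ball_sym; apply: le_ball vq; exact: ltW.
  by apply: le_ball qw; exact: ltW.
apply: bigcupT_measurable => k; case: unpickle => // z.
by rewrite /F; case: pselect => /= _ //; exact: measurable_ball_rV.
Qed.

End measurable_rV.

Section lebesgue_rV.
Context {R : realType}.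
Local Open Scope ereal_scope.

Definition rVcons n (z : R * 'rV[R]_n) : 'rV[R]_n.+1 :=
  \row_i (if unlift ord0 i is Some j then z.2 ord0 j else z.1).

Definition rVuncons n (v : 'rV[R]_n.+1) : R * 'rV[R]_n :=
  (v ord0 ord0, \row_i v ord0 (lift ord0 i)).

Lemma rVconsK n : cancel (@rVcons n) (@rVuncons n).
Proof.
move=> [x v]; rewrite /rVcons /rVuncons/= mxE unlift_none; congr pair.
by apply/rowP => i; rewrite !mxE liftK.
Qed.

Lemma rVunconsK n : cancel (@rVuncons n) (@rVcons n).
Proof.
move=> v; apply/rowP => i; rewrite !mxE.
by case: unliftP => [j ->|->]//=; rewrite mxE.
Qed.

Lemma measurable_rVcons n : measurable_fun setT (@rVcons n).
Proof.
apply: measurable_fun_rV => i; rewrite /comp/rV_coord.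
under eq_fun do rewrite mxE.
case: (unlift ord0 i) => [j|]; last exact: measurable_fst.
exact: (measurableT_comp (measurable_rV_coord j) measurable_snd).
Qed.

Lemma measurable_rVuncons n : measurable_fun setT (@rVuncons n).
Proof.
apply/measurable_fun_pair; first exact: measurable_rV_coord.
apply: measurable_fun_rV => i; rewrite /comp/rV_coord.
under eq_fun do rewrite mxE.
exact: (measurable_rV_coord (lift ord0 i)).
Qed.

Section step.
Variables (n : nat) (m : {sigma_finite_measure set 'rV[R]_n -> \bar R}).

Definition lebesgue_rV_step : set 'rV[R]_n.+1 -> \bar R :=
  pushforward (lebesgue_measure \x m) (@rVcons n).

Let step0 : lebesgue_rV_step set0 = 0.
Proof. by rewrite /lebesgue_rV_step /pushforward preimage_set0 measure0. Qed.

Let step_ge0 A : 0 <= lebesgue_rV_step A.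
Proof. by rewrite /lebesgue_rV_step /pushforward; exact: measure_ge0. Qed.

Let step_sigma_additive : semi_sigma_additive lebesgue_rV_step.
Proof.
have mc X : measurable X -> measurable (@rVcons n @^-1` X).
  by move=> mX; rewrite -[Y in measurable Y]setTI; exact: measurable_rVcons.
move=> F mF tF mUF; rewrite /lebesgue_rV_step /pushforward preimage_bigcup.
apply: measure_semi_sigma_additive.
- by move=> k; exact: mc.
- apply/trivIsetP => /= i j _ _ ij; rewrite -preimage_setI.
  by move/trivIsetP : tF => /(_ _ _ _ _ ij) ->//; rewrite preimage_set0.
- by rewrite -preimage_bigcup; exact: mc.
Qed.

HB.instance Definition _ := isMeasure.Build _ _ _
  lebesgue_rV_step step0 step_ge0 step_sigma_additive.

Let step_sigma_finite : sigma_finite setT lebesgue_rV_step.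
Proof.
have /sigma_finiteP[F [TF ndF Foo]] := sigma_finiteT (@lebesgue_measure R).
have /sigma_finiteP[G [TG ndG Goo]] := sigma_finiteT m.
have TFG : \bigcup_k (F k `*` G k) = setT.
  rewrite -setXTT TF TG predeqE => -[x y]; split=> [[k _ []/= ? ?]|].
    by split; exists k.
  move=> [/= [k _ Fkx] [j _ Gjy]]; exists (maxn k j) => //; split.
  - by move: x Fkx; exact/subsetPset/ndF/leq_maxl.
  - by move: y Gjy; exact/subsetPset/ndG/leq_maxr.
exists (fun k => @rVuncons n @^-1` (F k `*` G k)).
  by rewrite -preimage_bigcup TFG preimage_setT.
move=> k; have [? ?] := Foo k; have [? ?] := Goo k; split.
  rewrite -[X in measurable X]setTI; apply: measurable_rVuncons => //.
  exact: measurableX.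
rewrite /lebesgue_rV_step /pushforward -comp_preimage.
rewrite (_ : _ \o _ = id); last by apply/funext => z /=; rewrite rVconsK.
by rewrite preimage_id product_measure1E// lte_mul_pinfty// ge0_fin_numE.
Qed.

HB.instance Definition _ := Measure_isSigmaFinite.Build _ _ _
  lebesgue_rV_step step_sigma_finite.

End step.

Fixpoint lebesgue_rV (n : nat) : {sigma_finite_measure set 'rV[R]_n -> \bar R} :=
  match n with
  | 0%N => dirac (0%R : 'rV[R]_0)
  | n'.+1 => lebesgue_rV_step (lebesgue_rV n')
  end.

Lemma lebesgue_rV_box n (A : 'I_n -> set R) : (forall i, measurable (A i)) ->
  lebesgue_rV n [set v | forall i, A i (v ord0 i)] =
  \prod_(i < n) lebesgue_measure (A i).
Proof.
elim: n A => [|n IHn] A mA /=.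
  rewrite big_ord0 /dirac/= indicE mem_set//.
  by case.
rewrite big_ord_recl /lebesgue_rV_step /pushforward.
rewrite (_ : _ @^-1` _ =
    A ord0 `*` [set v : 'rV[R]_n | forall i, A (lift ord0 i) (v ord0 i)]); last first.
  apply/seteqP; split => [[x v]/= h|[x v]/= [h0 h] i].
    split; first by have := h ord0; rewrite mxE unlift_none.
    by move=> i; have := h (lift ord0 i); rewrite mxE liftK.
  by rewrite mxE; case: unliftP => [j ->|->]//=.
rewrite product_measure1E//; [by congr (_ * _); exact: IHn|exact: mA|].
set B := (B in measurable B).
have -> : B = \big[setI/setT]_(i < n) (@rV_coord R n i @^-1` A (lift ord0 i)).
  rewrite -bigcap_seq; apply/seteqP; split => v /= h i; first by move=> _; exact: h.
  by apply: h => /=; rewrite mem_index_enum.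
apply: bigsetI_measurable => i _.
by rewrite -[X in measurable X]setTI; exact: measurable_rV_coord.
Qed.

End lebesgue_rV.

Arguments lebesgue_rV {R} n.

(* |x| and x . y below are Euclidean: the library norm of ['rV_n] is the
   maximum norm. *)
Section euclidean.
Context {R : realType} {n : nat}.
Implicit Types v w : 'rV[R]_n.

Definition dotp v w : R := \sum_(i < n) v ord0 i * w ord0 i.

Definition enorm v : R := Num.sqrt (dotp v v).

End euclidean.

Section domains.
Context {R : realType} {n : nat}.
Implicit Types (Omega A B D : set 'rV[R]_n) (delta : R).

Definition boundary Omega : set 'rV[R]_n := closure Omega `\` interior Omega.

Definition C1_hoelder delta A (psi : 'rV[R]_n -> 'rV[R]_n) : Prop :=
  (forall x, A x -> differentiable psi x) /\
  exists C : R, forall x y v, A x -> A y ->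
    `|'d psi x v - 'd psi y v| <= C * `|x - y| `^ delta * `|v|.

(* The boundary can be locally straightened by a C^{1,delta} diffeomorphism
   [psi] which sends the domain to the half-space {y | 0 < y_k}. *)
Definition C1_hoelder_boundary delta Omega : Prop :=
  forall x0, boundary Omega x0 ->
  exists (B D : set 'rV[R]_n) (psi phi : 'rV[R]_n -> 'rV[R]_n) (k : 'I_n),
    [/\ [/\ open B, B x0 & open D],
        [/\ set_fun B D psi, set_fun D B phi,
            {in B, cancel psi phi} & {in D, cancel phi psi}],
        C1_hoelder delta B psi, C1_hoelder delta D phi &
        forall x, B x -> (Omega x <-> 0 < psi x ord0 k) /\
                         (boundary Omega x <-> psi x ord0 k = 0)].

Definition bounded_C1_hoelder_domain delta Omega : Prop :=
  [/\ open Omega, connected Omega, Omega !=set0, bounded_set Omega &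
      C1_hoelder_boundary delta Omega].

End domains.

Section test_functions.
Context {R : realType} {n : nat}.
Implicit Types phi : 'rV[R]_n -> R.

Definition partial (i : 'I_n) phi (x : 'rV[R]_n) : R :=
  'D_(delta_mx ord0 i) phi x.

Definition iter_partial (s : seq 'I_n) phi := foldr partial phi s.

Definition smooth phi : Prop :=
  forall s x, differentiable (iter_partial s phi) x.

(* C_c^oo(Omega) *)
Definition test_function (Omega : set 'rV[R]_n) phi : Prop :=
  [/\ smooth phi, compact (closure [set x | phi x != 0]) &
      closure [set x | phi x != 0] `<=` Omega].

End test_functions.

Section sobolev.
Context {R : realType} {n : nat}.
Variable Omega : set 'rV[R]_n.
Local Notation mu := (@lebesgue_rV R n).

(* g \in L^q(Omega), for 1 <= q <= +oo; g is arbitrary outside Omega. *)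
Definition in_Lspace (q : \bar R) (g : 'rV[R]_n -> R) : Prop :=
  measurable_fun Omega g /\ finite_norm mu q (g \_ Omega).

Definition Lp_dist (q : \bar R) (g h : 'rV[R]_n -> R) : \bar R :=
  'N[mu]_q [EFin \o ((g \- h) \_ Omega)].

Definition weak_partial (i : 'I_n) (g gi : 'rV[R]_n -> R) : Prop :=
  forall phi, test_function Omega phi ->
    \int[mu]_(x in Omega) (g x * partial i phi x) =
    - \int[mu]_(x in Omega) (gi x * phi x).

(* An element of W_0^{1,p}(Omega), the closure of C_c^oo(Omega) in
   W^{1,p}(Omega), bundled with a representative of its weak gradient (which
   is unique almost everywhere). *)
Record W0 (p : R) := {
  W0_fun :> 'rV[R]_n -> R ;
  grad : 'rV[R]_n -> 'rV[R]_n ;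
  W0_Lp : in_Lspace p%:E W0_fun ;
  grad_Lp : forall i, in_Lspace p%:E (fun x => grad x ord0 i) ;
  grad_weak : forall i, weak_partial i W0_fun (fun x => grad x ord0 i) ;
  W0_closure : exists phi : ('rV[R]_n -> R)^nat,
    [/\ forall m, test_function Omega (phi m),
        Lp_dist p%:E (phi m) W0_fun @[m --> \oo] --> 0%E &
        forall i, Lp_dist p%:E (partial i (phi m)) (fun x => grad x ord0 i)
                    @[m --> \oo] --> 0%E] }.

Definition W0_nonzero (p : R) (u : W0 p) : Prop :=
  ~ {ae mu, forall x, Omega x -> u x = 0}.

(* u > 0 in Omega, for u determined up to null sets: almost everywhere, and at
   every point for the continuous representative of u in Omega. *)
Definition positive_in (u : 'rV[R]_n -> R) : Prop :=
  {ae mu, forall x, Omega x -> 0 < u x} /\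
  forall v : 'rV[R]_n -> R, {in Omega, continuous v} ->
    {ae mu, forall x, Omega x -> v x = u x} ->
    forall x, Omega x -> 0 < v x.

End sobolev.

Section p_laplacian.
Context {R : realType} {n : nat}.
Variables (Omega : set 'rV[R]_n) (p : R).
Local Notation mu := (@lebesgue_rV R n).
Implicit Types (u phi : W0 Omega p) (f : 'rV[R]_n -> R) (lambda : R).

Definition grad_energy u : R := \int[mu]_(x in Omega) (enorm (grad u x) `^ p).

Definition mass u : R := \int[mu]_(x in Omega) (`|u x| `^ p).

Definition H_functional lambda u : R := grad_energy u - lambda * mass u.

Definition E_functional f lambda u : R :=
  p^-1 * H_functional lambda u - \int[mu]_(x in Omega) (f x * u x).

(* [0 `^ (p - 2)] is 0 (or 1 when p = 2), so that |y|^{p-2} y vanishes at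
   y = 0 also when p < 2. *)
Definition weak_solution f lambda u : Prop :=
  forall phi,
    \int[mu]_(x in Omega)
       (enorm (grad u x) `^ (p - 2) * dotp (grad u x) (grad phi x)) =
    lambda * \int[mu]_(x in Omega) (`|u x| `^ (p - 2) * u x * phi x)
    + \int[mu]_(x in Omega) (f x * phi x).

Definition lambda1 : \bar R :=
  ereal_inf [set (grad_energy u / mass u)%:E | u in
    [set u : W0 Omega p | W0_nonzero u]].

Definition lambda_star f : \bar R :=
  ereal_inf [set (grad_energy u / mass u)%:E | u in [set u : W0 Omega p |
      \int[mu]_(x in Omega) (f x * u x) = 0 /\ W0_nonzero u]].

End p_laplacian.

Arguments lambda1 {R n} Omega p.
Arguments lambda_star {R n} Omega p f.

(* Main.v *)
(* Write H u := int |grad u|^p - lambda int |u|^p.  Testing the equation with u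
   gives H u = int f u, so that E_lambda u = (1/p - 1) int f u, and everything
   depends on the sign of int f u.

   If int f u = 0 then H u = 0, which contradicts lambda < lambda_f^*.  If
   lambda < lambda_1, then testing with u^- gives H (u^-) <= 0, whence u >= 0,
   and int f u = H u > 0.  In case (ii), suppose that a - b >= 0 where
   a := int f u^+ = H (u^+) and b := int f u^- = - H (u^-).  If u^- <> 0, then
   b > 0, as otherwise u^- contradicts lambda < lambda_f^*, and
   v := b u^+ - a u^- satisfies int f v = 0 and
   H v = a b (b^{p-1} - a^{p-1}) <= 0, a contradiction; hence u >= 0, and then
   u > 0.  By Picone's inequality, i.e. testing with h^p / (u + e)^{p-1},
   H >= 0 on all test functions, which contradicts lambda_1 < lambda.

   No regularity theory is needed for positivity.  The same test functions with
   a bump h bound grad ln (u + e) locally in L^1 uniformly in e, so that by the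
   Poincare inequality u is locally a.e. zero or a.e. positive; connectedness
   concludes.  For continuous representatives, u dominates near each point a
   multiple of exp (- c / (r^2 - |x - z|^2)), a strict subsolution of the
   homogeneous equation off a small ball around z. *)

From HB Require Import structures.
Require Import Defs.
From mathcomp Require Import all_boot all_order all_algebra.
From mathcomp Require Import all_classical all_reals all_analysis.
From mathcomp Require Import measurable_realfun ess_sup_inf ring lra.

Set Implicit Arguments.
Unset Strict Implicit.
Unset Printing Implicit Defensive.
Import Order.TTheory GRing.Theory Num.Theory.
Import numFieldNormedType.Exports.

Local Open Scope classical_set_scope.
Local Open Scope ring_scope.

(** * Smooth functions *)

(** What shapes the proof is that [W0] is only a closure of test functions, bundled with a weak
    gradient. Every nonlinear test function (positive part, quotient, logarithm) has to be reached
    through test functions, with convergence of the gradients. Hence the pairs (u, G) of [W0app],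
    whose approximants may be confined to a set [J] of values: powers and logarithms of u + e have
    bounded derivatives only on the nonnegative reals. Nonnegative smooth functions whose p-th
    powers are smooth for every real p > 1 come from the family [flat]. In case (ii) the
    coefficients of v are those that annihilate int f v. Since u^+ and u^- have disjoint supports
    and H is p-homogeneous, H v = b^p H (u^+) + a^p H (u^-). Picone's inequality wants h^p smooth,
    which is why it is proved for flat truncations before it is passed to positive parts and, by
    density, to the whole space, where lambda_1 < lambda supplies a function with H < 0. The
    comparison with the barrier discards the source and estimates the zeroth-order term by its
    absolute value, so it works for either sign of lambda. *)

Section smooth_functions.
Context {R : realType} {n : nat}.
Implicit Types (f g : 'rV[R]_n -> R) (i : 'I_n) (x : 'rV[R]_n).

(** Grading [smooth] by the order makes stability provable by induction on [k], since derivatives of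
    products and compositions involve factors known to one order less. The index is shifted: [Ck 0]
    is differentiability. *)
Definition Ck (k : nat) f : Prop :=
  forall s : seq 'I_n, (size s <= k)%N -> forall x, differentiable (iter_partial s f) x.

Lemma smoothP f : smooth f <-> forall k, Ck k f.
Proof.
split=> [h k s _ x|h s x]; first exact: h.
exact: (h (size s)).
Qed.

Lemma Ck0 f : Ck 0 f <-> forall x, differentiable f x.
Proof.
split=> [h x|h s]; first exact: (h [::]).
by rewrite leqn0 size_eq0 => /eqP ->.
Qed.

Lemma CkS k f : Ck k.+1 f <-> (forall x, differentiable f x) /\
  forall i, Ck k (partial i f).
Proof.
split=> [h|[h1 h2] s].
  split=> [x|i s sk x]; first exact: (h [::]).
  rewrite /iter_partial -foldr_rcons; apply: h.
  by rewrite size_rcons.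
(* [foldr] applies the last index first, so the first derivative taken is found at the end of
   [s]. *)
case/lastP: s => [|s i] sk x; first exact: h1.
rewrite /iter_partial foldr_rcons; apply: (h2 i).
by rewrite size_rcons in sk.
Qed.

Lemma CkW k f : Ck k.+1 f -> Ck k f.
Proof. by move=> h s sk; apply: h; exact: leqW. Qed.

Lemma Ck_diff k f x : Ck k f -> differentiable f x.
Proof. by move=> h; exact: (h [::]). Qed.

Lemma partialE i f x : partial i f x = 'D_(delta_mx ord0 i) f x.
Proof. by []. Qed.

Lemma partialD i f g : (forall x, differentiable f x) -> (forall x, differentiable g x) ->
  partial i (fun x => f x + g x) = (fun x => partial i f x + partial i g x).
Proof.
move=> df dg; apply/funext => x; rewrite /partial.
by rewrite (deriveD (f := f) (g := g)) //; exact: diff_derivable.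
Qed.

Lemma partialM i f g : (forall x, differentiable f x) -> (forall x, differentiable g x) ->
  partial i (fun x => f x * g x) = (fun x => f x * partial i g x + g x * partial i f x).
Proof.
move=> df dg; apply/funext => x; rewrite /partial.
by rewrite (deriveM (f := f) (g := g)) //; exact: diff_derivable.
Qed.

Lemma partial_cst i (c : R) : partial i (fun=> c) = (fun=> 0).
Proof. by apply/funext => x; rewrite /partial derive_cst. Qed.

Lemma partial_comp i f (h h' : R -> R) : (forall x, differentiable f x) ->
  (forall x, is_derive (f x) (1 : R) h (h' (f x))) ->
  (forall x, differentiable (fun x => h (f x)) x) /\
  partial i (fun x => h (f x)) = (fun x => h' (f x) * partial i f x).
Proof.
move=> df dh.
have dh1 x : differentiable h (f x) by apply/derivable1_diffP; case: (dh x).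
have dc x : differentiable (fun x => h (f x)) x by exact: (differentiable_comp (df x) (dh1 x)).
split => //; apply/funext => x; rewrite /partial (deriveE (f := fun x => h (f x))) //.
rewrite (_ : (fun x => h (f x)) = h \o f)// diff_comp //= -(deriveE (f := f)) //.
set c := 'D_ _ f x; have -> : 'd h (f x) c = c *: 'd h (f x) 1.
  by rewrite -linearZ /=; congr ('d h _ _); rewrite /GRing.scale /= mulr1.
by rewrite -deriveE // (derive_val (is_derive := dh x)) mulrC.
Qed.

Lemma Ck_cst k (c : R) : Ck k (fun=> c).
Proof.
elim: k c => [|k IH] c; first by apply/Ck0 => x.
by apply/CkS; split=> // i; rewrite partial_cst; exact: IH.
Qed.

Lemma CkD k f g : Ck k f -> Ck k g -> Ck k (fun x => f x + g x).
Proof.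
elim: k f g => [|k IH] f g.
  by move=> /Ck0 df /Ck0 dg; apply/Ck0 => x; exact: differentiableD.
move=> /CkS[df hf] /CkS[dg hg]; apply/CkS; split => [x|i].
  exact: differentiableD.
by rewrite partialD//; exact: IH.
Qed.

Lemma CkM k f g : Ck k f -> Ck k g -> Ck k (fun x => f x * g x).
Proof.
elim: k f g => [|k IH] f g.
  by move=> /Ck0 df /Ck0 dg; apply/Ck0 => x; exact: differentiableM.
move=> cf cg; have /CkS[df hf] := cf; have /CkS[dg hg] := cg.
apply/CkS; split => [x|i].
  exact: differentiableM.
by rewrite partialM//; apply: CkD; apply: IH => //; exact: CkW.
Qed.

Lemma Ck_sum k (I : Type) (r : seq I) (F : I -> 'rV[R]_n -> R) :
  (forall j, Ck k (F j)) -> Ck k (fun x => \sum_(j <- r) F j x).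
Proof.
move=> h; elim: r => [|j r IH].
  rewrite (_ : (fun x => _) = fun=> 0); first exact: Ck_cst.
  by apply/funext => x; rewrite big_nil.
rewrite (_ : (fun x => _) = fun x => F j x + \sum_(j <- r) F j x); first exact: CkD.
by apply/funext => x; rewrite big_cons.
Qed.

Lemma is_diff_coord i x : is_diff x (fun y : 'rV[R]_n => y ord0 i) (fun y => y ord0 i).
Proof.
pose f := (fun y : 'rV[R]_n => y ord0 i).
have lf : linear f by move=> a u v; rewrite /f !mxE.
pose F : {linear 'rV[R]_n -> R} := HB.pack f (GRing.isLinear.Build _ _ _ _ _ lf).
have cF : continuous F by move=> y; exact: coord_continuous.
apply: DiffDef; first exact: (linear_differentiable (f := F)).
by rewrite (diff_lin (f := F)).
Qed.

Lemma partial_coord i j : partial i (fun y : 'rV[R]_n => y ord0 j) = (fun=> (i == j)%:R).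
Proof.
apply/funext => x; rewrite /partial.
have d := is_diff_coord j x.
rewrite deriveE; last exact: ex_diff.
by rewrite diff_val mxE eqxx /= eq_sym.
Qed.

Lemma Ck_coord k i : Ck k (fun y : 'rV[R]_n => y ord0 i).
Proof.
case: k => [|k]; first by apply/Ck0 => x; have [] := is_diff_coord i x.
apply/CkS; split=> [x|j]; first by have [] := is_diff_coord i x.
rewrite partial_coord; exact: Ck_cst.
Qed.

(** The squared Euclidean distance: unlike the norm it is smooth at [z], so bumps and barriers are
    built as functions of it. *)
Definition sq (z x : 'rV[R]_n) : R := \sum_(i < n) (x ord0 i - z ord0 i) ^+ 2.

Lemma Ck_sq k z : Ck k (sq z).
Proof.
apply: Ck_sum => j; under eq_fun do rewrite expr2.
by apply: CkM; apply: CkD; (exact: Ck_coord || exact: Ck_cst).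
Qed.

End smooth_functions.

(** * Flat functions and smooth approximation of the positive part *)

Section flat_function.
Context {R : realType}.

(* All the smooth functions needed (bumps, barriers, smooth approximations of
   the positive part and their powers) are built from this family, which is
   closed under derivation. *)
Definition flat (a c t : R) : R :=
  if 0 < t then t `^ a * expR (- c / t) else 0.

Lemma flat_le0 a c t : t <= 0 -> flat a c t = 0.
Proof. by rewrite /flat ltNge => ->. Qed.

Lemma flat_gt0E a c t : 0 < t -> flat a c t = t `^ a * expR (- c / t).
Proof. by rewrite /flat => ->. Qed.

Lemma flat_gt0 a c t : 0 < t -> 0 < flat a c t.
Proof. by move=> t0; rewrite flat_gt0E// mulr_gt0 ?powR_gt0 ?expR_gt0. Qed.

Lemma flat_ge0 a c t : 0 <= flat a c t.
Proof. by rewrite /flat; case: ifPn => // t0; rewrite mulr_ge0 ?powR_ge0 ?expR_ge0. Qed.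

(** The exponential series gives exp x >= x^(m+1) / (m+1)! at x = c / t; take inverses. *)
Lemma expRN_le (c t : R) (m : nat) : 0 < c -> 0 < t ->
  expR (- c / t) <= m.+1`!%:R / c ^+ m.+1 * t ^+ m.+1.
Proof.
move=> c0 t0; have ct : 0 < c / t by rewrite divr_gt0.
have := expR_ge1Dxn m (ltW ct).
rewrite mulNr expRN => h.
have f0 : (0 : R) < m.+1`!%:R by rewrite ltr0n fact_gt0.
have {}h : (c / t) ^+ m.+1 / m.+1`!%:R <= expR (c / t).
  by apply: le_trans h; rewrite lerDr.
rewrite -[leRHS]invrK lef_pV2 ?posrE ?expR_gt0 ?invr_gt0 //; last first.
  by rewrite mulr_gt0 ?divr_gt0 ?exprn_gt0.
apply: le_trans h; rewrite le_eqVlt; apply/orP; left; apply/eqP.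
rewrite expr_div_n; field.
by rewrite !expf_neq0 ?gt_eqF.
Qed.

(** The exponential beats every negative power of [t]. Two spare powers are what a vanishing
    derivative at the origin asks for. *)
Lemma flat_small a c : 0 < c -> exists2 C, 0 < C &
  forall t, 0 < t -> t <= 1 -> flat a c t <= C * t ^+ 2.
Proof.
move=> c0; have [m hm] : exists m : nat, 2 - a <= m.+1%:R.
  exists (Num.truncn `|2 - a|); apply: le_trans (ler_norm _) _.
  by apply: ltW; exact: truncnS_gt.
exists (m.+1`!%:R / c ^+ m.+1).
  by rewrite divr_gt0 ?exprn_gt0 // ltr0n fact_gt0.
move=> t t0 t1; rewrite flat_gt0E//.
apply: (le_trans (ler_wpM2l (powR_ge0 _ _) (expRN_le m c0 t0))).
rewrite mulrCA ler_wpM2l//.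
  by rewrite divr_ge0 ?exprn_ge0 // ltW.
rewrite -!powR_mulrn ?(ltW t0)// -powRD; last by rewrite (gt_eqF t0) implybT.
by apply: ger_powR; [rewrite t0 t1|lra].
Qed.

(** Real powers stay in the family, so p-th powers of bumps are smooth even when [p] is not an
    integer. *)
Lemma flat_powR a c t r : 0 < r -> flat a c t `^ r = flat (a * r) (c * r) t.
Proof.
move=> r0; rewrite /flat; case: ifPn => t0; last by rewrite powR0// gt_eqF.
rewrite powRM ?powR_ge0 ?expR_ge0// -powRrM; congr (_ * _).
rewrite /powR gt_eqF ?expR_gt0// expRK; congr expR; ring.
Qed.

Definition dflat (a c t : R) : R := a * flat (a - 1) c t + c * flat (a - 2) c t.

Lemma is_derive_flat a c t : 0 < c -> is_derive t (1 : R) (flat a c) (dflat a c t).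
Proof.
move=> c0; have [t0|t0|->] := ltgtP t 0.
- have -> : dflat a c t = 0 by rewrite /dflat !flat_le0 ?ltW// !mulr0 addr0.
  apply: (@near_eq_is_derive _ _ _ (cst 0)) => //.
  near=> s; rewrite flat_le0//; apply: ltW; near: s; exact: lt_nbhsl.
- have -> : dflat a c t = a * t `^ (a - 1) * expR (- c / t) +
      t `^ a * (expR (- c / t) * (c / t ^+ 2)).
    rewrite /dflat !flat_gt0E//.
    have -> : t `^ a = t `^ (a - 2) * t ^+ 2.
      rewrite -powR_mulrn ?ltW// -powRD; last by rewrite (gt_eqF t0) implybT.
      by congr powR; ring.
    field; exact: lt0r_neq0.
  apply: (@near_eq_is_derive _ _ _ (fun s => s `^ a * expR (- c / s))) => //.
    near=> s; rewrite flat_gt0E//; near: s; exact: lt_nbhsr.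
  have d1 := is_derive1_powR a t0.
  have d2 : is_derive t (1:R) (fun s => - c / s) (c / t ^+ 2).
    have d0 : is_derive t (1:R) (id : R -> R) 1 by exact: is_derive_id.
    have d1' := is_deriveV (f := id) (lt0r_neq0 t0) d0.
    apply: (is_derive_eq (is_deriveZ (f := fun s : R => s^-1) (- c) d1')); rewrite /GRing.scale /=; ring.
  have d3 : is_derive t (1:R) (fun s => expR (- c / s)) (expR (- c / t) * (c / t ^+ 2)).
    exact: (is_derive1_comp (f := expR) (g := fun s => - c / s)).
  apply: (is_derive_eq (is_deriveM (f := (fun s => s `^ a)) d1 d3)); rewrite /GRing.scale /=; ring.
(* At the origin the difference quotient at [h] is at most C h by [flat_small]. *)
- have -> : dflat a c 0 = 0 by rewrite /dflat !flat_le0 // !mulr0 addr0.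
  have [C C0 hC] := flat_small a c0.
  have h0 : h^-1 *: ((flat a c \o shift 0) (h *: 1) - flat a c 0)
      @[h --> (0 : R)^'] --> (0 : R).
    apply/cvgrPdist_lt => e e0; near=> h.
    have hn0 : h != 0 by near: h; exact: nbhs_dnbhs_neq.
    rewrite /= addr0 /GRing.scale /= mulr1 (@flat_le0 _ _ 0)// subr0 sub0r normrN.
    have [h0|h0] := leP h 0; first by rewrite flat_le0// mulr0 normr0.
    have h1 : `|h| < 1 by near: h; apply: dnbhs0_lt.
    have h2 : `|h| < e / C by near: h; apply: dnbhs0_lt; rewrite divr_gt0.
    rewrite gtr0_norm// in h1 h2.
    rewrite normrM normfV ger0_norm ?flat_ge0// gtr0_norm//.
    rewrite mulrC ltr_pdivrMr//.
    apply: le_lt_trans (hC _ h0 (ltW h1)) _.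
    by rewrite expr2 mulrA ltr_pM2r// mulrC -ltr_pdivlMr.
  apply: DeriveDef; first by apply/cvg_ex; exists 0.
  exact/cvg_lim.
Unshelve. all: by end_near.
Qed.

End flat_function.

Section smooth_compositions.
Context {R : realType} {n : nat}.
Implicit Types (f g : 'rV[R]_n -> R) (i : 'I_n).

Lemma differentiable_comp1 f (h h' : R -> R) : (forall x, differentiable f x) ->
  (forall x, is_derive (f x) (1 : R) h (h' (f x))) ->
  forall x, differentiable (fun x => h (f x)) x.
Proof.
move=> df dh x; apply: (differentiable_comp (df x)).
by apply/derivable1_diffP; case: (dh x).
Qed.

Lemma Ck_flat k a c f : 0 < c -> Ck k f -> Ck k (fun x => flat a c (f x)).
Proof.
move=> c0; elim: k a f => [|k IH] a f hf.
  apply/Ck0; apply: (differentiable_comp1 (h' := dflat a c)); first exact/Ck0.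
  by move=> x; exact: is_derive_flat.
have /CkS[df hf'] := hf; apply/CkS.
have dh x := is_derive_flat a (f x) c0.
split=> [|i]; first exact: (differentiable_comp1 df dh).
have [_ ->] := partial_comp i df dh.
apply: CkM (hf' i); apply: CkD; apply: CkM; try exact: Ck_cst;
  by apply: IH; exact: CkW.
Qed.

Lemma Ck_powR k a f : (forall x, 0 < f x) -> Ck k f -> Ck k (fun x => f x `^ a).
Proof.
move=> f0; elim: k a => [|k IH] a hf.
  apply/Ck0; apply: (differentiable_comp1 (f := f) (h := fun s : R => s `^ a) (h' := fun s => a * s `^ (a - 1))).
    exact/Ck0.
  by move=> x; exact: is_derive1_powR.
have /CkS[df hf'] := hf; apply/CkS.
have dh x := is_derive1_powR a (f0 x).
split=> [|i]; first exact: (differentiable_comp1 (f := f) (h := fun s : R => s `^ a) (h' := fun s => a * s `^ (a - 1)) df dh).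
have [_ ->] := partial_comp (f := f) (h := fun s : R => s `^ a) (h' := fun s => a * s `^ (a - 1)) i df dh.
by apply: CkM (hf' i); apply: CkM; [exact: Ck_cst|apply: IH; exact: CkW].
Qed.

Lemma Ck_ln k f : (forall x, 0 < f x) -> Ck k f -> Ck k (fun x => ln (f x)).
Proof.
move=> f0; case: k => [|k] hf.
  apply/Ck0; apply: (differentiable_comp1 (f := f) (h := fun s : R => ln s) (h' := fun s : R => s^-1)).
    exact/Ck0.
  by move=> x; exact: is_derive1_ln.
have /CkS[df hf'] := hf; apply/CkS.
have dh x := is_derive1_ln (f0 x).
split=> [|i]; first exact: (differentiable_comp1 (f := f) (h := fun s : R => ln s) (h' := fun s : R => s^-1) df dh).
have [_ ->] := partial_comp (f := f) (h := fun s : R => ln s) (h' := fun s : R => s^-1) i df dh.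
apply: CkM (hf' i).
(* The factor 1 / f is a real power, whose regularity is already known. *)
rewrite (_ : (fun x => _) = (fun x => f x `^ (-1))).
  by apply: Ck_powR => //; exact: CkW.
by apply/funext => x; rewrite powR_inv1// ltW.
Qed.

End smooth_compositions.

Section one_variable.
Context {R : realType}.

Lemma lip_derive (g g' : R -> R) (M a b : R) : a <= b ->
  (forall t : R, a <= t <= b -> is_derive t (1 : R) g (g' t)) ->
  (forall t, a <= t <= b -> `|g' t| <= M) -> `|g b - g a| <= M * `|b - a|.
Proof.
move=> ab dg hM.
have [c cab ->] : exists2 c, c \in `[a, b]%R & g b - g a = g' c * (b - a).
  apply: MVT_segment => //.
    by move=> x; rewrite in_itv/= => /andP[? ?]; apply: dg; rewrite !ltW.
  apply: derivable_within_continuous => x; rewrite in_itv/= => xab.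
  by have [] := dg x xab.
rewrite normrM ler_wpM2r//; apply: hM.
by move: cab; rewrite in_itv.
Qed.

Lemma lip_derive_nng (g g' : R -> R) (M : R) :
  (forall t : R, 0 <= t -> is_derive t (1 : R) g (g' t)) ->
  (forall t, 0 <= t -> `|g' t| <= M) ->
  forall s t, 0 <= s -> 0 <= t -> `|g s - g t| <= M * `|s - t|.
Proof.
move=> dg hM s t s0 t0; have [st|/ltW st] := leP t s.
  by apply: (@lip_derive g g') => // x /andP[x1 _]; [apply: dg|apply: hM]; exact: le_trans x1.
rewrite distrC [X in _ * X]distrC.
by apply: (@lip_derive g g') => // x /andP[x1 _]; [apply: dg|apply: hM]; exact: le_trans x1.
Qed.

Lemma lip_deriveT (g g' : R -> R) (M : R) :
  (forall t, is_derive t (1 : R) g (g' t)) -> (forall t, `|g' t| <= M) ->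
  forall s t, `|g s - g t| <= M * `|s - t|.
Proof.
move=> dg hM s t; have [st|/ltW st] := leP t s.
  exact: (@lip_derive g g').
rewrite distrC [X in _ * X]distrC; exact: (@lip_derive g g').
Qed.

Lemma dflat1E (c t : R) : dflat 1 c t = flat 0 c t + c * flat (-1) c t.
Proof. by rewrite /dflat mul1r subrr; congr (_ + _ * flat _ _ _); ring. Qed.

Lemma dflat1_ge0 (c t : R) : 0 < c -> 0 <= dflat 1 c t.
Proof. by move=> c0; rewrite dflat1E addr_ge0 ?mulr_ge0 ?flat_ge0// ltW. Qed.

(** With x = c / t the derivative is (1 + x) exp (- x). The bound is uniform in [c], so compositions
    with [flat 1 c] and their gradients stay dominated as [c] tends to 0. *)
Lemma dflat1_le1 (c t : R) : 0 < c -> dflat 1 c t <= 1.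
Proof.
move=> c0; rewrite dflat1E /flat; case: ifPn => t0; last by rewrite mulr0 addr0.
rewrite powRr0 powR_inv1 ?(ltW t0)// mul1r mulrA.
rewrite -[X in X + _]mul1r -mulrDl mulNr expRN ler_pdivrMr ?expR_gt0// mul1r.
exact: expR_ge1Dx.
Qed.

(** The second derivative is c^2 t^(-3) exp (- c / t), and [expRN_le] with exponent 3 cancels the
    negative power, leaving 3! / c. This degenerates as [c] tends to 0, but the chain rule is only
    applied at fixed [c]. *)
Lemma dflat1_lip (c : R) : 0 < c ->
  forall s t, `|dflat 1 c s - dflat 1 c t| <= 6 / c * `|s - t|.
Proof.
move=> c0.
apply: (@lip_deriveT _ (fun t => c ^+ 2 * flat (-3) c t)) => t; last first.
  rewrite normrM !ger0_norm ?flat_ge0 ?exprn_ge0 ?(ltW c0)//.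
  rewrite /flat; case: ifPn => t0; last by rewrite mulr0 divr_ge0// ltW.
  rewrite powR_invn ?(ltW t0)//.
  have h := expRN_le 2 c0 t0.
  apply: le_trans.
    apply: ler_wpM2l; first by rewrite exprn_ge0// ltW.
    by apply: ler_wpM2l h; rewrite invr_ge0 exprn_ge0// ltW.
  rewrite le_eqVlt; apply/orP; left; apply/eqP.
  rewrite (_ : 3`! = 6)%N//; field.
  by rewrite !gt_eqF.
have d1 := is_derive_flat 0 t c0.
have d2 := is_derive_flat (-1) t c0.
have -> : dflat 1 c = flat 0 c + c \*: flat (-1) c.
  by apply/funext => s; rewrite dflat1E.
apply: (is_derive_eq (is_deriveD d1 (is_deriveZ c d2))).
rewrite /GRing.scale /= /dflat !mul0r add0r.
rewrite (_ : 0 - 2 = -2 :> R); last ring.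
rewrite (_ : -1 - 1 = -2 :> R); last ring.
rewrite (_ : -1 - 2 = -3 :> R); last ring.
ring.
Qed.

Lemma flat_lip1 (c : R) : 0 < c -> forall s t, `|flat 1 c s - flat 1 c t| <= `|s - t|.
Proof.
move=> c0 s t; rewrite -[leRHS]mul1r.
apply: (@lip_deriveT _ (dflat 1 c)) => x; first exact: is_derive_flat.
by rewrite ger0_norm ?dflat1_ge0// dflat1_le1.
Qed.

Lemma cvg_expR_harmonic (c t : R) :
  expR (- (c * harmonic m) / t) @[m --> \oo] --> (1 : R).
Proof.
have -> : (1 : R) = expR (- (c * 0) / t) by rewrite mulr0 oppr0 mul0r expR0.
apply: continuous_cvg; first exact: continuous_expR.
by apply: cvgMl; apply: cvgN; apply: cvgMr; exact: cvg_harmonic.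
Qed.

Lemma cvg_flat (a c t : R) :
  flat a (c * harmonic m) t @[m --> \oo] --> (if 0 < t then t `^ a else 0).
Proof.
rewrite /flat; case: ifPn => t0; last exact: cvg_cst.
rewrite -[X in _ --> X]mulr1; apply: cvgMr; exact: cvg_expR_harmonic.
Qed.

Lemma cvg_flat1 (t : R) : flat 1 (harmonic m) t @[m --> \oo] --> Num.max t 0.
Proof.
have := @cvg_flat 1 1 t; under eq_fun do rewrite mul1r.
suff -> : Num.max t 0 = (if 0 < t then t `^ 1 else 0) by [].
by case: ltP => // t0; rewrite powRr1// ltW.
Qed.

(** The limit is 0 at t = 0. Gradients of positive parts are thus taken to vanish where the function
    is 0, which [W0app_zero_level] exploits. *)
Lemma cvg_dflat1 (t : R) : dflat 1 (harmonic m) t @[m --> \oo] --> ((0 < t)%R%:R : R).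
Proof.
under eq_fun do rewrite dflat1E.
have -> : (0 < t)%R%:R = (if 0 < t then t `^ 0 else 0) + 0 * (if 0 < t then t `^ (-1) else 0).
  by rewrite mul0r addr0 powRr0; case: ifP.
apply: cvgD; first by have := @cvg_flat 0 1 t; under eq_fun do rewrite mul1r.
apply: cvgM; first exact: cvg_harmonic.
by have := @cvg_flat (-1) 1 t; under eq_fun do rewrite mul1r.
Qed.

End one_variable.

Section test_functions.
Context {R : realType} {n : nat}.
Variable Omega : set 'rV[R]_n.
Implicit Types (f g phi psi : 'rV[R]_n -> R) (i : 'I_n).
Local Notation test := (test_function Omega).

Lemma smoothM f g : smooth f -> smooth g -> smooth (fun x : 'rV[R]_n => f x * g x).
Proof. by move=> /smoothP hf /smoothP hg; apply/smoothP => k; exact: CkM. Qed.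

Lemma smoothD f g : smooth f -> smooth g -> smooth (fun x : 'rV[R]_n => f x + g x).
Proof. by move=> /smoothP hf /smoothP hg; apply/smoothP => k; exact: CkD. Qed.

Lemma smooth_cst (c : R) : smooth (fun _ : 'rV[R]_n => c).
Proof. by apply/smoothP => k; exact: Ck_cst. Qed.

Lemma smooth_diff f x : smooth f -> differentiable f (x : 'rV[R]_n).
Proof. by move=> h; exact: (h [::]). Qed.

Lemma smooth_partial i f : smooth f -> smooth (partial i f).
Proof. by move=> /smoothP h; apply/smoothP => k; have /CkS[] := h k.+1. Qed.

Lemma smooth_continuous f : smooth f -> continuous (f : 'rV[R]_n -> R).
Proof. by move=> h x; apply: differentiable_continuous; exact: smooth_diff. Qed.

(** Any compact subset of [Omega] off which the function vanishes can replace the closed support;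
    such a set is easily carried through products and compositions. *)
Lemma testP phi : test phi <-> smooth phi /\ exists K : set 'rV[R]_n,
  [/\ compact K, K `<=` Omega & forall x, ~ K x -> phi x = 0].
Proof.
split=> [[sp cp pO]|[sp [K [cK KO hK]]]].
  split => //; exists (closure [set x | phi x != 0]); split => // x nx.
  by apply: contrapT => /eqP h; apply: nx; apply: subset_closure.
have clK : closed K by apply: compact_closed cK; exact: norm_hausdorff.
have sK : closure [set x | phi x != 0] `<=` K.
  rewrite closure_id in clK; rewrite clK; apply: closure_subset => x /= /eqP h.
  by apply: contrapT => /hK.
split => //; last exact: subset_trans KO.
apply: (subclosed_compact _ cK sK); exact: closed_closure.
Qed.

Lemma test_smooth phi : test phi -> smooth phi.
Proof. by case. Qed.

Lemma testM f phi : smooth f -> test phi -> test (fun x => f x * phi x).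
Proof.
move=> sf /testP[sp [K [cK KO hK]]]; apply/testP; split; first exact: smoothM.
by exists K; split => // x /hK ->; rewrite mulr0.
Qed.

Lemma testD phi psi : test phi -> test psi -> test (fun x => phi x + psi x).
Proof.
move=> /testP[sp [K [cK KO hK]]] /testP[sq [L [cL LO hL]]].
apply/testP; split; first exact: smoothD.
exists (K `|` L); split; first exact: compactU.
  by rewrite subUset.
by move=> x /not_orP[/hK -> /hL ->]; rewrite addr0.
Qed.

Lemma testZ (c : R) phi : test phi -> test (fun x => c * phi x).
Proof. by move=> h; apply: testM h; exact: smooth_cst. Qed.

Lemma test_comp phi (h : R -> R) : test phi -> smooth (fun x => h (phi x)) ->
  h 0 = 0 -> test (fun x => h (phi x)).
Proof.
move=> /testP[sp [K [cK KO hK]]] sh h0; apply/testP; split => //.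
by exists K; split => // x /hK ->.
Qed.

Lemma test_partial i phi : test phi -> test (partial i phi).
Proof.
move=> /testP[sp [K [cK KO hK]]]; apply/testP; split; first exact: smooth_partial.
exists K; split => // x nKx.
have clK : closed K by apply: compact_closed cK; exact: norm_hausdorff.
rewrite /partial (@near_eq_derive _ _ _ _ (cst 0)) ?derive_cst//.
have : nbhs x (~` K) by apply: open_nbhs_nbhs; split => //; exact: closed_openC.
by apply: filterS => y /hK.
Qed.

Lemma test_bounded phi : test phi -> exists M, forall x, `|phi x| <= M.
Proof.
move=> /testP[sp [K [cK KO hK]]].
have cphi := smooth_continuous sp.
have : compact (phi @` K).
  by apply: continuous_compact => //; exact: continuous_subspaceT.
move=> /compact_bounded[M [_ hM]].
exists (`|M| + 1) => x.
have [/(imageP phi) Kx|nx] := pselect (K x).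
  apply: (hM _ _ _ Kx); apply: le_lt_trans (_ : M <= `|M|) _; last by rewrite ltrDl.
  exact: ler_norm.
by rewrite hK// normr0 addr_ge0.
Qed.

Lemma partial_sq i (z x : 'rV[R]_n) : partial i (sq z) x = 2 * (x ord0 i - z ord0 i).
Proof.
have dj j y : differentiable (fun y : 'rV[R]_n => y ord0 j - z ord0 j) y.
  by apply: (@Ck_diff _ _ 0); apply: CkD; [exact: Ck_coord|exact: Ck_cst].
have pj j : partial i (fun y : 'rV[R]_n => y ord0 j - z ord0 j) = fun=> (i == j)%:R.
  rewrite partialD => [|y|y].
  - by rewrite partial_coord partial_cst; apply/funext => y; rewrite addr0.
  - by apply: (@Ck_diff _ _ 0); exact: Ck_coord.
  - by apply: (@Ck_diff _ _ 0); exact: Ck_cst.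
have -> : sq z = \sum_(j < n) (fun y : 'rV[R]_n => (y ord0 j - z ord0 j) * (y ord0 j - z ord0 j)).
  by apply/funext => y; rewrite fct_sumE; apply: eq_bigr => j _; rewrite expr2.
rewrite /partial derive_sum; last first.
  by move=> j; apply: diff_derivable; apply: differentiableM; exact: dj.
rewrite (bigD1 i)//= big1 ?addr0 => [|j ji].
  have /(congr1 (@^~ x)) := partialM i (dj i) (dj i).
  by rewrite /partial => ->; rewrite -!partialE !pj eqxx /=; ring.
have /(congr1 (@^~ x)) := partialM i (dj j) (dj j).
by rewrite /partial => ->; rewrite -!partialE !pj eq_sym (negbTE ji) /=; ring.
Qed.

Lemma smooth_sq z : smooth (@sq R n z).
Proof. by apply/smoothP => k; exact: Ck_sq. Qed.

Lemma sq_ge0 (z x : 'rV[R]_n) : 0 <= sq z x.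
Proof. by apply: sumr_ge0 => j _; exact: sqr_ge0. Qed.

Lemma le_sq (z x : 'rV[R]_n) i : (x ord0 i - z ord0 i) ^+ 2 <= sq z x.
Proof.
by rewrite /sq (bigD1 i)//= lerDl; apply: sumr_ge0 => j _; exact: sqr_ge0.
Qed.

Lemma compact_sq (z : 'rV[R]_n) r : compact [set x | sq z x <= r].
Proof.
have cl : closed [set x | sq z x <= r].
  apply: (@preimage_closed _ _ (sq z) [set y | y <= r]).
    by move=> x _; exact/smooth_continuous/smooth_sq.
  exact: closed_le.
(* Chosen so that r <= M^2. *)
pose M := `|r| + 1.
have cK : compact [set v : 'rV[R]_n | forall i, `[z ord0 i - M, z ord0 i + M]%classic (v ord0 i)].
  apply: (@rV_compact _ _ (fun i => `[z ord0 i - M, z ord0 i + M]%classic)) => i.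
  exact: segment_compact.
apply: (subclosed_compact cl cK); move=> x /= xr i; rewrite in_itv/= -ler_distlC.
have h : (x ord0 i - z ord0 i) ^+ 2 <= r := le_trans (le_sq z x i) xr.
have M0 : 0 <= M by rewrite addr_ge0.
rewrite distrC -(@ler_pXn2r _ 2)// ?nnegrE//.
rewrite real_normK ?num_real//; apply: le_trans h _; rewrite /M.
have := ler_norm r; have := normr_ge0 r; nra.
Qed.

Lemma open_sq_sub (z : 'rV[R]_n) : open Omega -> Omega z ->
  exists2 r, 0 < r & [set x | sq z x <= r ^+ 2] `<=` Omega.
Proof.
move=> oO Oz; have [e /= e0 eA] : nbhs_ball z Omega by apply/nbhs_ballP/open_nbhs_nbhs.
exists (e / 2) => [|x /= xe]; first by rewrite divr_gt0.
apply: eA; split => // a i; rewrite ord1 /ball /=.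
have := le_trans (le_sq z x i) xe.
rewrite -real_normK ?num_real// ler_pXn2r ?nnegrE// ?divr_ge0 ?(ltW e0)// distrC => h.
by apply: le_lt_trans h _; lra.
Qed.

Lemma ball_sq (z x : 'rV[R]_n) r : 0 <= r ->
  (forall i, `|x ord0 i - z ord0 i| <= r) -> sq z x <= n%:R * r ^+ 2.
Proof.
move=> r0 h; apply: (@le_trans _ _ (\sum_(i < n) r ^+ 2)).
  by apply: ler_sum => i _; rewrite -real_normK ?num_real// ler_pXn2r ?nnegrE.
by rewrite sumr_const card_ord mulr_natl.
Qed.

(** This provides the bumps of the local estimates as well as the barrier and its flux. *)
Lemma test_flat_sq a c (z : 'rV[R]_n) r : 0 < c ->
  [set x | sq z x <= r] `<=` Omega -> test (fun x => flat a c (r - sq z x)).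
Proof.
move=> c0 h; apply/testP; split.
  apply/smoothP => k; apply: Ck_flat => //; apply: CkD; first exact: Ck_cst.
  rewrite (_ : (fun x => - _) = (fun x => -1 * sq z x)).
    by apply: CkM; [exact: Ck_cst|exact: Ck_sq].
  by apply/funext => x; rewrite mulN1r.
exists [set x | sq z x <= r]; split => //; first exact: compact_sq.
by move=> x /= /negP; rewrite -ltNge => rx; rewrite flat_le0// subr_le0 ltW.
Qed.

End test_functions.

(** * Integrals over boxes *)

Section slices.
Context {R : realType}.
Local Notation mu := (@lebesgue_rV R).

Lemma continuous_rV n (T : topologicalType) (f : T -> 'rV[R]_n) :
  (forall i, continuous (fun t => f t ord0 i)) -> continuous f.
Proof.
move=> h t; apply/cvg_ballP => e e0; have : \forall s \near nbhs t, forall i, ball (f t ord0 i) e (f s ord0 i).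
  by apply: filter_forall => i; have /cvg_ballP := h i t; exact.
by apply: filterS => s hs; split => // a i; rewrite ord1.
Qed.

Lemma continuous_rVcons_r n (x : R) : continuous (fun v : 'rV[R]_n => rVcons (x, v)).
Proof.
apply: continuous_rV => i; under eq_fun do rewrite mxE.
case: (unlift ord0 i) => [j|] v; [exact: (@coord_continuous R 1 n ord0 j v)|exact: (@cst_continuous _ _ x)].
Qed.

Lemma continuous_rVcons_l n (v : 'rV[R]_n) : continuous (fun x : R => rVcons (x, v)).
Proof.
apply: continuous_rV => i; under eq_fun do rewrite mxE.
case: (unlift ord0 i) => [j|] x; [exact: (@cst_continuous _ _ (v ord0 j))|by move=> A].
Qed.

Lemma rVconsDl n (x h : R) (v : 'rV[R]_n) :
  h *: delta_mx ord0 ord0 + rVcons (x, v) = rVcons (h * 1 + x, v).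
Proof.
apply/rowP => i; rewrite !mxE /=; case: unliftP => [j ->|->] //=.
  by rewrite mulr0 add0r.
Qed.

Lemma rVconsDr n (x h : R) (v : 'rV[R]_n) j :
  h *: delta_mx ord0 (lift ord0 j) + rVcons (x, v) =
  rVcons (x, h *: delta_mx ord0 j + v).
Proof.
apply/rowP => i; rewrite !mxE /=; case: unliftP => [k ->|->] //=.
  by rewrite !mxE /= (inj_eq lift_inj).
by rewrite mulr0 add0r.
Qed.

(* C^1 functions, with derivatives along the axes only: a class which is
   obviously stable under restriction to coordinate slices. *)
Definition axis_C1 n (f : 'rV[R]_n -> R) : Prop :=
  [/\ continuous f, forall i x, derivable f x (delta_mx ord0 i) &
      forall i, continuous (partial i f)].

Lemma smooth_axis_C1 n (f : 'rV[R]_n -> R) : smooth f -> axis_C1 f.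
Proof.
move=> sf; split; first exact: smooth_continuous.
  by move=> i x; apply: diff_derivable; exact: smooth_diff.
by move=> i; apply: smooth_continuous; exact: smooth_partial.
Qed.

Lemma partial_slice n (f : 'rV[R]_n.+1 -> R) (x : R) j (v : 'rV[R]_n) :
  partial j (fun v => f (rVcons (x, v))) v = partial (lift ord0 j) f (rVcons (x, v)).
Proof.
by rewrite /partial /derive /=; under [in RHS]eq_fun do rewrite rVconsDr.
Qed.

Lemma axis_C1_slice n (f : 'rV[R]_n.+1 -> R) (x : R) : axis_C1 f ->
  axis_C1 (fun v : 'rV[R]_n => f (rVcons (x, v))).
Proof.
move=> [cf df cdf]; split.
- by move=> v; apply: (continuous_comp (@continuous_rVcons_r n x v)); exact: cf.
- move=> j v; have := df (lift ord0 j) (rVcons (x, v)); rewrite /derivable /=.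
  by under eq_fun do rewrite rVconsDr.
- move=> j; rewrite (_ : partial j _ = fun v => partial (lift ord0 j) f (rVcons (x, v))).
    by move=> v; apply: (continuous_comp (@continuous_rVcons_r n x v)); exact: cdf.
  by apply/funext => v; exact: partial_slice.
Qed.

Lemma is_derive_slice n (f : 'rV[R]_n.+1 -> R) (v : 'rV[R]_n) (x : R) : axis_C1 f ->
  is_derive x (1 : R) (fun t => f (rVcons (t, v))) (partial ord0 f (rVcons (x, v))).
Proof.
move=> [_ df _]; have := df ord0 (rVcons (x, v)); rewrite /derivable /= => h.
apply: DeriveDef.
  by rewrite /derivable /=; move: h; under eq_fun do rewrite rVconsDl.
by rewrite /partial /derive /=; under [in RHS]eq_fun do rewrite rVconsDl.
Qed.

Lemma measurable_continuous_rV n (f : 'rV[R]_n -> R) : continuous f -> measurable_fun setT f.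
Proof.
move=> /continuousP cf; apply: (measurability _ (RGenOpens.measurableE R)).
move=> _ [_ [a [b ->] <-]]; rewrite setTI; apply: open_measurable_rV; apply: cf.
exact: interval_open.
Qed.

Lemma FTC_slice n (f : 'rV[R]_n.+1 -> R) (v : 'rV[R]_n) (a b M : R) : axis_C1 f -> a < b ->
  (\int[lebesgue_measure]_(x in `[a, b]) (partial ord0 f (rVcons (x, v)) + M)%:E =
   (f (rVcons (b, v)) - f (rVcons (a, v)) + M * (b - a))%:E)%E.
Proof.
move=> Cf ab; have [cf df cdf] := Cf.
pose F t := f (rVcons (t, v)) + M * t.
have dF t : is_derive t (1 : R) F (partial ord0 f (rVcons (t, v)) + M).
  have d0 : is_derive t (1 : R) (id : R -> R) 1 by exact: is_derive_id.
  apply: (is_derive_eq (is_deriveD (is_derive_slice v t Cf) (is_deriveZ (f := id : R -> R) M d0))).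
  by rewrite /GRing.scale /= mulr1.
rewrite (_ : f _ - _ + _ = F b - F a); last by rewrite /F; ring.
rewrite EFinB; apply: (@continuous_FTC2 R _ F) => //.
- apply: continuous_subspaceT => x; apply: cvgD; last exact: cvg_cst.
  by apply: (continuous_comp (@continuous_rVcons_l n v x)); exact: cdf.
- have c : continuous F.
    move=> x; apply: cvgD; last by apply: cvgMr; exact: cvg_id.
    by apply: (continuous_comp (@continuous_rVcons_l n v x)); exact: cf.
  split.
  + by move=> x _; have [] := dF x.
  + exact/cvg_at_right_filter/c.
  + exact/cvg_at_left_filter/c.
- by move=> x _; rewrite derive1E; have [] := dF x.
Qed.

Local Open Scope ereal_scope.

(** [lebesgue_rV n.+1] is by construction the image of a product measure under [rVcons], so a change
    of variables reduces both formulas to Tonelli's theorem. *)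
Lemma tonelli_rV n (F : 'rV[R]_n.+1 -> \bar R) : measurable_fun setT F ->
  (forall x, 0 <= F x) ->
  \int[mu n.+1]_x F x =
    \int[lebesgue_measure]_x \int[mu n]_v F (rVcons (x, v)) /\
  \int[mu n.+1]_x F x =
    \int[mu n]_v \int[lebesgue_measure]_x F (rVcons (x, v)).
Proof.
move=> mF F0.
have mr : measurable_fun (setT : set (measurableTypeR R * 'rV[R]_n)) (@rVcons R n).
  move=> _ Y mY; exact: (@measurable_rVcons R n measurableT Y mY).
have mc : measurable_fun (setT : set (measurableTypeR R * 'rV[R]_n)) (F \o @rVcons R n).
  exact: measurableT_comp.
have h := @ge0_integral_pushforward _ _ _ _ R _ mr
    (lebesgue_measure \x mu n) setT F measurableT mF (fun y _ => F0 y).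
rewrite preimage_setT in h.
have -> : \int[mu n.+1]_x F x = \int[lebesgue_measure \x mu n]_z (F \o @rVcons R n) z.
  exact: h.
split.
  have := @fubini_tonelli1 _ _ _ _ R lebesgue_measure (mu n) _ mc (fun z => F0 _).
  exact.
have := @fubini_tonelli2 _ _ _ _ R lebesgue_measure (mu n) _ mc (fun z => F0 _).
exact.
Qed.

Definition box n (a : 'rV[R]_n) (l : R) : set 'rV[R]_n :=
  [set v | forall i, v ord0 i \in `[a ord0 i, a ord0 i + l]%R].

Lemma measurable_box n (a : 'rV[R]_n) l : measurable (box a l).
Proof.
have -> : box a l = \big[setI/setT]_(i < n) (@rV_coord R n i @^-1` `[a ord0 i, (a ord0 i + l)%R]).
  rewrite -bigcap_seq; apply/seteqP; split => v /= h i; first by move=> _; exact: h.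
  by apply: h => /=; rewrite mem_index_enum.
apply: bigsetI_measurable => i _.
by rewrite -[X in measurable X]setTI; exact: measurable_rV_coord.
Qed.

Lemma mu_box n (a : 'rV[R]_n) l : (0 <= l)%R -> mu n (box a l) = (l ^+ n)%:E.
Proof.
move=> l0.
have h := @lebesgue_rV_box R n (fun i => `[a ord0 i, (a ord0 i + l)%R]%classic)
  (fun i => measurable_itv _).
apply: (eq_trans h).
rewrite (eq_bigr (fun=> l%:E)) => [|i _].
  by rewrite big_const_ord; elim: n {a h} => [|n IH] //=; rewrite IH exprS EFinM.
rewrite lebesgue_measure_itv /= lte_fin ltrDl.
case: ifPn => [_|]; first by rewrite -EFinD addrAC subrr add0r.
by rewrite -leNgt => l1; congr (_%:E); apply/eqP; rewrite eq_le l0 l1.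
Qed.

Lemma box_cons n (a : 'rV[R]_n.+1) l x v : box a l (rVcons (x, v)) <->
  (x \in `[a ord0 ord0, a ord0 ord0 + l]%R) /\ box (rVuncons a).2 l v.
Proof.
split=> [h|[h1 h2] i].
  split; first by have := h ord0; rewrite mxE unlift_none.
  by move=> i; have := h (lift ord0 i); rewrite !mxE liftK.
rewrite mxE; case: unliftP => [j ->|->]//=.
by have := h2 j; rewrite !mxE.
Qed.

Lemma tonelli_box n (a : 'rV[R]_n.+1) l (F : 'rV[R]_n.+1 -> \bar R) :
  measurable_fun setT F -> (forall x, 0 <= F x) ->
  let I := `[a ord0 ord0, (a ord0 ord0 + l)%R]%classic in
  \int[mu n.+1]_(x in box a l) F x =
    \int[lebesgue_measure]_(x in I) \int[mu n]_(v in box (rVuncons a).2 l) F (rVcons (x, v)) /\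
  \int[mu n.+1]_(x in box a l) F x =
    \int[mu n]_(v in box (rVuncons a).2 l) \int[lebesgue_measure]_(x in I) F (rVcons (x, v)).
Proof.
move=> mF F0 I.
have mFb : measurable_fun setT (F \_ (box a l)).
  apply/(measurable_restrict _ (measurable_box a l)) => //; rewrite setTI.
  exact: measurable_funTS.
have Fb0 x : 0 <= (F \_ (box a l)) x by exact: erestrict_ge0.
have [h1 h2] := tonelli_rV mFb Fb0.
have E x v : (F \_ (box a l)) (rVcons (x, v)) =
    if (x \in I) && (v \in box (rVuncons a).2 l) then F (rVcons (x, v)) else 0.
  rewrite patchE; have -> // : (rVcons (x, v) \in box a l) =
    ((x \in I) && (v \in box (rVuncons a).2 l)).
  apply/idP/idP.
    by move=> /set_mem/box_cons[xI vb]; apply/andP; split; apply/mem_set.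
  by move=> /andP[/set_mem xI /set_mem vb]; apply/mem_set/box_cons.
split; rewrite integral_mkcond.
  rewrite h1 [RHS]integral_mkcond; apply: eq_integral => x _.
  rewrite patchE; under eq_integral do rewrite E.
  case: ifPn => xI /=; last by rewrite integral0_eq.
  by rewrite [RHS]integral_mkcond; apply: eq_integral => v _; rewrite patchE.
rewrite h2 [RHS]integral_mkcond; apply: eq_integral => v _.
rewrite patchE; under eq_integral do rewrite E.
case: ifPn => xI /=; last by rewrite integral0_eq// => x _; rewrite andbF.
by rewrite [RHS]integral_mkcond; apply: eq_integral => x _; rewrite patchE andbT.
Qed.

End slices.

Section box_calculus.
Context {R : realType}.
Local Notation mu := (@lebesgue_rV R).
Local Open Scope ereal_scope.

Lemma integral_box_cst n (a : 'rV[R]_n) (l c : R) : (0 <= l)%R ->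
  \int[mu n]_(x in box a l) c%:E = (c * l ^+ n)%:E.
Proof.
move=> l0; rewrite integral_cst; last exact: measurable_box.
by rewrite EFinM; congr (_ * _); exact: mu_box.
Qed.

Lemma integral_itv_cst (a l c : R) : (0 <= l)%R ->
  \int[lebesgue_measure]_(x in `[a, (a + l)%R]) c%:E = (c * l)%:E.
Proof.
move=> l0; rewrite integral_cst//= lebesgue_measure_itv /= lte_fin ltrDl.
case: ifPn => [_|]; first by rewrite -EFinD addrAC subrr add0r.
by rewrite -leNgt => l1; have -> : l = 0%R; rewrite ?mulr0 ?mule0//; apply/eqP; rewrite eq_le l0 l1.
Qed.

(* [M] makes the integrand nonnegative, so that Tonelli suffices. *)
Lemma integral_partial_box n (a : 'rV[R]_n) (l M : R) (f : 'rV[R]_n -> R) i :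
  (0 < l)%R -> axis_C1 f ->
  (forall (x : 'rV[R]_n) j, x ord0 j <= a ord0 j \/ a ord0 j + l <= x ord0 j -> f x = 0)%R ->
  (forall x, 0 <= partial i f x + M)%R ->
  \int[mu n]_(x in box a l) (partial i f x + M)%:E = (M * l ^+ n)%:E.
Proof.
move=> l0; elim: n a M f i => [|n IH] a M f i Cf f0 fM; first by case: (i).
have [_ _ cdf] := Cf.
have mF : measurable_fun setT (fun x => (partial i f x + M)%:E).
  apply/measurable_EFinP; apply: measurable_funD => //.
  exact: measurable_continuous_rV.
have F0 x : 0 <= (partial i f x + M)%:E by rewrite lee_fin.
have [h1 h2] := tonelli_box a l mF F0.
(* A derivative along a later axis is a derivative of the slices, handled by induction. Along the
   first axis, that variable is integrated first and the boundary terms vanish. *)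
case: (unliftP ord0 i) => [j ij|i0]; last subst i.
  rewrite h1.
  transitivity (\int[lebesgue_measure]_(x in `[a ord0 ord0, (a ord0 ord0 + l)%R])
    (M * l ^+ n)%:E).
    apply: eq_integral => x _.
    rewrite -(IH (rVuncons a).2 M (fun v => f (rVcons (x, v))) j).
    - by apply: eq_integral => v _; rewrite ij partial_slice.
    - exact: axis_C1_slice.
    - by move=> v k; rewrite mxE => h; apply: (f0 _ (lift ord0 k)); rewrite mxE liftK.
    - by move=> v; rewrite partial_slice -ij.
  by rewrite integral_itv_cst ?ltW// exprSr mulrA.
rewrite h2 exprS mulrA -(integral_box_cst (rVuncons a).2) ?ltW//.
apply: eq_integral => v _; rewrite FTC_slice//; last by rewrite ltrDl.
rewrite (f0 _ ord0); last by right; rewrite mxE unlift_none.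
rewrite (f0 _ ord0); last by left; rewrite mxE unlift_none.
by congr (_%:E); ring.
Qed.

Lemma measurable_inner_integral n (D : set 'rV[R]_n) (G : 'rV[R]_n * 'rV[R]_n -> \bar R) :
  measurable D -> measurable_fun setT G -> (forall z, 0 <= G z) ->
  measurable_fun setT (fun x => \int[mu n]_(y in D) G (x, y)).
Proof.
move=> mD mG G0.
have mSD : measurable (setT `*` D : set ('rV[R]_n * 'rV[R]_n)) by exact: measurableX.
have mG' : measurable_fun setT (G \_ (setT `*` D)).
  apply/(measurable_restrict _ mSD) => //; rewrite setTI; exact: measurable_funTS.
have G'0 z : 0 <= (G \_ (setT `*` D)) z by exact: erestrict_ge0.
have := @measurable_fun_fubini_tonelli_F _ _ _ _ R (mu n) _ mG' G'0.
apply: eq_measurable_fun => x _; rewrite /fubini_F [RHS]integral_mkcond.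
apply: eq_integral => y _; rewrite !patchE; congr (if _ then _ else _).
apply/idP/idP; first by move=> /set_mem [_ yD]; exact/mem_set.
by move=> /set_mem yD; exact/mem_set.
Qed.

(** The integral of a nonnegative function is a supremum over the simple functions below it, hence
    monotone without measurability. This spares many side conditions on iterated integrals. *)
Lemma le_ge0_integral d (T : measurableType d) (m : {measure set T -> \bar R})
    (D : set T) (f1 f2 : T -> \bar R) :
  (forall x, D x -> 0 <= f1 x) -> (forall x, D x -> f1 x <= f2 x) ->
  \int[m]_(x in D) f1 x <= \int[m]_(x in D) f2 x.
Proof.
move=> f0 f12; rewrite !ge0_integralE//; last by move=> x Dx; exact: le_trans (f0 x Dx) (f12 x Dx).
apply: le_ereal_sup => _ [h hf <-]; exists h => // x.
apply: le_trans (hf x) _; rewrite !patchE; case: ifPn => // /set_mem; exact: f12.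
Qed.

Lemma measurable_slice_integral n (B : set 'rV[R]_n) (F : 'rV[R]_n.+1 -> \bar R) :
  measurable B -> measurable_fun setT F -> (forall x, 0 <= F x) ->
  measurable_fun (setT : set (measurableTypeR R))
    (fun x => \int[mu n]_(v in B) F (rVcons (x, v))).
Proof.
move=> mB mF F0.
have mr : measurable_fun (setT : set (measurableTypeR R * 'rV[R]_n)) (@rVcons R n).
  move=> _ Y mY; exact: (@measurable_rVcons R n measurableT Y mY).
have mSB : measurable (setT `*` B : set (measurableTypeR R * 'rV[R]_n)).
  exact: measurableX.
have mG : measurable_fun setT ((fun z : measurableTypeR R * 'rV[R]_n => F (rVcons z)) \_ (setT `*` B)).
  apply/(measurable_restrict _ mSB) => //; rewrite setTI.
  by apply: measurable_funTS; exact: measurableT_comp.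
have G0 z : 0 <= ((fun z : measurableTypeR R * 'rV[R]_n => F (rVcons z)) \_ (setT `*` B)) z.
  exact: erestrict_ge0.
have := @measurable_fun_fubini_tonelli_F _ _ _ _ R (mu n) _ mG G0.
apply: eq_measurable_fun => x _; rewrite /fubini_F [RHS]integral_mkcond.
apply: eq_integral => y _; rewrite !patchE; congr (if _ then _ else _).
apply/idP/idP; first by move=> /set_mem [_ yD]; exact/mem_set.
by move=> /set_mem yD; exact/mem_set.
Qed.

Lemma measurable_slice_integral_l n (I : set (measurableTypeR R)) (F : 'rV[R]_n.+1 -> \bar R) :
  measurable I -> measurable_fun setT F -> (forall x, 0 <= F x) ->
  measurable_fun setT (fun v => \int[lebesgue_measure]_(x in I) F (rVcons (x, v))).
Proof.
move=> mI mF F0.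
have mr : measurable_fun (setT : set (measurableTypeR R * 'rV[R]_n)) (@rVcons R n).
  move=> _ Y mY; exact: (@measurable_rVcons R n measurableT Y mY).
have mSB : measurable (I `*` setT : set (measurableTypeR R * 'rV[R]_n)).
  exact: measurableX.
have mG : measurable_fun setT ((fun z : measurableTypeR R * 'rV[R]_n => F (rVcons z)) \_ (I `*` setT)).
  apply/(measurable_restrict _ mSB) => //; rewrite setTI.
  by apply: measurable_funTS; exact: measurableT_comp.
have G0 z : 0 <= ((fun z : measurableTypeR R * 'rV[R]_n => F (rVcons z)) \_ (I `*` setT)) z.
  exact: erestrict_ge0.
have := @measurable_fun_fubini_tonelli_G _ _ _ _ R lebesgue_measure _ mG G0.
apply: eq_measurable_fun => x _; rewrite /fubini_G [RHS]integral_mkcond.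
apply: eq_integral => y _; rewrite !patchE; congr (if _ then _ else _).
apply/idP/idP; first by move=> /set_mem [yD _]; exact/mem_set.
by move=> /set_mem yD; exact/mem_set.
Qed.

Lemma integral_box_ecst n (a : 'rV[R]_n) (l : R) (c : \bar R) : (0 <= l)%R ->
  \int[mu n]_(x in box a l) c = (l ^+ n)%:E * c.
Proof.
move=> l0; rewrite integral_cst; last exact: measurable_box.
by rewrite muleC; congr (_ * _); exact: mu_box.
Qed.

Lemma integral_itv_ecst (a l : R) (c : \bar R) : (0 <= l)%R ->
  \int[lebesgue_measure]_(x in `[a, (a + l)%R]) c = l%:E * c.
Proof.
move=> l0; rewrite integral_cst//= muleC; congr (_ * _).
have := integral_itv_cst a 1 l0; rewrite integral_cst// mul1e mul1r; exact.
Qed.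

Lemma le_FTC_slice n (f : 'rV[R]_n.+1 -> R) (v : 'rV[R]_n) (a b : R) s t :
  axis_C1 f -> (a <= s <= b)%R -> (a <= t <= b)%R ->
  (`|f (rVcons (s, v)) - f (rVcons (t, v))|%R)%:E <=
  \int[lebesgue_measure]_(x in `[a, b]) (`|partial ord0 f (rVcons (x, v))|%R)%:E.
Proof.
move=> Cf; have [cf df cdf] := Cf.
wlog st : s t / (s < t)%R => [H|] hs ht.
  have [st|ts|->] := ltgtP s t; first exact: H.
    by rewrite distrC; exact: H.
  by rewrite subrr normr0; apply: integral_ge0.
have cpf : continuous (fun x => partial ord0 f (rVcons (x, v))).
  by move=> x; apply: (continuous_comp (@continuous_rVcons_l R n v x)); exact: cdf.
have h := FTC_slice v 0 Cf st.
rewrite mul0r addr0 in h.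
have {}h : (`|f (rVcons (s, v)) - f (rVcons (t, v))|%R)%:E =
   `| \int[lebesgue_measure]_(x in `[s, t]) (partial ord0 f (rVcons (x, v)))%:E |.
  rewrite distrC -abse_EFin -h; congr (`| _ |).
  by apply: eq_integral => x _; rewrite addr0.
rewrite h; apply: le_trans (le_abse_integral _ _ _) _ => //.
  apply/measurable_EFinP; apply: measurable_funTS; exact: continuous_measurable_fun.
apply: ge0_subset_integral => //.
  by apply/measurable_EFinP; apply: measurable_funTS; apply: measurableT_comp => //; exact: continuous_measurable_fun.
move=> x /=; rewrite !in_itv/= => /andP[sx xt].
move: hs ht => /andP[h1 _] /andP[_ h4].
by rewrite (le_trans h1 sx) (le_trans xt h4).
Qed.

(** Induction on the dimension, moving one coordinate at a time: |f (x, x') - f (y0, y')| is at most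
    |f (x, x') - f (x, y')|, a difference inside one slice, plus the integral of |partial ord0 f|
    along the segment over y'. The double integral avoids mean values altogether. *)
Lemma poincare_box n (a : 'rV[R]_n) (l : R) (f : 'rV[R]_n -> R) :
  (0 < l)%R -> axis_C1 f ->
  \int[mu n]_(x in box a l) \int[mu n]_(y in box a l) (`|f x - f y|%R)%:E <=
  (l ^+ n.+1)%:E * \sum_(i < n) \int[mu n]_(x in box a l) (`|partial i f x|%R)%:E.
Proof.
move=> l0; elim: n a f => [|n IH] a f Cf.
  rewrite big_ord0 mule0 le_eqVlt; apply/orP; left; apply/eqP.
  rewrite integral0_eq// => x _; rewrite integral0_eq// => y _.
  by rewrite (_ : x = y) ?subrr ?normr0//; apply/rowP; case.
have [cf df cdf] := Cf.
set I := `[a ord0 ord0, (a ord0 ord0 + l)%R]%classic.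
set B := box (rVuncons a).2 l.
have mB : measurable B by exact: measurable_box.
pose T i := \int[mu n.+1]_(x in box a l) (`|partial i f x|%R)%:E.
have T0 i : 0 <= T i by apply: integral_ge0.
have mf : measurable_fun setT f by exact: measurable_continuous_rV.
have mp i : measurable_fun setT (fun x => (`|partial i f x|%R)%:E).
  apply/measurable_EFinP; apply: measurableT_comp => //.
  exact: measurable_continuous_rV.
pose G (z : 'rV[R]_n.+1 * 'rV[R]_n.+1) := (`|f z.1 - f z.2|%R)%:E.
have mG : measurable_fun setT G.
  apply/measurable_EFinP; apply: measurableT_comp => //; apply: measurable_funB.
    exact: (measurableT_comp mf measurable_fst).
  exact: (measurableT_comp mf measurable_snd).
have G0 z : 0 <= G z by rewrite lee_fin.
have mPhi := measurable_inner_integral (measurable_box a l) mG G0.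
have Phi0 x : 0 <= \int[mu n.+1]_(y in box a l) G (x, y) by apply: integral_ge0 => y _; exact: G0.
rewrite (tonelli_box a l mPhi Phi0).1.
pose alpha x x' := \int[mu n]_(y in B) (`|f (rVcons (x, x')) - f (rVcons (x, y))|%R)%:E.
have alpha0 x x' : 0 <= alpha x x' by apply: integral_ge0.
pose S (j : 'I_n) x := \int[mu n]_(v in B) (`|partial (lift ord0 j) f (rVcons (x, v))|%R)%:E.
have S0 j x : 0 <= S j x by apply: integral_ge0.
pose D (y : 'rV[R]_n) := \int[lebesgue_measure]_(t in I) (`|partial ord0 f (rVcons (t, y))|%R)%:E.
have D0 y : 0 <= D y by apply: integral_ge0.
have ll := ltW l0.
(* Integration over the second point: the first coordinate ranges over an interval of length [l],
   and the segment integrals add up to [T ord0]. *)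
have step x x' : I x ->
    \int[mu n.+1]_(y in box a l) G (rVcons (x, x'), y) <=
    l%:E * (alpha x x' + T ord0).
  move=> xI.
  have mGx : measurable_fun setT (fun y => G (rVcons (x, x'), y)).
    apply/measurable_EFinP; apply: measurableT_comp => //.
    have mc : measurable_fun setT (fun _ : 'rV[R]_n.+1 => f (rVcons (x, x')) : R) by exact: measurable_cst.
    exact: (measurable_funB mc mf).
  rewrite (tonelli_box a l mGx (fun y => G0 (rVcons (x, x'), y))).1 -(integral_itv_ecst (a ord0 ord0))//.
  apply: le_ge0_integral => y0 y0I; first by apply: integral_ge0 => y _; exact: G0.
  rewrite /T (tonelli_box a l (mp ord0) (fun y => normr_ge0 _)).2 -ge0_integralD//.
  - apply: le_ge0_integral => y' By' //=.
    apply: (le_trans _ (leeD2l _ (@le_FTC_slice n f y' _ _ x y0 Cf _ _))) => //=.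
    by rewrite -EFinD lee_fin ler_distD.
  - apply: measurable_funTS; apply/measurable_EFinP; apply: measurableT_comp => //.
    apply: measurable_funB; first exact: measurable_cst.
    apply: measurable_continuous_rV => v.
    by apply: (continuous_comp (@continuous_rVcons_r R n x v)); exact: cf.
  - by move=> y' _; exact: D0.
  - by apply: measurable_funTS; exact: (measurable_slice_integral_l (F := fun x => (`|partial ord0 f x|%R)%:E)).
(* The factor 1 / l is there because the last integration, over [I] of length [l], multiplies the
   constant [T ord0] by [l]. *)
have step2 x : I x ->
    \int[mu n]_(x' in B) \int[mu n.+1]_(y in box a l) G (rVcons (x, x'), y) <=
    (l ^+ n.+2)%:E * (\sum_(j < n) S j x + (l^-1)%:E * T ord0).
  move=> xI; apply: (@le_trans _ _ (\int[mu n]_(x' in B) (l%:E * (alpha x x' + T ord0)))).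
    by apply: le_ge0_integral => x' Bx'; [exact: Phi0|exact: step].
  have malpha : measurable_fun B (alpha x).
    apply: measurable_funTS.
    apply: (measurable_inner_integral (G := fun z => (`|f (rVcons (x, z.1)) - f (rVcons (x, z.2))|%R)%:E)) => //.
    have mfx : measurable_fun setT (fun v => f (rVcons (x, v))).
      apply: measurable_continuous_rV => v.
      by apply: (continuous_comp (@continuous_rVcons_r R n x v)); exact: cf.
    apply/measurable_EFinP; apply: measurableT_comp => //; apply: measurable_funB.
      exact: (measurableT_comp mfx measurable_fst).
    exact: (measurableT_comp mfx measurable_snd).
  rewrite ge0_integralZl_EFin//; last first.
  - by apply: emeasurable_funD.
  - by move=> x' _; exact: adde_ge0.
  rewrite ge0_integralD// integral_box_ecst//.
  rewrite exprS EFinM -muleA; apply: lee_wpmul2l; first by rewrite lee_fin.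
  rewrite (@ge0_muleDr _ (l ^+ n.+1)%:E (\sum_(j < n) S j x)); last 2 first.
  - exact: sume_ge0.
  - by rewrite mule_ge0 ?lee_fin ?invr_ge0.
  apply: leeD.
    apply: (le_trans (IH (rVuncons a).2 (fun v => f (rVcons (x, v))) (axis_C1_slice x Cf))).
    apply: lee_wpmul2l; first by rewrite lee_fin exprn_ge0.
    apply: lee_sum => j _; apply: le_ge0_integral => v _; first by rewrite lee_fin.
    by rewrite partial_slice.
  by rewrite muleA -EFinM exprSr mulfK// gt_eqF.
apply: (@le_trans _ _ (\int[lebesgue_measure]_(x in I)
   ((l ^+ n.+2)%:E * (\sum_(j < n) S j x + (l^-1)%:E * T ord0)))).
  by apply: le_ge0_integral => x xI; [apply: integral_ge0 => v _; exact: Phi0|exact: step2].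
have mS j : measurable_fun I (S j).
  apply: measurable_funTS.
  exact: (measurable_slice_integral (F := fun x => (`|partial (lift ord0 j) f x|%R)%:E)).
have mI : measurable I by exact: measurable_itv.
rewrite ge0_integralZl_EFin ?exprn_ge0//; last 2 first.
- by move=> x _; rewrite adde_ge0 ?mule_ge0 ?lee_fin ?invr_ge0 ?sume_ge0.
- by apply: emeasurable_funD => //; exact: emeasurable_sum.
rewrite ge0_integralD//; last 3 first.
- by move=> x _; exact: sume_ge0.
- exact: emeasurable_sum.
- by move=> x _; rewrite mule_ge0 ?lee_fin ?invr_ge0.
rewrite integral_itv_ecst// muleA -EFinM divff ?gt_eqF// mul1e.
rewrite ge0_integral_sum// big_ord_recl addeC lee_wpmul2l ?lee_fin ?exprn_ge0//.
rewrite leeD2l// le_eqVlt; apply/orP; left; apply/eqP.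
apply: eq_bigr => j _.
by rewrite (tonelli_box a l (mp _) (fun y => normr_ge0 _)).1.
Qed.

End box_calculus.

(** * Sobolev functions *)

Section Lp_functions.
Context d (T : measurableType d) (R : realType) (mu : {measure set T -> \bar R}).
Variables (D : set T) (p : R).
Hypotheses (mD : measurable D) (hp : 1 < p).
Implicit Types f g h : T -> R.

Definition intg f := mu.-integrable D (EFin \o f).
Local Notation I f := (\int[mu]_(x in D) f x).

Lemma intg_measurable f : intg f -> measurable_fun D f.
Proof. by move=> /integrableP[/measurable_EFinP]. Qed.

Lemma intg_le f g : measurable_fun D f -> (forall x, D x -> `|f x| <= g x) ->
  intg g -> intg f.
Proof.
move=> mf fg; apply: le_integrable => //; first exact/measurable_EFinP.
by move=> x Dx /=; rewrite lee_fin (le_trans (fg x Dx))// ler_norm.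
Qed.

Lemma intgD f g : intg f -> intg g -> intg (fun x => f x + g x).
Proof. by move=> hf hg; exact: (integrableD mD hf hg). Qed.

Lemma intgZ c f : intg f -> intg (fun x => c * f x).
Proof. by move=> hf; exact: (integrableZl mD c hf). Qed.

Lemma eq_intg f g : (forall x, D x -> f x = g x) -> intg f -> intg g.
Proof.
move=> fg; apply: eq_integrable => // x /set_mem Dx.
by rewrite /= fg.
Qed.

Lemma intg0 : intg (fun=> 0).
Proof. exact: integrable0. Qed.

Lemma intg_sum (J : Type) (s : seq J) (F : J -> T -> R) :
  (forall j, intg (F j)) -> intg (fun x => \sum_(j <- s) F j x).
Proof.
move=> h; elim: s => [|j s IH].
  by apply: (eq_intg _ intg0) => x _; rewrite big_nil.
by apply: (eq_intg _ (intgD (h j) IH)) => x _; rewrite big_cons.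
Qed.

Lemma I_sum (J : Type) (s : seq J) (F : J -> T -> R) :
  (forall j, intg (F j)) -> I (fun x => \sum_(j <- s) F j x) = \sum_(j <- s) I (F j).
Proof.
move=> h; elim: s => [|j s IH].
  rewrite big_nil; transitivity (I (fun=> 0)); last by rewrite Rintegral_cst// mul0r.
  by apply: eq_Rintegral => x _; rewrite big_nil.
rewrite big_cons -IH -RintegralD//; [|exact: h|exact: intg_sum].
by apply: eq_Rintegral => x _; rewrite big_cons.
Qed.

Lemma intg_abs f : intg f -> intg (fun x => `|f x|).
Proof.
exact: integrable_norm.
Qed.

Lemma I_le f g : intg f -> intg g -> (forall x, D x -> f x <= g x) -> I f <= I g.
Proof. exact: le_Rintegral. Qed.

Lemma I_lincomb a b f g : intg f -> intg g ->
  I (fun x => a * f x + b * g x) = a * I f + b * I g.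
Proof.
move=> hf hg; have haf := intgZ a hf; have hbg := intgZ b hg.
rewrite (RintegralD mD haf hbg).
by rewrite (RintegralZl _ mD hf) (RintegralZl _ mD hg).
Qed.

Lemma I_abs_le f g : measurable_fun D f -> (forall x, D x -> `|f x| <= g x) ->
  intg g -> `|I f| <= I g.
Proof.
move=> mf fg ig; have hf := intg_le mf fg ig.
apply: le_trans (le_normr_Rintegral mD hf) _; apply: I_le => //.
exact: intg_abs.
Qed.

Lemma I_dominated (f_ : nat -> T -> R) f h :
  (forall m, measurable_fun D (f_ m)) -> measurable_fun D f -> intg h ->
  (forall m x, D x -> `|f_ m x| <= h x) ->
  (forall x, D x -> f_ m x @[m --> \oo] --> f x) ->
  I (f_ m) @[m --> \oo] --> I f.
Proof.
move=> mf_ mf ih fh ff.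
have [] := @dominated_convergence _ _ _ mu D mD (fun m => EFin \o f_ m) (EFin \o f) (EFin \o h).
- by move=> m; exact/measurable_EFinP.
- exact/measurable_EFinP.
- by apply: aeW => x Dx; apply: cvg_EFin; [exact: nearW|exact: ff].
- exact: ih.
- by apply: aeW => x m Dx /=; rewrite lee_fin; exact: fh.
move=> i_f _ h3.
apply: fine_cvg; rewrite fineK; first exact: h3.
exact: integrable_fin_num.
Qed.

Lemma I_ae_eq f g : measurable_fun D f -> measurable_fun D g ->
  {ae mu, forall x, D x -> f x = g x} -> I f = I g.
Proof.
move=> mf mg fg; rewrite /Rintegral; congr fine; apply: ae_eq_integral => //.
- exact/measurable_EFinP.
- exact/measurable_EFinP.
- by apply: filterS fg => x + Dx => /(_ Dx) ->.
Qed.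

Lemma I_eq0 f : intg f -> (forall x, D x -> 0 <= f x) -> I f = 0 ->
  {ae mu, forall x, D x -> f x = 0}.
Proof.
move=> hf f0 If0.
have h : (\int[mu]_(x in D) `|(EFin \o f) x| = 0)%E.
  rewrite -[LHS]fineK; last first.
    by apply: integrable_fin_num => //; exact: integrable_abse.
  congr (_%:E); rewrite -If0; congr fine; apply: eq_integral => x /set_mem Dx.
  by rewrite /= ger0_norm ?f0.
have mf : measurable_fun D (EFin \o f) by exact/measurable_EFinP/intg_measurable.
have := (ae_eq_integral_abs mu mD mf).1 h.
by apply: filterS => x + Dx => /(_ Dx) [].
Qed.

Definition Lp f := measurable_fun D f /\ intg (fun x => `|f x| `^ p).
(** The p-th power of the norm, without the root. It adds up over disjoint supports like the energy,
    and the factor 2^p that replaces the triangle inequality is harmless in limits. *)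
Definition Np f := I (fun x => `|f x| `^ p).

Let p0 : 0 < p. Proof. exact: lt_trans hp. Qed.
Let p0' : 0 <= p. Proof. exact: ltW. Qed.

Lemma measurable_norm_powR f r : measurable_fun D f ->
  measurable_fun D (fun x => `|f x| `^ r).
Proof.
move=> mf; apply: (measurableT_comp (measurable_powR r)).
exact: measurableT_comp.
Qed.

Lemma Lp_le f g : measurable_fun D f -> (forall x, D x -> `|f x| <= `|g x|) ->
  Lp g -> Lp f.
Proof.
move=> mf fg [mg ig]; split => //; apply: intg_le ig => //.
  exact: measurable_norm_powR.
by move=> x Dx; rewrite ger0_norm ?powR_ge0// ge0_ler_powR ?nnegrE// fg.
Qed.

Lemma Np_le f g : measurable_fun D f -> (forall x, D x -> `|f x| <= `|g x|) ->
  Lp g -> Np f <= Np g.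
Proof.
move=> mf fg lg; have [_ i_f] := Lp_le mf fg lg; case: lg => _ ig.
by apply: I_le => // x Dx; rewrite ge0_ler_powR ?nnegrE// fg.
Qed.

Lemma Np_ge0 f : 0 <= Np f.
Proof. by apply: Rintegral_ge0 => x _; exact: powR_ge0. Qed.

Lemma powR_add_le (a b : R) : 0 <= a -> 0 <= b ->
  (a + b) `^ p <= 2 `^ p * (a `^ p + b `^ p).
Proof.
move=> a0 b0; wlog ab : a b a0 b0 / a <= b => [H|].
  have [ab|/ltW ba] := leP a b; first exact: H.
  by rewrite addrC [X in _ * X]addrC; exact: H.
apply: (@le_trans _ _ ((2 * b) `^ p)).
  rewrite ge0_ler_powR ?nnegrE ?addr_ge0 ?mulr_ge0//.
  by rewrite mulr_natl mulr2n lerD2r.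
by rewrite powRM// ler_wpM2l ?powR_ge0// lerDr powR_ge0.
Qed.

Lemma intg_NpD f g : Lp f -> Lp g ->
  intg (fun x => 2 `^ p * (`|f x| `^ p + `|g x| `^ p)).
Proof. by move=> [_ ?] [_ ?]; apply: intgZ; exact: intgD. Qed.

Lemma LpD f g : Lp f -> Lp g -> Lp (fun x => f x + g x).
Proof.
move=> lf lg; have mfg : measurable_fun D (fun x => f x + g x).
  by apply: measurable_funD; [exact: lf.1|exact: lg.1].
split => //; apply: (intg_le (measurable_norm_powR _ mfg) _ (intg_NpD lf lg)) => x Dx.
rewrite ger0_norm ?powR_ge0//; apply: le_trans (powR_add_le _ _) => //.
by rewrite ge0_ler_powR ?nnegrE ?addr_ge0// ler_normD.
Qed.

Lemma Np_D f g : Lp f -> Lp g -> Np (fun x => f x + g x) <= 2 `^ p * (Np f + Np g).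
Proof.
move=> lf lg; have [_ ifg] := LpD lf lg.
rewrite /Np -RintegralD ?lf.2 ?lg.2//; [|exact: lf.2|exact: lg.2].
rewrite -RintegralZl//; last by apply: intgD; [exact: lf.2|exact: lg.2].
apply: I_le => //; first exact: intg_NpD.
move=> x Dx; apply: le_trans (powR_add_le _ _) => //.
by rewrite ge0_ler_powR ?nnegrE ?addr_ge0// ler_normD.
Qed.

Lemma LpZ c f : Lp f -> Lp (fun x => c * f x).
Proof.
move=> [mf i_f]; split; first exact: measurable_funM.
by apply: (eq_intg _ (intgZ (`|c| `^ p) i_f)) => x _; rewrite normrM powRM.
Qed.

Lemma Np_Z c f : Lp f -> Np (fun x => c * f x) = `|c| `^ p * Np f.
Proof.
move=> [mf i_f]; rewrite -RintegralZl//.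
by apply: eq_Rintegral => x _; rewrite normrM powRM.
Qed.

Lemma LpN f : Lp f -> Lp (fun x => - f x).
Proof.
by move=> /(LpZ (-1)); under eq_fun do rewrite mulN1r.
Qed.

Lemma LpB f g : Lp f -> Lp g -> Lp (fun x => f x - g x).
Proof. by move=> lf lg; apply: LpD => //; exact: LpN. Qed.

Lemma Np_triangle f g h : Lp f -> Lp g -> Lp h ->
  Np (fun x => f x - h x) <= 2 `^ p * (Np (fun x => f x - g x) + Np (fun x => g x - h x)).
Proof.
move=> lf lg lh; have := Np_D (LpB lf lg) (LpB lg lh).
by under [X in Np X <= _]eq_fun do rewrite addrA subrK.
Qed.

Lemma Lp_norm f : Lp f -> Lp (fun x => `|f x|).
Proof.
move=> [mf i_f]; split; first exact: measurableT_comp.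
by under eq_fun do rewrite normr_id.
Qed.

(** Replace the smaller of the two numbers by the larger. This crude form of Young's inequality is
    enough for the integrability of flux terms. *)
Lemma powR_mix_le (a b : R) : 0 <= a -> 0 <= b -> a `^ (p - 1) * b <= a `^ p + b `^ p.
Proof.
move=> a0 b0; have p10 : 0 <= p - 1 by rewrite subr_ge0 ltW.
have [ab|/ltW ba] := leP a b.
  apply: (@le_trans _ _ (b `^ (p - 1) * b)).
    by rewrite ler_wpM2r// ge0_ler_powR ?nnegrE.
  by rewrite mulrC mulr_powRB1// lerDr powR_ge0.
apply: (@le_trans _ _ (a `^ (p - 1) * a)); first by rewrite ler_wpM2l// powR_ge0.
by rewrite mulrC mulr_powRB1// lerDl powR_ge0.
Qed.

Lemma intg_mix f g h : measurable_fun D h -> Lp f -> Lp g ->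
  (forall x, D x -> `|h x| <= `|f x| `^ (p - 1) * `|g x|) -> intg h.
Proof.
move=> mh lf lg hfg; apply: (intg_le mh _ (intgD lf.2 lg.2)) => x Dx.
by apply: le_trans (hfg x Dx) _; exact: powR_mix_le.
Qed.

Lemma Np_dominated (e_ : nat -> T -> R) h :
  (forall m, measurable_fun D (e_ m)) -> Lp h ->
  (forall m x, D x -> `|e_ m x| <= h x) ->
  (forall x, D x -> e_ m x @[m --> \oo] --> 0) ->
  Np (e_ m) @[m --> \oo] --> 0.
Proof.
move=> me lh eh e0.
have -> : 0 = I (fun=> 0 `^ p).
  by rewrite powR0 ?gt_eqF// Rintegral_cst// mul0r.
apply: (I_dominated (h := fun x => `|h x| `^ p)) => //.
- by move=> m; exact: measurable_norm_powR.
- exact: lh.2.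
- move=> m x Dx; rewrite ger0_norm ?powR_ge0// ge0_ler_powR ?nnegrE//.
  by apply: le_trans (eh m x Dx) _; exact: ler_norm.
- move=> x Dx; rewrite powR0 ?gt_eqF//.
  have h1 := e0 x Dx.
  apply/cvgrPdist_lt => e e_gt0.
  have ep0 : 0 < e `^ p^-1 by rewrite powR_gt0.
  move/cvgrPdist_lt : h1 => /(_ _ ep0); apply: filterS => m.
  rewrite !sub0r !normrN (@ger0_norm _ (_ `^ _)) ?powR_ge0// => hm.
  have -> : e = (e `^ p^-1) `^ p by rewrite -powRrM mulVf ?gt_eqF// powRr1// ltW.
  by rewrite gt0_ltr_powR ?nnegrE// powR_ge0.
Qed.

Hypothesis fD : (mu D < +oo)%E.

Lemma intg_cst c : intg (fun=> c).
Proof.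
apply/integrableP; split; first exact: measurable_cst.
by rewrite integral_cst// lte_mul_pinfty.
Qed.

Lemma Lp_bounded f M : measurable_fun D f -> (forall x, D x -> `|f x| <= M) -> Lp f.
Proof.
move=> mf fM; split => //; apply: (intg_le (g := fun=> M `^ p)) (intg_cst _).
  exact: measurable_norm_powR.
move=> x Dx; have := fM x Dx => fxM.
rewrite ger0_norm ?powR_ge0// ge0_ler_powR ?nnegrE//.
exact: le_trans fxM.
Qed.

(** If t > eta, then t <= (t / eta)^(p-1) t. *)
Lemma L1_le (eta t : R) : 0 < eta -> 0 <= t -> t <= eta + eta `^ (1 - p) * t `^ p.
Proof.
move=> e0 t0; have [te|et] := leP t eta.
  by apply: le_trans te _; rewrite lerDl mulr_ge0 ?powR_ge0.
apply: (@le_trans _ _ (eta `^ (1 - p) * t `^ p)); last by rewrite lerDr ltW.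
have t0' : 0 < t by exact: lt_trans et.
rewrite -(mulr_powRB1 t0 p0) mulrCA -[leLHS]mulr1 ler_wpM2l//.
rewrite -opprB powRN mulrC -ler_pdivrMr ?invr_gt0 ?powR_gt0// invrK mul1r.
by rewrite ge0_ler_powR ?nnegrE ?ltW// subr_gt0.
Qed.

Lemma Lp_intg f : Lp f -> intg (fun x => `|f x|).
Proof.
move=> [mf i_f].
apply: (intg_le (g := fun x => 1 + 1 `^ (1 - p) * `|f x| `^ p)).
- exact: measurableT_comp.
- by move=> x Dx; rewrite normr_id; exact: L1_le.
- by apply: intgD; [exact: intg_cst|exact: intgZ].
Qed.

(** A substitute for Hölder's inequality on a set of finite measure: in [L1_le], [eta] is chosen so
    that the constant term integrates to at most e / 2, and then [del] so that the other term does
    too. *)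
Lemma L1_small (e : R) : 0 < e -> exists2 del, 0 < del &
  forall f, Lp f -> Np f <= del -> I (fun x => `|f x|) <= e.
Proof.
move=> e0; pose m := fine (mu D).
have m0 : 0 <= m by exact: fine_ge0.
pose eta := e / 2 / (m + 1).
have eta0 : 0 < eta by rewrite !divr_gt0// ltr_wpDl.
exists (e / 2 / eta `^ (1 - p)); first by rewrite !divr_gt0// powR_gt0.
move=> f lf hN; have [mf i_f] := lf.
apply: (@le_trans _ _ (I (fun x => eta + eta `^ (1 - p) * `|f x| `^ p))).
  apply: I_le; first exact: Lp_intg.
    by apply: intgD; [exact: intg_cst|exact: intgZ].
  by move=> x Dx; exact: L1_le.
rewrite RintegralD//; [|exact: intg_cst|exact: intgZ].
rewrite RintegralZl// Rintegral_cst// -/m.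
rewrite [leRHS](splitr e); apply: lerD.
  rewrite /eta -mulrA ler_piMr ?divr_ge0 ?(ltW e0)//.
  by rewrite mulrC ler_pdivrMr ?mul1r ?lerDl// ltr_wpDl.
by rewrite mulrC -ler_pdivlMr// powR_gt0.
Qed.

End Lp_functions.

Section sobolev_approximation.
Context {R : realType} {n : nat}.
Variables (Omega : set 'rV[R]_n) (p : R).
Hypotheses (oO : open Omega) (bO : bounded_set Omega) (hp : 1 < p).
Local Notation mu := (@lebesgue_rV R n).
Local Notation test := (test_function Omega).
Local Notation Lp := (Lp mu Omega p).
Local Notation Np := (Np mu Omega p).
Local Notation intg := (intg mu Omega).
Local Notation I f := (\int[mu]_(x in Omega) f x).
Implicit Types (u v phi psi : 'rV[R]_n -> R) (G : 'rV[R]_n -> 'rV[R]_n) (J : set R).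

Lemma measurable_domain : measurable Omega.
Proof. exact: open_measurable_rV. Qed.
Let mO := measurable_domain.

(** The inequalities are strict so that functions vanishing off [Omega] vanish on the faces of the
    box, as [integral_partial_box] requires. *)
Lemma domain_in_box : exists (a : 'rV[R]_n) l, 0 < l /\
  forall x, Omega x -> forall i, a ord0 i < x ord0 i < a ord0 i + l.
Proof.
have [M [_ hM]] := bO; pose L := `|M| + 1.
have L0 : 0 < L by rewrite ltr_wpDl.
exists (const_mx (- L)), (2 * L); split; first by rewrite mulr_gt0.
move=> x Ox i; rewrite mxE.
have ML : M < L by rewrite (le_lt_trans (ler_norm M))// /L ltrDl.
have xL0 : `|x| <= (M + L) / 2.
  by apply: (hM _ _ x Ox); lra.
have xL : `|x| < L by apply: le_lt_trans xL0 _; lra.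
have [_ /(_ ord0 i)] : ball (0 : 'rV[R]_n) L x by rewrite mx_norm_ball /ball_ /= sub0r normrN.
by rewrite /ball /= mxE sub0r normrN ltr_norml => /andP[h1 h2]; lra.
Qed.

Lemma finite_domain : (mu Omega < +oo)%E.
Proof.
have [a [l [l0 h]]] := domain_in_box.
apply: (@le_lt_trans _ _ (mu (box a l))); last by rewrite mu_box ?ltry// ltW.
apply: le_measure; rewrite ?inE//; first exact: measurable_box.
move=> x Ox i; have /andP[h1 h2] := h x Ox i.
by rewrite in_itv/= !ltW.
Qed.
Let fO := finite_domain.

Lemma test_out phi x : test phi -> ~ Omega x -> phi x = 0.
Proof. by move=> /testP[_ [K [_ KO hK]]] nx; apply: hK => /KO. Qed.

Lemma smooth_measurable phi : smooth phi -> measurable_fun Omega phi.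
Proof.
by move=> /smooth_continuous h; apply: measurable_funTS; exact: measurable_continuous_rV.
Qed.

Lemma test_measurable phi : test phi -> measurable_fun Omega phi.
Proof. by move=> /test_smooth; exact: smooth_measurable. Qed.

Lemma test_Lp phi : test phi -> Lp phi.
Proof.
move=> tphi; have [M hM] := test_bounded tphi.
by apply: (Lp_bounded mO hp fO (M := M)) => //; exact: test_measurable.
Qed.

Lemma intg_mul_test u phi : Lp u -> test phi -> intg (fun x => u x * phi x).
Proof.
move=> lu tphi; have [M hM] := test_bounded tphi.
apply: (intg_le mO (g := fun x => M * `|u x|)).
- by apply: measurable_funM; [exact: lu.1|exact: test_measurable].
- by move=> x _; rewrite normrM mulrC ler_wpM2r.
- by apply: intgZ => //; exact: (Lp_intg mO hp fO).
Qed.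

(** Adding a bound [M] of the derivative gives a nonnegative integrand, whose integral over an
    enclosing box is that of [M] alone; then subtract. *)
Lemma I_partial_test i phi : test phi -> I (partial i phi) = 0.
Proof.
move=> tphi; have [a [l [l0 h]]] := domain_in_box.
have tp := test_partial i tphi.
have [M hM] := test_bounded tp.
have Ob : Omega `<=` box a l.
  move=> x Ox j; have /andP[h1 h2] := h x Ox j; by rewrite in_itv/= !ltW.
have E : (\int[mu]_(x in box a l) (partial i phi x + M)%:E = (M * l ^+ n)%:E)%E.
  apply: integral_partial_box l0 _ _ _; first exact: smooth_axis_C1 (test_smooth tphi).
    move=> x j hx; apply: test_out tphi _ => /h /(_ j) /andP[h1 h2].
    by case: hx; rewrite leNgt ?h1 ?h2.
  move=> x; have := hM x; rewrite ler_norml => /andP[+ _].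
  by rewrite -subr_ge0 opprK.
have mb := measurable_box a l.
have mbl : mu (box a l) = (l ^+ n)%:E by rewrite mu_box// ltW.
have fb : (mu (box a l) < +oo)%E by rewrite mbl ltry.
have ib : (mu.-integrable (box a l) (EFin \o partial i phi))%E.
  apply: (@measurable_bounded_integrable) => //.
  - apply: measurable_funTS; exact: measurable_continuous_rV (smooth_continuous (test_smooth tp)).
  - exists M; split; first exact: num_real.
    by move=> M' MM' x _; apply: le_trans (hM x) _; exact: ltW.
have ic : (mu.-integrable (box a l) (EFin \o (fun=> M)))%E.
  apply/integrableP; split; first exact: measurable_cst.
  by rewrite integral_cst// lte_mul_pinfty.
have : \int[mu]_(x in box a l) (partial i phi x + M) = M * l ^+ n.
  by rewrite /Rintegral E.
rewrite RintegralD// Rintegral_cst//.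
have -> : fine (mu (box a l)) = l ^+ n by rewrite /= in mbl *; rewrite mbl.
move=> /(canRL (addrK _)); rewrite subrr => E0.
rewrite -E0 [LHS]Rintegral_mkcond [RHS]Rintegral_mkcond; apply: eq_Rintegral => x _.
rewrite !patchE; case: ifPn => [/set_mem Ox|].
  by rewrite mem_set//; exact: Ob.
move=> /negP nOx; rewrite (test_out tp) ?if_same// => Ox; apply: nOx; exact/mem_set.
Qed.

Lemma IBP_test i phi psi : test phi -> test psi ->
  I (fun x => phi x * partial i psi x) = - I (fun x => partial i phi x * psi x).
Proof.
move=> tphi tpsi; have tM : test (fun x => phi x * psi x).
  exact: testM (test_smooth tphi) tpsi.
have := I_partial_test i tM; rewrite partialM; last 2 first.
- by move=> x; exact: (smooth_diff x (test_smooth tphi)).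
- by move=> x; exact: (smooth_diff x (test_smooth tpsi)).
rewrite RintegralD//; last 2 first.
- by apply: intg_mul_test; [exact: test_Lp|exact: test_partial].
- by apply: intg_mul_test; [exact: test_Lp|exact: test_partial].
move=> /eqP; rewrite addr_eq0 => /eqP ->; congr (- _).
by apply: eq_Rintegral => x _; rewrite mulrC.
Qed.

(* [J] constrains the values of the approximating test functions; it is used
   with [J = setT] and with the nonnegative reals. *)
Definition W0app J u G : Prop :=
  [/\ Lp u, forall i, Lp (fun x => G x ord0 i) &
      forall e, 0 < e -> exists phi, [/\ test phi, forall x, J (phi x),
        Np (fun x => phi x - u x) <= e &
        forall i, Np (fun x => partial i phi x - G x ord0 i) <= e]].

(** Integration by parts for test functions passes to the limit by [L1_small]. Approximability alone
    thus yields the weak gradient that a record of [W0] has to carry. *)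
Lemma W0app_weak J u G i : W0app J u G -> weak_partial Omega i u (fun x => G x ord0 i).
Proof.
move=> [lu lG hu] psi tpsi; have tp := test_partial i tpsi.
have [M hM] := test_bounded tpsi.
have [M' hM'] := test_bounded tp.
have M0 : 0 <= M by apply: le_trans (hM 0).
have M'0 : 0 <= M' by apply: le_trans (hM' 0).
apply/eqP; rewrite -subr_eq0 opprK; apply/eqP/normr0_eq0/eqP.
rewrite eq_le normr_ge0 andbT; apply/ler_addgt0Pr => e e0; rewrite add0r.
(* The two error terms carry the factors [M'] and [M]; the 1 keeps the denominator positive. *)
have e'0 : 0 < e / (M + M' + 1) by rewrite divr_gt0// ltr_wpDl// addr_ge0.
have [del del0 hdel] := L1_small mO hp fO e'0.
have [phi [tphi _ hphi hpphi]] := hu del del0.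
have lphi := test_Lp tphi.
have lpphi := test_Lp (test_partial i tphi).
have -> : I (fun x => u x * partial i psi x) + I (fun x => G x ord0 i * psi x) =
  - (I (fun x => (phi x - u x) * partial i psi x) +
     I (fun x => (partial i phi x - G x ord0 i) * psi x)).
  have -> : I (fun x => (phi x - u x) * partial i psi x) =
    I (fun x => phi x * partial i psi x) - I (fun x => u x * partial i psi x).
    rewrite -RintegralB//; [|exact: intg_mul_test|exact: intg_mul_test].
    by apply: eq_Rintegral => x _; rewrite mulrBl.
  have -> : I (fun x => (partial i phi x - G x ord0 i) * psi x) =
    I (fun x => partial i phi x * psi x) - I (fun x => G x ord0 i * psi x).
    rewrite -RintegralB//; [|exact: intg_mul_test|exact: intg_mul_test].
    by apply: eq_Rintegral => x _; rewrite mulrBl.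
  by rewrite (IBP_test i tphi tpsi); ring.
have bound v w (K : R) : 0 <= K -> Lp v -> test w -> (forall x, `|w x| <= K) -> Np v <= del ->
    `|I (fun x => v x * w x)| <= K * (e / (M + M' + 1)).
  move=> K0 lv tw hw hv.
  apply: (@le_trans _ _ (I (fun x => K * `|v x|))).
    apply: I_abs_le => //.
    - by apply: measurable_funM; [exact: lv.1|exact: test_measurable].
    - by move=> x _; rewrite normrM mulrC ler_wpM2r.
    - by apply: intgZ => //; exact: (Lp_intg mO hp fO).
  rewrite RintegralZl//; last exact: (Lp_intg mO hp fO).
  by rewrite ler_wpM2l//; exact: hdel.
rewrite normrN; apply: le_trans (ler_normD _ _) _.
apply: le_trans (lerD (bound _ _ M' M'0 _ tp hM' hphi) (bound _ _ M M0 _ tpsi hM (hpphi i))) _.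
- exact: (LpB mO hp).
- exact: (LpB mO hp).
rewrite -mulrDl mulrCA ler_piMr// ?(ltW e0)// ler_pdivrMr ?mul1r; last first.
  by rewrite ltr_wpDl// addr_ge0.
by rewrite (addrC M') lerDl.
Qed.

Lemma Lnorm_Np u : (poweR ('N[mu]_(p%:E)[EFin \o (u \_ Omega)]) p =
  \int[mu]_(x in Omega) (`|u x| `^ p)%:E)%E.
Proof.
rewrite poweR_Lnorm; last by rewrite gt_eqF// (lt_trans _ hp).
rewrite [RHS]integral_mkcond; apply: eq_integral => x _ /=.
rewrite !patchE; case: ifPn => // _.
by rewrite normr0 powR0// gt_eqF// (lt_trans _ hp).
Qed.

Lemma Lp_in_Lspace u : Lp u <-> in_Lspace Omega p%:E u.
Proof.
have p0 : 0 < p by exact: lt_trans hp.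
split=> [[mu_ iu]|[mu_ fu]]; split => //.
  apply: (@lty_poweRy _ _ p); first by rewrite gt_eqF.
  rewrite Lnorm_Np; have /integrableP[_] := iu; apply: le_lt_trans.
  rewrite le_eqVlt; apply/orP; left; apply/eqP; apply: eq_integral => x _ /=.
  by rewrite (@ger0_norm _ (_ `^ _)) ?powR_ge0.
apply/integrableP; split; first exact/measurable_EFinP/measurable_norm_powR.
under eq_integral do rewrite /= (@ger0_norm _ (_ `^ _)) ?powR_ge0//.
rewrite -Lnorm_Np; exact: poweR_lty.
Qed.

End sobolev_approximation.

Section sobolev_records.
Context {R : realType} {n : nat}.
Variables (Omega : set 'rV[R]_n) (p : R).
Hypotheses (oO : open Omega) (bO : bounded_set Omega) (hp : 1 < p).
Local Notation mu := (@lebesgue_rV R n).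
Local Notation test := (test_function Omega).
Local Notation Lp := (Lp mu Omega p).
Local Notation Np := (Np mu Omega p).
Local Notation W0app := (W0app Omega p).
Implicit Types (u v phi psi : 'rV[R]_n -> R) (G : 'rV[R]_n -> 'rV[R]_n) (J : set R).
Let mO : measurable Omega := measurable_domain oO.
Let p0 : 0 < p. Proof. exact: lt_trans hp. Qed.

Lemma Lp_dist_Np u v : Lp (fun x => u x - v x) ->
  Lp_dist Omega p%:E u v = ((Np (fun x => u x - v x)) `^ p^-1)%:E.
Proof.
move=> luv; rewrite /Lp_dist.
have -> : ('N[mu]_(p%:E)[EFin \o ((u \- v)%R \_ Omega)] =
  poweR (poweR ('N[mu]_(p%:E)[EFin \o ((u \- v)%R \_ Omega)]) p) p^-1)%E.
  by rewrite -poweRrM mulfV ?gt_eqF// poweRe1// Lnorm_ge0.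
rewrite (Lnorm_Np Omega hp) -poweR_EFin; congr poweR.
by rewrite fineK//; apply: integrable_fin_num => //; exact: luv.2.
Qed.

Lemma cvg_powR0 (a : nat -> R) (r : R) : 0 < r -> (forall m, 0 <= a m) ->
  a m @[m --> \oo] --> 0 -> (a m) `^ r @[m --> \oo] --> 0.
Proof.
move=> r0 a0 ha; apply/cvgrPdist_lt => e e0.
have er0 : 0 < e `^ r^-1 by rewrite powR_gt0.
move/cvgrPdist_lt : ha => /(_ _ er0); apply: filterS => m.
rewrite !sub0r !normrN !ger0_norm ?powR_ge0// => hm.
have -> : e = (e `^ r^-1) `^ r by rewrite -powRrM mulVf ?gt_eqF// powRr1// ltW.
by rewrite gt0_ltr_powR ?nnegrE ?powR_ge0.
Qed.

(** With [record_W0app] this is the bridge between the records of the statement and the pairs on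
    which the proof computes. *)
Lemma W0app_record J u G : W0app J u G ->
  exists w : W0 Omega p, W0_fun w = u /\ grad w = G.
Proof.
move=> hu; have [lu lG hap] := hu.
have h1 : in_Lspace Omega p%:E u by apply/(Lp_in_Lspace _ hp).
have h2 i : in_Lspace Omega p%:E (fun x => G x ord0 i) by apply/(Lp_in_Lspace _ hp).
have h3 i := W0app_weak oO bO hp i hu.
suff h4 : exists phi : ('rV[R]_n -> R)^nat,
    [/\ forall m, test_function Omega (phi m),
        Lp_dist Omega p%:E (phi m) u @[m --> \oo] --> 0%E &
        forall i, Lp_dist Omega p%:E (partial i (phi m)) (fun x => G x ord0 i)
                    @[m --> \oo] --> 0%E].
  by exists (Build_W0 h1 h2 h3 h4).
have /choice[phi hphi] : forall m : nat, exists phi, [/\ test phi, forall x, J (phi x),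
        Np (fun x => phi x - u x) <= harmonic m &
        forall i, Np (fun x => partial i phi x - G x ord0 i) <= harmonic m].
  by move=> m; apply: hap; rewrite /harmonic invr_gt0.
have cv (f : nat -> 'rV[R]_n -> R) g : (forall m, Lp (fun x => f m x - g x)) ->
    (forall m, Np (fun x => f m x - g x) <= harmonic m) ->
    Lp_dist Omega p%:E (f m) g @[m --> \oo] --> 0%E.
  move=> lf hf; under eq_fun do rewrite Lp_dist_Np//.
  apply: cvg_EFin; first exact: nearW.
  apply: cvg_powR0; [by rewrite invr_gt0|by move=> m; exact: Np_ge0|].
  apply: (@squeeze_cvgr _ _ _ _ (cst 0) harmonic); last exact: cvg_harmonic.
    by apply: nearW => m; rewrite Np_ge0 hf.
  exact: cvg_cst.
exists phi; split.
- by move=> m; have [] := hphi m.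
- apply: cv => m; have [tphi _ h _] := hphi m => //.
  by apply: LpB => //; exact: test_Lp.
- move=> i; apply: (cv (fun m => partial i (phi m))) => m; have [tphi _ _ h] := hphi m => //.
  by apply: LpB => //; apply: test_Lp => //; exact: test_partial.
Qed.

Lemma record_W0app (w : W0 Omega p) : W0app setT w (grad w).
Proof.
have lw : Lp w by apply/(Lp_in_Lspace _ hp); exact: W0_Lp.
have lG i : Lp (fun x => grad w x ord0 i) by apply/(Lp_in_Lspace _ hp); exact: grad_Lp.
split => // e e0; have [phi [tphi h1 h2]] := W0_closure w.
have e'0 : 0 < e `^ p^-1 by rewrite powR_gt0.
have small (f : nat -> 'rV[R]_n -> R) g : (forall m, Lp (fun x => f m x - g x)) ->
    Lp_dist Omega p%:E (f m) g @[m --> \oo] --> 0%E ->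
    \forall m \near \oo, Np (fun x => f m x - g x) <= e.
  move=> lf; under eq_fun do rewrite Lp_dist_Np//.
  move=> /fine_cvg /= /cvgrPdist_lt /(_ _ e'0); apply: filterS => m.
  rewrite sub0r normrN ger0_norm ?powR_ge0// => hm.
  rewrite leNgt; apply/negP => eN; move: hm; apply/negP; rewrite -leNgt.
  by rewrite ge0_ler_powR ?nnegrE ?invr_ge0 ?Np_ge0// ltW.
have lphi m : Lp (phi m) by exact: test_Lp.
have lpphi i m : Lp (partial i (phi m)) by apply: test_Lp => //; exact: test_partial.
have n1 : \forall m \near \oo, Np (fun x => phi m x - w x) <= e.
  by apply: small => // m; exact: LpB.
have n2 : \forall m \near \oo, forall i, Np (fun x => partial i (phi m) x - grad w x ord0 i) <= e.
  apply: filter_forall => i; apply: (small (fun m => partial i (phi m))) => // m; exact: LpB.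
have [m [hm1 hm2]] := filter_ex (filterI n1 n2).
by exists (phi m); split.
Qed.

Lemma W0appS J J' u G : J `<=` J' -> W0app J u G -> W0app J' u G.
Proof.
move=> JJ [lu lG h]; split => // e /h[phi [? Jphi ? ?]]; exists phi; split => // x.
exact/JJ.
Qed.

Lemma W0app_limit J u G : Lp u -> (forall i, Lp (fun x => G x ord0 i)) ->
  (forall e, 0 < e -> exists v H, [/\ W0app J v H, Np (fun x => v x - u x) <= e &
     forall i, Np (fun x => H x ord0 i - G x ord0 i) <= e]) -> W0app J u G.
Proof.
move=> lu lG h; split => // e e0.
pose e' := e / (2 `^ p * 2).
have c0 : 0 < 2 `^ p * 2 :> R by rewrite mulr_gt0// powR_gt0.
have e'0 : 0 < e' by rewrite divr_gt0.
have [v [H [[lv lH hv] h1 h2]]] := h _ e'0.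
have [phi [tphi Jphi h3 h4]] := hv _ e'0.
have ee : 2 `^ p * (e' + e') <= e.
  by rewrite -mulr2n -(mulr_natr e') mulrCA mulfVK// gt_eqF.
exists phi; split => //.
- apply: le_trans (Np_triangle mO hp (test_Lp oO bO hp tphi) lv lu) _.
  apply: le_trans ee; apply: ler_wpM2l; first exact: powR_ge0.
  exact: (lerD h3 h1).
- move=> i.
  apply: le_trans (Np_triangle mO hp (test_Lp oO bO hp (test_partial i tphi)) (lH i) (lG i)) _.
  apply: le_trans ee; apply: ler_wpM2l; first exact: powR_ge0.
  exact: (lerD (h4 i) (h2 i)).
Qed.

(** Domination turns pointwise convergence of values and gradients into convergence in [Np], under
    which the closure is stable. *)
Lemma W0app_limit_seq J (u_ : nat -> 'rV[R]_n -> R) (G_ : nat -> 'rV[R]_n -> 'rV[R]_n) u G h k :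
  measurable_fun Omega u -> (forall i, measurable_fun Omega (fun x => G x ord0 i)) ->
  (forall m, W0app J (u_ m) (G_ m)) -> Lp h -> (forall i, Lp (k i)) ->
  (forall m x, Omega x -> `|u_ m x| <= h x) ->
  (forall x, Omega x -> u_ m x @[m --> \oo] --> u x) ->
  (forall m i x, Omega x -> `|G_ m x ord0 i| <= k i x) ->
  (forall i x, Omega x -> G_ m x ord0 i @[m --> \oo] --> G x ord0 i) ->
  W0app J u G.
Proof.
move=> mu_ mG hW lh lk uh uu Gk GG.
have key (f_ : nat -> 'rV[R]_n -> R) (f g : 'rV[R]_n -> R) : measurable_fun Omega f -> (forall m, Lp (f_ m)) -> Lp g ->
    (forall m x, Omega x -> `|f_ m x| <= g x) ->
    (forall x, Omega x -> f_ m x @[m --> \oo] --> f x) ->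
    Lp f /\ Np (fun x => f_ m x - f x) @[m --> \oo] --> 0.
  move=> mf lf lg fg ff.
  have fg' x : Omega x -> `|f x| <= g x.
    move=> Ox; have c : `|f_ m x| @[m --> \oo] --> `|f x| by apply: cvg_norm; exact: ff.
    rewrite -(cvg_lim _ c)//.
    apply: limr_le; first by apply/cvg_ex; exists `|f x|.
    by apply: nearW => m; exact: fg.
  split.
    by apply: (Lp_le mO hp mf _ lg) => x Ox; apply: le_trans (fg' x Ox) (ler_norm _).
  apply: (Np_dominated mO hp (h := fun x => 2 * g x)).
  - by move=> m; apply: measurable_funB => //; exact: (lf m).1.
  - exact: LpZ.
  - move=> m x Ox; rewrite mulr_natl mulr2n; apply: le_trans (ler_normB _ _) _.
    by rewrite lerD// ?fg ?fg'.
  - by move=> x Ox; rewrite -(subrr (f x)); apply: cvgB; [exact: ff|exact: cvg_cst].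
have [lu cu] := key u_ u h mu_ (fun m => let: And3 a _ _ := hW m in a) lh uh uu.
have lG i : Lp (fun x => G x ord0 i).
  exact: (key (fun m x => G_ m x ord0 i) _ _ (mG i) (fun m => let: And3 _ b _ := hW m in b i) (lk i) (fun m x => Gk m i x) (GG i)).1.
have cG i := (key (fun m x => G_ m x ord0 i) _ _ (mG i) (fun m => let: And3 _ b _ := hW m in b i) (lk i) (fun m x => Gk m i x) (GG i)).2.
apply: W0app_limit => // e e0.
have small (a : nat -> R) : a m @[m --> \oo] --> 0 -> \forall m \near \oo, a m <= e.
  move=> /cvgrPdist_lt /(_ _ e0); apply: filterS => m; rewrite sub0r normrN => hm.
  by apply: le_trans (ler_norm _) _; exact: ltW.
have n2 : \forall m \near \oo, forall i, Np (fun x => G_ m x ord0 i - G x ord0 i) <= e.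
  by apply: filter_forall => i; apply: small; exact: cG.
have [m [hm1 hm2]] := filter_ex (filterI (small _ cu) n2).
by exists (u_ m), (G_ m); split.
Qed.

Lemma W0appD a b u G v H : W0app setT u G -> W0app setT v H ->
  W0app setT (fun x => a * u x + b * v x) (fun x => a *: G x + b *: H x).
Proof.
move=> [lu lG hu] [lv lH hv].
have key (f f' g g' : 'rV[R]_n -> R) e : 0 < e -> Lp f -> Lp g -> Lp f' -> Lp g' ->
    Np (fun x => f' x - f x) <= e -> Np (fun x => g' x - g x) <= e ->
    Np (fun x => (a * f' x + b * g' x) - (a * f x + b * g x)) <=
    2 `^ p * (`|a| `^ p + `|b| `^ p + 1) * e.
  move=> e0 lf lg lf' lg' h1 h2.
  under [X in Np X]eq_fun do rewrite opprD addrACA -!mulrBr.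
  apply: le_trans (Np_D mO hp (LpZ mO a (LpB mO hp lf' lf)) (LpZ mO b (LpB mO hp lg' lg))) _.
  rewrite (Np_Z mO a (LpB mO hp lf' lf)) (Np_Z mO b (LpB mO hp lg' lg)).
  rewrite -mulrA; apply: ler_wpM2l; first exact: powR_ge0.
  rewrite !mulrDl mul1r -[leLHS]addr0; apply: lerD; last exact: ltW.
  by apply: lerD; apply: ler_wpM2l => //; exact: powR_ge0.
split.
- by apply: LpD => //; exact: LpZ.
- by move=> i; under eq_fun do rewrite !mxE; apply: LpD => //; exact: LpZ.
- move=> e e0; pose c := 2 `^ p * (`|a| `^ p + `|b| `^ p + 1).
  have c0 : 0 < c by rewrite mulr_gt0 ?powR_gt0// ltr_wpDl// addr_ge0// powR_ge0.
  have ec0 : 0 < e / c by rewrite divr_gt0.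
  have ee : c * (e / c) <= e by rewrite mulrC divfK// gt_eqF.
  have [phi [tphi _ h1 h2]] := hu _ ec0.
  have [psi [tpsi _ h3 h4]] := hv _ ec0.
  exists (fun x => a * phi x + b * psi x); split => //.
  + by apply: testD; exact: testZ.
  + apply: le_trans ee.
    have lphi := test_Lp oO bO hp tphi; have lpsi := test_Lp oO bO hp tpsi.
    exact: (key _ _ _ _ _ ec0 lu lv lphi lpsi h1 h3).
  + move=> i; have dphi x : differentiable phi x := smooth_diff x (test_smooth tphi).
    have dpsi x : differentiable psi x := smooth_diff x (test_smooth tpsi).
    have dc (c' : R) (x : 'rV[R]_n) : differentiable (fun=> c' : R) x by exact: differentiable_cst.
    rewrite partialD; [|by move=> x; exact: differentiableM|by move=> x; exact: differentiableM].
    rewrite !partialM// !partial_cst.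
    under [X in Np X]eq_fun do rewrite !mxE !mulr0 !addr0.
    apply: le_trans ee.
    have lphi := test_Lp oO bO hp (test_partial i tphi).
    have lpsi := test_Lp oO bO hp (test_partial i tpsi).
    exact: (key _ _ _ _ _ ec0 (lG i) (lH i) lphi lpsi (h2 i) (h4 i)).
Qed.

End sobolev_records.

(** * Chain rule and positive part *)

Section chain_rule.
Context {R : realType} {n : nat}.
Variables (Omega : set 'rV[R]_n) (p : R).
Hypotheses (oO : open Omega) (bO : bounded_set Omega) (hp : 1 < p).
Local Notation mu := (@lebesgue_rV R n).
Local Notation test := (test_function Omega).
Local Notation Lp := (Lp mu Omega p).
Local Notation Np := (Np mu Omega p).
Local Notation W0app := (W0app Omega p).
Implicit Types (u v phi psi : 'rV[R]_n -> R) (G : 'rV[R]_n -> 'rV[R]_n) (J : set R).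
Let mO : measurable Omega := measurable_domain oO.
Let fO := finite_domain oO bO.
Let p0 : 0 < p. Proof. exact: lt_trans hp. Qed.

Lemma measurable_if (b : 'rV[R]_n -> bool) u v : measurable_fun Omega b ->
  measurable_fun Omega u -> measurable_fun Omega v ->
  measurable_fun Omega (fun x => if b x then u x else v x).
Proof.
move=> mb mu_ mv; apply: measurable_fun_if => //.
- by apply: measurable_funS mu_ => // x [].
- by apply: measurable_funS mv => // x [].
Qed.

(** In the chain rule a gradient is multiplied by a difference that is bounded but not uniformly
    small; cutting the gradient at height [K] isolates the part where only boundedness is
    available. *)
Lemma Np_tail g e : Lp g -> 0 < e -> exists2 K, 0 <= K &
  Lp (fun x => if K < `|g x| then g x else 0) /\
  Np (fun x => if K < `|g x| then g x else 0) <= e.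
Proof.
move=> lg e0; pose t (m : nat) x := if m%:R < `|g x| then g x else 0.
have mt m : measurable_fun Omega (t m).
  apply: measurable_if => //; last exact: lg.1.
  by apply: measurable_fun_ltr => //; apply: measurableT_comp => //; exact: lg.1.
have tg m x : `|t m x| <= `|g x| by rewrite /t; case: ifPn; rewrite ?normr0.
have c : Np (t m) @[m --> \oo] --> 0.
  apply: (Np_dominated mO hp (h := fun x => `|g x|)) => //; first exact: Lp_norm.
  move=> x _; apply/cvgrPdist_lt => e' e'0.
  have [m hm] : exists m : nat, `|g x| <= m%:R.
    by exists (Num.truncn `|g x|).+1; apply/ltW/truncnS_gt.
  exists m => // m' /= mm'; rewrite /t ifF ?subrr ?normr0//.
  by apply/negbTE; rewrite -leNgt (le_trans hm)// ler_nat.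
move/cvgrPdist_lt : c => /(_ _ e0) [m _ /(_ m (leqnn m))].
rewrite sub0r normrN => hm; exists m%:R; rewrite ?ler0n//; split.
  by apply: (Lp_le mO hp (mt m) _ lg) => x _; exact: tg.
by apply: le_trans (ler_norm _) _; exact: ltW.
Qed.

(** The approximants are eta k (psi), with psi approximating u. The gradient error splits into [A]
    and [B], which are linear in the errors of psi, and [D], containing (k' (psi) - k' (u)) G. Where
    |G_i| <= K_i, the Lipschitz bound of k' controls [D]; elsewhere the bound of k' leaves a tail of
    G_i. Regularity of [k] is only asked on [J], where u and psi take their values, and the
    alternative on [eta] and k 0 keeps the support compact. *)
Lemma W0app_chain J J' (eta : 'rV[R]_n -> R) (k k' : R -> R) (L M : R) u G :
  0 <= L -> 0 <= M -> J 0 -> smooth eta ->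
  (forall x, `|eta x| <= M) -> (forall i x, `|partial i eta x| <= M) ->
  test eta \/ k 0 = 0 ->
  (forall psi, test psi -> (forall x, J (psi x)) -> smooth (fun x => k (psi x)) /\
     forall i, partial i (fun x => k (psi x)) = fun x => k' (psi x) * partial i psi x) ->
  (forall s t, J s -> J t -> `|k s - k t| <= L * `|s - t|) ->
  (forall t, J t -> `|k' t| <= L) ->
  (forall s t, J s -> J t -> `|k' s - k' t| <= L * `|s - t|) ->
  (forall x, Omega x -> J (u x)) ->
  measurable_fun setT k -> measurable_fun setT k' ->
  (forall x t, J t -> J' (eta x * k t)) ->
  W0app J u G ->
  W0app J' (fun x => eta x * k (u x))
    (fun x => \row_i (partial i eta x * k (u x) + eta x * k' (u x) * G x ord0 i)).
Proof.
move=> L0 M0 J0 seta etaM detaM tk hk lipk bk' lipk' Ju mk mk' JJ' [lu lG hu].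
have meta : measurable_fun Omega eta := smooth_measurable seta.
have mpeta i : measurable_fun Omega (partial i eta) := smooth_measurable (smooth_partial i seta).
have mku : measurable_fun Omega (fun x => k (u x)) := measurableT_comp mk lu.1.
have mk'u : measurable_fun Omega (fun x => k' (u x)) := measurableT_comp mk' lu.1.
have lku : Lp (fun x => k (u x)).
  apply: (Lp_le mO hp mku (g := fun x => `|k 0| + L * `|u x|)).
    move=> x Ox; rewrite (@ger0_norm _ (`|k 0| + _)) ?addr_ge0 ?mulr_ge0//.
    have -> : k (u x) = k 0 + (k (u x) - k 0) by ring.
    apply: le_trans (ler_normD _ _) _.
    by rewrite lerD2l; apply: le_trans (lipk _ _ (Ju x Ox) J0) _; rewrite subr0.
  apply: LpD => //; last by apply: LpZ => //; exact: Lp_norm.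
  apply: (Lp_bounded mO hp fO (M := `|k 0|)); first exact: measurable_cst.
  by move=> x _; rewrite normr_id.
have bmul (a w : 'rV[R]_n -> R) (A : R) : 0 <= A -> measurable_fun Omega a ->
    (forall x, Omega x -> `|a x| <= A) -> Lp w ->
    Lp (fun x => a x * w x) /\ Np (fun x => a x * w x) <= A `^ p * Np w.
  move=> A0 ma aA lw; have lAw := LpZ mO A lw.
  have mw := lw.1; have maw : measurable_fun Omega (fun x => a x * w x) by exact: measurable_funM.
  have h x : Omega x -> `|a x * w x| <= `|A * w x|.
    by move=> Ox; rewrite !normrM (ger0_norm A0) ler_wpM2r// aA.
  split; first exact: (Lp_le mO hp maw h lAw).
  by apply: le_trans (Np_le mO hp maw h lAw) _; rewrite Np_Z// ger0_norm.
have lL (w : 'rV[R]_n -> R) : measurable_fun Omega w -> (forall x, Omega x -> `|w x| <= L) ->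
    forall v, Lp v -> Lp (fun x => eta x * w x * v x) /\
       Np (fun x => eta x * w x * v x) <= (M * L) `^ p * Np v.
  move=> mw wL v lv; apply: bmul => //; rewrite ?mulr_ge0//; first exact: measurable_funM.
  by move=> x Ox; rewrite normrM ler_pM// wL.
pose c := M * L; have c0 : 0 <= c by rewrite mulr_ge0.
pose q : R := 2 `^ p; have q0 : 0 < q by rewrite powR_gt0.
split.
- by have [] := bmul eta _ M M0 meta (fun x _ => etaM x) lku.
- move=> i; under eq_fun do rewrite mxE; apply: LpD => //.
    by have [] := bmul _ _ M M0 (mpeta i) (fun x _ => detaM i x) lku.
  by have [] := lL _ mk'u (fun x Ox => bk' _ (Ju x Ox)) _ (lG i).
move=> e e0.
(* The order of choice matters: the heights [K_] depend on [tau], and [del], which has to compensate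
   them, comes last. *)
pose tau := e / 2 / (q ^+ 3 * ((2 * c) `^ p + 1)).
have qc0 : 0 < q ^+ 3 * ((2 * c) `^ p + 1).
  by rewrite mulr_gt0 ?exprn_gt0// ltr_wpDl ?powR_ge0.
have tau0 : 0 < tau by rewrite !divr_gt0.
have /choice[K_ hK_] i : exists K, 0 <= K /\
    (Lp (fun x => if K < `|G x ord0 i| then G x ord0 i else 0) /\
     Np (fun x => if K < `|G x ord0 i| then G x ord0 i else 0) <= tau).
  by have [K ? ?] := Np_tail (lG i) tau0; exists K.
(* [S] bounds the contributions of all the heights, so that one [del] serves every coordinate. *)
pose S := \sum_(i < n) (c * K_ i) `^ p.
have S0 : 0 <= S by apply: sumr_ge0 => i _; exact: powR_ge0.
pose C := q * c `^ p + q ^+ 2 * c `^ p + q ^+ 3 * S + c `^ p + 1.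
have C0 : 0 < C.
  by rewrite ltr_wpDl// !addr_ge0 ?mulr_ge0 ?exprn_ge0 ?powR_ge0 ?(ltW q0).
pose del := e / 2 / C.
have del0 : 0 < del by rewrite !divr_gt0.
have [psi [tpsi Jpsi h1 h2]] := hu _ del0.
have [sk pk] := hk _ tpsi Jpsi.
have lpsi := test_Lp oO bO hp tpsi.
have dl := LpB mO hp lpsi lu.
exists (fun x => eta x * k (psi x)); split.
- case: tk => [teta|k0].
    by under eq_fun do rewrite mulrC; exact: testM.
  by apply: testM => //; exact: test_comp.
- by move=> x; exact: JJ'.
- have l1 x : Omega x -> `|eta x * k (psi x) - eta x * k (u x)| <= `|c * (psi x - u x)|.
    move=> Ox; rewrite -mulrBr !normrM (ger0_norm M0) (ger0_norm L0) -mulrA.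
    by rewrite ler_pM// lipk//; exact: Ju.
  have mk1 : measurable_fun Omega (fun x => eta x * k (psi x) - eta x * k (u x)).
    by apply: measurable_funB; apply: measurable_funM => //; exact: smooth_measurable.
  apply: le_trans (Np_le mO hp mk1 l1 (LpZ mO c dl)) _.
  rewrite Np_Z// ger0_norm//; apply: (@le_trans _ _ (C * del)).
    apply: ler_pM => //; rewrite ?powR_ge0 ?Np_ge0// /C -addrA (addrC _ (c `^ p + 1)) -addrA.
    by rewrite lerDl !addr_ge0 ?mulr_ge0 ?exprn_ge0 ?powR_ge0 ?(ltW q0).
  by rewrite mulrC divfK ?gt_eqF//; lra.
move=> i.
have dk x : differentiable (fun x => k (psi x)) x := smooth_diff x sk.
have de x : differentiable eta x := smooth_diff x seta.
rewrite partialM// pk.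
pose A x := partial i eta x * (k (psi x) - k (u x)).
pose B x := eta x * k' (psi x) * (partial i psi x - G x ord0 i).
pose D x := eta x * (k' (psi x) - k' (u x)) * G x ord0 i.
have mk'psi : measurable_fun Omega (fun x => k' (psi x)).
  exact: measurableT_comp mk' (test_measurable tpsi).
have -> : (fun x => eta x * (k' (psi x) * partial i psi x) + k (psi x) * partial i eta x -
   (\row_i0 (partial i0 eta x * k (u x) + eta x * k' (u x) * G x ord0 i0)) ord0 i) =
   fun x => A x + (B x + D x).
  by apply/funext => x; rewrite mxE /A /B /D; ring.
have lpd := LpB mO hp (test_Lp oO bO hp (test_partial i tpsi)) (lG i).
have [lA NA] : Lp A /\ Np A <= c `^ p * del.
  have mA : measurable_fun Omega A.
    by apply: measurable_funM => //; apply: measurable_funB => //; exact: smooth_measurable.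
  have l1 x : Omega x -> `|A x| <= `|c * (psi x - u x)|.
    move=> Ox; rewrite !normrM (ger0_norm M0) (ger0_norm L0) -mulrA.
    by rewrite ler_pM// lipk//; exact: Ju.
  split; first exact: (Lp_le mO hp mA l1 (LpZ mO c dl)).
  apply: le_trans (Np_le mO hp mA l1 (LpZ mO c dl)) _.
  by rewrite Np_Z// ger0_norm// ler_wpM2l ?powR_ge0.
have [lB NB] : Lp B /\ Np B <= c `^ p * del.
  have [h3 h4] := lL _ mk'psi (fun x _ => bk' _ (Jpsi x)) _ lpd.
  split; first exact: h3.
  exact: (le_trans h4 (ler_wpM2l (powR_ge0 _ _) (h2 i))).
have [K0 [ltail Ntail]] := hK_ i.
have [lD ND] : Lp D /\ Np D <= q * ((c * K_ i) `^ p * del + (2 * c) `^ p * tau).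
  have mD : measurable_fun Omega D.
    apply: measurable_funM; last exact: (lG i).1.
    by apply: measurable_funM => //; exact: measurable_funB.
  pose D1 x := c * K_ i * `|psi x - u x|.
  pose D2 x := 2 * c * `|if K_ i < `|G x ord0 i| then G x ord0 i else 0|.
  have lD1 : Lp D1 by apply: LpZ => //; exact: Lp_norm.
  have lD2 : Lp D2 by apply: LpZ => //; exact: Lp_norm.
  have D10 x : 0 <= D1 x by rewrite !mulr_ge0.
  have D20 x : 0 <= D2 x by rewrite !mulr_ge0.
  have l1 x : Omega x -> `|D x| <= `|D1 x + D2 x|.
    move=> Ox; rewrite (ger0_norm (addr_ge0 (D10 x) (D20 x))).
    have [hG|hG] := ltP (K_ i) `|G x ord0 i|.
      apply: (@le_trans _ _ (D2 x)); last by rewrite lerDr.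
      rewrite /D2 hG !normrM /c mulrCA -!mulrA ler_pM ?mulr_ge0// mulrA ler_wpM2r//.
      rewrite mulrC mulr_natr mulr2n; apply: le_trans (ler_normB _ _) _.
      by rewrite lerD ?bk'//; exact: Ju.
    apply: (@le_trans _ _ (D1 x)); last by rewrite lerDl.
    rewrite !normrM /D1 /c -!mulrA ler_pM ?mulr_ge0// mulrC mulrCA ler_pM//.
    by rewrite lipk'//; exact: Ju.
  split; first exact: (Lp_le mO hp mD l1 (LpD mO hp lD1 lD2)).
  apply: le_trans (Np_le mO hp mD l1 (LpD mO hp lD1 lD2)) _.
  apply: le_trans (Np_D mO hp lD1 lD2) _; rewrite ler_wpM2l ?(ltW q0)//.
  rewrite (Np_Z mO _ (Lp_norm dl)) (Np_Z mO _ (Lp_norm ltail)).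
  have En w : Np (fun x => `|w x|) = Np w.
    by apply: eq_Rintegral => x _; rewrite normr_id.
  have cK0 : 0 <= c * K_ i by exact: mulr_ge0.
  have cc0 : 0 <= 2 * c by exact: mulr_ge0.
  rewrite !En (ger0_norm cK0) (ger0_norm cc0).
  exact: (lerD (ler_wpM2l (powR_ge0 _ _) h1) (ler_wpM2l (powR_ge0 _ _) Ntail)).
apply: le_trans (Np_D mO hp lA (LpD mO hp lB lD)) _.
apply: (@le_trans _ _ (q * (c `^ p * del + q * (c `^ p * del + q * ((c * K_ i) `^ p * del + (2 * c) `^ p * tau))))).
  apply: (ler_wpM2l (ltW q0)); apply: (lerD NA); apply: (le_trans (Np_D mO hp lB lD)).
  exact: (ler_wpM2l (ltW q0) (lerD NB ND)).
have Ki : (c * K_ i) `^ p <= S.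
  by rewrite /S (bigD1 i)//= lerDl; apply: sumr_ge0 => j _; exact: powR_ge0.
apply: (@le_trans _ _ (C * del + (q ^+ 3 * ((2 * c) `^ p + 1)) * tau)); last first.
  have E1 : C * del = e / 2 by rewrite mulrC /del (divfK (lt0r_neq0 C0)).
  have E2 : (q ^+ 3 * ((2 * c) `^ p + 1)) * tau = e / 2.
    by rewrite mulrC /tau (divfK (lt0r_neq0 qc0)).
  by rewrite E1 E2 -splitr.
have q2 := ltW q0; have cp : 0 <= c `^ p := powR_ge0 _ _.
have X1 : q ^+ 3 * ((c * K_ i) `^ p) * del <= q ^+ 3 * S * del.
  by rewrite ler_wpM2r ?(ltW del0)// ler_wpM2l ?exprn_ge0.
have X2 : 0 <= (c `^ p + 1) * del by rewrite mulr_ge0 ?addr_ge0 ?(ltW del0).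
have X3 : 0 <= q ^+ 3 * tau by rewrite mulr_ge0 ?exprn_ge0 ?(ltW tau0).
rewrite /C -subr_ge0.
have -> : (q * c `^ p + q ^+ 2 * c `^ p + q ^+ 3 * S + c `^ p + 1) * del +
  q ^+ 3 * ((2 * c) `^ p + 1) * tau -
  q * (c `^ p * del + q * (c `^ p * del + q * ((c * K_ i) `^ p * del + (2 * c) `^ p * tau))) =
  (q ^+ 3 * S * del - q ^+ 3 * (c * K_ i) `^ p * del) + (c `^ p + 1) * del + q ^+ 3 * tau by ring.
by apply: addr_ge0 => //; apply: addr_ge0 => //; rewrite subr_ge0.
Qed.

Lemma smooth_flat_comp (a c : R) psi : 0 < c -> smooth psi ->
  smooth (fun x => flat a c (psi x)) /\
  forall i, partial i (fun x => flat a c (psi x)) = fun x => dflat a c (psi x) * partial i psi x.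
Proof.
move=> c0 sp; split=> [|i].
  by apply/smoothP => k; apply: Ck_flat => //; exact: (smoothP _).1.
have [_ ->] := partial_comp (h := flat a c) (h' := dflat a c) i
  (fun x => smooth_diff x sp) (fun x => is_derive_flat a (psi x) c0).
by [].
Qed.

Lemma measurable_flat (a c : R) : 0 < c -> measurable_fun setT (flat a c).
Proof.
move=> c0; apply: continuous_measurable_fun => t.
apply: differentiable_continuous; apply/derivable1_diffP.
by have [] := is_derive_flat a t c0.
Qed.

Lemma measurable_dflat (a c : R) : 0 < c -> measurable_fun setT (dflat a c).
Proof.
by move=> c0; apply: measurable_funD; apply: measurable_funM => //; exact: measurable_flat.
Qed.

(** The functions [flat 1 (harmonic m)] of u are dominated by |u|, and their gradients by those of
    u, because their slopes lie in [0, 1]. Being nonnegative on all reals, [flat] also makes the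
    approximating test functions nonnegative. *)
Lemma W0app_pos u G : W0app setT u G ->
  W0app [set t | 0 <= t] (fun x => Num.max (u x) 0) (fun x => if 0 < u x then G x else 0).
Proof.
move=> hu; have [lu lG _] := hu.
have h0 m : 0 < harmonic m :> R by rewrite /harmonic invr_gt0.
have l1 m t : `|flat 1 (harmonic m) t| <= `|t| :> R.
  have := flat_lip1 (h0 m) t 0; by rewrite (@flat_le0 _ _ _ 0)// !subr0.
apply: (@W0app_limit_seq R n Omega p oO bO hp _
   (fun m x => 1 * flat 1 (harmonic m) (u x))
   (fun m x => \row_i (partial i (fun=> 1) x * flat 1 (harmonic m) (u x) +
       1 * dflat 1 (harmonic m) (u x) * G x ord0 i))
   _ _ (fun x => `|u x|) (fun i x => `|G x ord0 i|)).
- by apply: measurable_maxr => //; exact: lu.1.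
- move=> i; rewrite (_ : (fun x => _) = fun x => if 0 < u x then G x ord0 i else 0).
    by apply: measurable_if; [apply: measurable_fun_ltr => //; exact: lu.1|exact: (lG i).1|].
  by apply/funext => x; case: ifP; rewrite ?mxE.
- move=> m; apply: (@W0app_chain setT _ _ _ _ (1 + 6 / harmonic m) 1) => //.
  + by rewrite addr_ge0// divr_ge0// ltW.
  + exact: smooth_cst.
  + by move=> x; rewrite normr1.
  + by move=> i x; rewrite partial_cst normr0.
  + by right; exact: flat_le0.
  + by move=> psi tpsi _; apply: smooth_flat_comp => //; exact: test_smooth tpsi.
  + move=> s t _ _; apply: le_trans (flat_lip1 (h0 m) s t) _.
    by rewrite -[leLHS]mul1r ler_wpM2r// lerDl divr_ge0// ltW.
  + move=> t _; rewrite ger0_norm ?dflat1_ge0//.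
    by apply: le_trans (dflat1_le1 _ (h0 m)) _; rewrite lerDl divr_ge0// ltW.
  + move=> s t _ _; apply: le_trans (dflat1_lip (h0 m) s t) _.
    by rewrite ler_wpM2r// lerDr.
  + exact: measurable_flat.
  + exact: measurable_dflat.
  + by move=> x t _ /=; rewrite mul1r flat_ge0.
- exact: Lp_norm.
- by move=> i; exact: Lp_norm.
- by move=> m x _; rewrite mul1r.
- by move=> x _; under eq_fun do rewrite mul1r; exact: cvg_flat1.
- move=> m i x _; rewrite mxE partial_cst mul0r add0r mul1r normrM.
  by rewrite ler_piMl// ger0_norm ?dflat1_ge0// dflat1_le1.
- move=> i x _; under eq_fun do rewrite mxE partial_cst mul0r add0r mul1r.
  have -> : (if 0 < u x then G x else 0) ord0 i = (0 < u x)%R%:R * G x ord0 i.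
    by case: ifP; rewrite ?mul1r ?mul0r// mxE.
  by apply: cvgMl; exact: cvg_dflat1.
Qed.

End chain_rule.

(** * Pointwise inequalities for the p-Laplacian flux *)

Section euclidean_lemmas.
Context {R : realType} {n : nat}.
Implicit Types v w : 'rV[R]_n.

Lemma dotpC v w : dotp v w = dotp w v.
Proof. by apply: eq_bigr => i _; rewrite mulrC. Qed.

Lemma dotpDr v w1 w2 : dotp v (w1 + w2) = dotp v w1 + dotp v w2.
Proof. by rewrite /dotp -big_split; apply: eq_bigr => i _; rewrite mxE mulrDr. Qed.

Lemma dotpZr v a w : dotp v (a *: w) = a * dotp v w.
Proof. by rewrite /dotp mulr_sumr; apply: eq_bigr => i _; rewrite mxE mulrCA. Qed.

Lemma dotpNr v w : dotp v (- w) = - dotp v w.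
Proof. by rewrite -scaleN1r dotpZr mulN1r. Qed.

Lemma dotp0r v : dotp v 0 = 0.
Proof. by rewrite /dotp big1// => i _; rewrite mxE mulr0. Qed.

Lemma dotp0l v : dotp 0 v = 0.
Proof. by rewrite dotpC dotp0r. Qed.

Lemma dotp_ge0 v : 0 <= dotp v v.
Proof. by apply: sumr_ge0 => i _; rewrite -expr2 sqr_ge0. Qed.

Lemma enorm_ge0 v : 0 <= enorm v.
Proof. exact: sqrtr_ge0. Qed.

Lemma sqr_enorm v : enorm v ^+ 2 = dotp v v.
Proof. by rewrite sqr_sqrtr// dotp_ge0. Qed.

Lemma enorm0 : enorm (0 : 'rV[R]_n) = 0.
Proof. by rewrite /enorm dotp0r sqrtr0. Qed.

Lemma enormZ a v : enorm (a *: v) = `|a| * enorm v.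
Proof.
rewrite /enorm dotpZr dotpC dotpZr mulrA -expr2 sqrtrM ?sqr_ge0//.
by rewrite sqrtr_sqr.
Qed.

Lemma enormN v : enorm (- v) = enorm v.
Proof. by rewrite -scaleN1r enormZ normrN1 mul1r. Qed.

Lemma coord_le_enorm v i : `|v ord0 i| <= enorm v.
Proof.
rewrite -sqrtr_sqr ler_wsqrtr// /dotp (bigD1 i)//= -expr2 lerDl.
by apply: sumr_ge0 => j _; rewrite -expr2 sqr_ge0.
Qed.

Lemma enorm_eq0 v : enorm v = 0 -> v = 0.
Proof.
move=> v0; apply/rowP => i; rewrite mxE; apply/eqP; rewrite -normr_le0 -v0.
exact: coord_le_enorm.
Qed.

Lemma enorm_le_sum v : enorm v <= \sum_(i < n) `|v ord0 i|.
Proof.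
have S0 : 0 <= \sum_(i < n) `|v ord0 i| by exact: sumr_ge0.
rewrite -(@ler_pXn2r _ 2) ?nnegrE ?enorm_ge0// sqr_enorm expr2 mulr_suml.
apply: ler_sum => i _; apply: le_trans (ler_norm _) _; rewrite normrM ler_wpM2l//.
by rewrite (bigD1 i)//= lerDl; exact: sumr_ge0.
Qed.

(** Expand the square of (w . w) v - (v . w) w and divide by w . w. *)
Lemma dotp_le v w : `|dotp v w| <= enorm v * enorm w.
Proof.
have [w0|w0] := eqVneq (enorm w) 0.
  by rewrite (enorm_eq0 w0) dotp0r enorm0 normr0 mulr0.
have ww : 0 < dotp w w by rewrite -sqr_enorm exprn_gt0// lt_neqAle eq_sym w0 enorm_ge0.
rewrite -(@ler_pXn2r _ 2) ?nnegrE ?mulr_ge0 ?enorm_ge0// exprMn !sqr_enorm.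
rewrite real_normK ?num_real//.
have := dotp_ge0 (dotp w w *: v + - (dotp v w *: w)).
rewrite dotpDr !dotpNr !dotpZr ![dotp (_ + _) _]dotpC !dotpDr !dotpNr !dotpZr.
rewrite (dotpC w v) => h.
have : 0 <= dotp w w * (dotp v v * dotp w w - dotp v w ^+ 2) by apply: le_trans h _; rewrite le_eqVlt; apply/orP; left; apply/eqP; ring.
by rewrite pmulr_rge0// subr_ge0.
Qed.

(** The case a = 0 is separate because negative powers of 0 do not obey the exponent law. *)
Lemma powR2_mul (p : R) (a : R) : 1 < p -> 0 <= a -> a `^ (p - 2) * a ^+ 2 = a `^ p.
Proof.
move=> hp a0; have [->|an0] := eqVneq a 0.
  by rewrite expr0n mulr0 powR0// gt_eqF// (lt_trans _ hp).
rewrite -powR_mulrn// -powRD; last by rewrite an0 implybT.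
by congr powR; ring.
Qed.

Lemma powR1_mul (p : R) (a : R) : 1 < p -> 0 <= a -> a `^ (p - 2) * a = a `^ (p - 1).
Proof.
move=> hp a0; have [->|an0] := eqVneq a 0.
  by rewrite mulr0 powR0// gt_eqF// subr_gt0.
rewrite -[X in _ * X]powRr1// -powRD; last by rewrite an0 implybT.
by congr powR; ring.
Qed.

Lemma flux_dotp (p : R) v : 1 < p -> enorm v `^ (p - 2) * dotp v v = enorm v `^ p.
Proof. by move=> hp; rewrite -sqr_enorm powR2_mul// enorm_ge0. Qed.

Lemma flux_le (p : R) v w : 1 < p ->
  `|enorm v `^ (p - 2) * dotp v w| <= enorm v `^ (p - 1) * enorm w.
Proof.
move=> hp; rewrite normrM ger0_norm ?powR_ge0// -powR1_mul ?enorm_ge0// -mulrA.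
by rewrite ler_wpM2l ?powR_ge0// dotp_le.
Qed.

Lemma abs_powR_mul_le (p : R) (a b : R) : 1 < p ->
  `| `|a| `^ (p - 2) * a * b| = `|a| `^ (p - 1) * `|b|.
Proof. by move=> hp; rewrite !normrM (@ger0_norm _ (_ `^ _)) ?powR_ge0// powR1_mul. Qed.

(** Cauchy-Schwarz on the two cross terms leaves (|v| - |w|) (|v|^(p-1) - |w|^(p-1)), which is
    nonnegative as t^(p-1) is increasing. *)
Lemma flux_monotone (p : R) v w : 1 < p ->
  0 <= enorm v `^ (p - 2) * dotp v (v - w) - enorm w `^ (p - 2) * dotp w (v - w).
Proof.
move=> hp; have ev := flux_dotp v hp; have ew := flux_dotp w hp.
have E1 : dotp v (v - w) = dotp v v - dotp v w by rewrite dotpDr dotpNr.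
have E2 : dotp w (v - w) = dotp w v - dotp w w by rewrite dotpDr dotpNr.
rewrite E1 E2.
have p10 : 0 < p - 1 by rewrite subr_gt0.
have h1 : enorm v `^ (p - 2) * dotp v w <= enorm v `^ (p - 1) * enorm w.
  by apply: le_trans (flux_le _ _ hp); exact: ler_norm.
have h2 : enorm w `^ (p - 2) * dotp w v <= enorm w `^ (p - 1) * enorm v.
  by apply: le_trans (flux_le _ _ hp); exact: ler_norm.
have p0 : 0 < p by exact: lt_trans hp.
have e1 := mulr_powRB1 (enorm_ge0 v) p0.
have e2 := mulr_powRB1 (enorm_ge0 w) p0.
have h3 : 0 <= (enorm v - enorm w) * (enorm v `^ (p - 1) - enorm w `^ (p - 1)).
  have [vw|/ltW wv] := leP (enorm v) (enorm w).
    by rewrite mulr_le0 // subr_le0// ge0_ler_powR ?nnegrE ?enorm_ge0// ltW.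
  by rewrite mulr_ge0 // subr_ge0// ge0_ler_powR ?nnegrE ?enorm_ge0// ltW.
rewrite -e1 in ev; rewrite -e2 in ew; move: ev ew h1 h2 h3.
move: (enorm v `^ (p - 1)) (enorm w `^ (p - 1)) (enorm v `^ (p - 2)) (enorm w `^ (p - 2)).
move: (dotp v v) (dotp v w) (dotp w v) (dotp w w) (enorm v) (enorm w).
by move=> dvv dvw dwv dww a b x y A B ev ew h1 h2 h3; lra.
Qed.

End euclidean_lemmas.

Section weak_solutions.
Context {R : realType} {n : nat}.
Variables (Omega : set 'rV[R]_n) (p : R).
Hypotheses (oO : open Omega) (bO : bounded_set Omega) (hp : 1 < p).
Local Notation mu := (@lebesgue_rV R n).
Local Notation test := (test_function Omega).
Local Notation Lp := (Lp mu Omega p).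
Local Notation Np := (Np mu Omega p).
Local Notation intg := (intg mu Omega).
Local Notation W0app := (W0app Omega p).
Local Notation I f := (\int[mu]_(x in Omega) f x).
Local Notation aeO P := {ae mu, forall x, Omega x -> P x}.
Implicit Types (u v phi psi : 'rV[R]_n -> R) (G H : 'rV[R]_n -> 'rV[R]_n) (J : set R).
Let mO : measurable Omega := measurable_domain oO.
Let fO := finite_domain oO bO.
Let p0 : 0 < p. Proof. exact: lt_trans hp. Qed.

Definition LpV G := forall i, Lp (fun x => G x ord0 i).

Lemma measurable_dotp G H : (forall i, measurable_fun Omega (fun x => G x ord0 i)) ->
  (forall i, measurable_fun Omega (fun x => H x ord0 i)) ->
  measurable_fun Omega (fun x => dotp (G x) (H x)).
Proof. by move=> mG mH; apply: measurable_sum => i; exact: measurable_funM. Qed.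

Lemma measurable_enorm G : (forall i, measurable_fun Omega (fun x => G x ord0 i)) ->
  measurable_fun Omega (fun x => enorm (G x)).
Proof.
move=> mG; have : measurable_fun Omega (fun x => dotp (G x) (G x)) by exact: measurable_dotp.
apply: measurableT_comp; apply: continuous_measurable_fun; exact: sqrt_continuous.
Qed.

Lemma LpV_measurable G i : LpV G -> measurable_fun Omega (fun x => G x ord0 i).
Proof. by move=> lG; exact: (lG i).1. Qed.

Lemma Lp_sum (F : 'I_n -> 'rV[R]_n -> R) : (forall i, Lp (F i)) ->
  Lp (fun x => \sum_(i < n) F i x).
Proof.
move=> h; elim: (index_enum _) => [|j s IH].
  under eq_fun do rewrite big_nil.
  by apply: (Lp_bounded mO hp fO (M := 0)) => //; rewrite normr0.
under eq_fun do rewrite big_cons.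
exact: LpD.
Qed.

Lemma Lp_enorm G : LpV G -> Lp (fun x => enorm (G x)).
Proof.
move=> lG; apply: (Lp_le mO hp _ _ (Lp_sum (fun i => Lp_norm (lG i)))).
  by apply: measurable_enorm => i; exact: LpV_measurable.
move=> x _; rewrite ger0_norm ?enorm_ge0//; apply: le_trans (enorm_le_sum _) _.
exact: ler_norm.
Qed.

Lemma intg_enorm_powR G : LpV G -> intg (fun x => enorm (G x) `^ p).
Proof.
move=> /Lp_enorm[_]; apply: (eq_intg mO) => x _.
by rewrite ger0_norm ?enorm_ge0.
Qed.

Lemma measurable_flux G H : LpV G -> LpV H ->
  measurable_fun Omega (fun x => enorm (G x) `^ (p - 2) * dotp (G x) (H x)).
Proof.
move=> lG lH; apply: measurable_funM.
  apply: (measurableT_comp (measurable_powR (p - 2))); apply: measurable_enorm => i.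
  exact: LpV_measurable.
by apply: measurable_dotp => i; exact: LpV_measurable.
Qed.

Lemma intg_flux G H : LpV G -> LpV H ->
  intg (fun x => enorm (G x) `^ (p - 2) * dotp (G x) (H x)).
Proof.
move=> lG lH; apply: (intg_mix mO hp _ (Lp_enorm lG) (Lp_enorm lH)).
  exact: measurable_flux.
by move=> x _; rewrite !(ger0_norm (enorm_ge0 _)); exact: flux_le.
Qed.

Lemma measurable_power_term u v : Lp u -> Lp v ->
  measurable_fun Omega (fun x => `|u x| `^ (p - 2) * u x * v x).
Proof.
move=> lu lv; apply: measurable_funM; last exact: lv.1.
by apply: measurable_funM; [apply: measurable_norm_powR|]; exact: lu.1.
Qed.

Lemma intg_power_term u v : Lp u -> Lp v -> intg (fun x => `|u x| `^ (p - 2) * u x * v x).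
Proof.
move=> lu lv; apply: (intg_mix mO hp _ lu lv); first exact: measurable_power_term.
by move=> x _; rewrite abs_powR_mul_le.
Qed.

Lemma Np_eq0 u : Lp u -> Np u = 0 -> aeO (fun x => u x = 0).
Proof.
move=> lu /(I_eq0 mO lu.2) h.
have := h (fun x _ => powR_ge0 _ _); apply: filterS => x + Ox => /(_ Ox) /powR_eq0_eq0.
exact: normr0_eq0.
Qed.

Lemma Np_gt0 u : Lp u -> ~ aeO (fun x => u x = 0) -> 0 < Np u.
Proof.
move=> lu nu; rewrite lt_neqAle Np_ge0 andbT; apply/negP => /eqP/esym/Np_eq0 h.
exact/nu/h.
Qed.

Definition energy G := I (fun x => enorm (G x) `^ p).

Lemma energy_ge0 G : 0 <= energy G.
Proof. by apply: Rintegral_ge0 => x _; exact: powR_ge0. Qed.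

Lemma lambda1_lt lambda J u G : (lambda%:E < lambda1 Omega p)%E -> W0app J u G ->
  ~ aeO (fun x => u x = 0) -> lambda * Np u < energy G.
Proof.
move=> hl hu nu; have [w [wu wG]] := W0app_record oO bO hp hu.
have Nu := Np_gt0 (let: And3 a _ _ := hu in a) nu.
rewrite -ltr_pdivlMr// -lte_fin; apply: lt_le_trans hl _.
apply: ereal_inf_lbound; exists w; first by rewrite /= /W0_nonzero wu.
by rewrite /grad_energy /mass wu wG.
Qed.

Lemma lambda_star_lt f lambda J u G : (lambda%:E < lambda_star Omega p f)%E -> W0app J u G ->
  ~ aeO (fun x => u x = 0) -> I (fun x => f x * u x) = 0 -> lambda * Np u < energy G.
Proof.
move=> hl hu nu fu; have [w [wu wG]] := W0app_record oO bO hp hu.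
have Nu := Np_gt0 (let: And3 a _ _ := hu in a) nu.
rewrite -ltr_pdivlMr// -lte_fin; apply: lt_le_trans hl _.
apply: ereal_inf_lbound; exists w; first by rewrite /= /W0_nonzero wu.
by rewrite /grad_energy /mass wu wG.
Qed.

Lemma W0app_neg u G : W0app setT u G ->
  W0app [set t | 0 <= t] (fun x => Num.max (- u x) 0) (fun x => if 0 < - u x then - G x else 0).
Proof.
move=> hu; apply: (W0app_pos oO bO hp).
have := W0appD oO bO hp (-1) 0 hu hu.
congr W0app; apply/funext => x; rewrite ?mul0r ?addr0 ?mulN1r//.
by rewrite scale0r addr0 scaleN1r.
Qed.

(** Both parts of u carry the gradient 0 on {u = 0}, so in u - u^+ + u^- the values cancel
    everywhere, and the gradients everywhere except there. *)
Lemma W0app_zero_level u G : W0app setT u G ->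
  W0app setT (fun=> 0) (fun x => if u x == 0 then G x else 0).
Proof.
move=> hu; have hp' := W0appS (@subsetT _ _) (W0app_pos oO bO hp hu).
have hm' := W0appS (@subsetT _ _) (W0app_neg hu).
have := W0appD oO bO hp 1 1 (W0appD oO bO hp 1 (-1) hu hp') hm'.
congr W0app; apply/funext => x; rewrite ?scale1r ?scaleN1r.
  rewrite !mul1r mulN1r; have [h|h] := leP (u x) 0.
    by rewrite max_l ?subr0 ?subrr// oppr_ge0.
  by rewrite max_r ?subrr ?addr0// oppr_le0 ltW.
rewrite oppr_gt0; have [h|h|h] := ltgtP (u x) 0.
- by rewrite subr0 subrr.
- by rewrite subrr addr0.
- by rewrite subr0 addr0.
Qed.

Lemma test_W0app J phi : test phi -> (forall x, J (phi x)) ->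
  W0app J phi (fun x => \row_i partial i phi x).
Proof.
move=> tphi Jphi; split.
- exact: test_Lp.
- by move=> i; under eq_fun do rewrite mxE; apply: test_Lp => //; exact: test_partial.
- move=> e e0; have N0 : Np (fun=> 0) = 0.
    by rewrite /Np normr0 powR0 ?gt_eqF// Rintegral_cst// mul0r.
  exists phi; split => //.
    by under [X in Np X <= _]eq_fun do rewrite subrr; rewrite N0 ltW.
  by move=> i; under [X in Np X <= _]eq_fun do rewrite mxE subrr; rewrite N0 ltW.
Qed.

End weak_solutions.

(** * Energy identities *)

Section solutions.
Context {R : realType} {n : nat}.
Variables (Omega : set 'rV[R]_n) (p : R).
Hypotheses (oO : open Omega) (bO : bounded_set Omega) (hp : 1 < p).
Local Notation mu := (@lebesgue_rV R n).
Local Notation test := (test_function Omega).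
Local Notation Lp := (Lp mu Omega p).
Local Notation Np := (Np mu Omega p).
Local Notation intg := (intg mu Omega).
Local Notation W0app := (W0app Omega p).
Local Notation I f := (\int[mu]_(x in Omega) f x).
Local Notation aeO P := {ae mu, forall x, Omega x -> P x}.
Local Notation energy := (energy Omega p).
Implicit Types (u v phi psi : 'rV[R]_n -> R) (G H : 'rV[R]_n -> 'rV[R]_n) (J : set R).
Let mO : measurable Omega := measurable_domain oO.
Let fO := finite_domain oO bO.
Let p0 : 0 < p. Proof. exact: lt_trans hp. Qed.
Variables (f : 'rV[R]_n -> R) (F : R) (lambda : R).
Hypotheses (mf : measurable_fun Omega f) (f0 : forall x, Omega x -> 0 <= f x)
  (fF : forall x, Omega x -> f x <= F).

Lemma intg_source v : Lp v -> intg (fun x => f x * v x).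
Proof.
move=> lv; apply: (intg_le mO (g := fun x => F * `|v x|)).
- by apply: measurable_funM => //; exact: lv.1.
- by move=> x Ox; rewrite normrM (ger0_norm (f0 Ox)) ler_wpM2r// fF.
- by apply: intgZ => //; exact: (Lp_intg mO hp fO).
Qed.

Lemma source_ge0 v : (forall x, 0 <= v x) -> 0 <= I (fun x => f x * v x).
Proof. by move=> v0; apply: Rintegral_ge0 => x Ox; rewrite mulr_ge0 ?f0. Qed.

Lemma source_combination a b u v : Lp u -> Lp v ->
  I (fun x => f x * (a * u x + b * v x)) =
  a * I (fun x => f x * u x) + b * I (fun x => f x * v x).
Proof.
move=> lu lv; rewrite -(I_lincomb mO _ _ (intg_source lu) (intg_source lv)).
by apply: eq_Rintegral => x _; ring.
Qed.

(** Quantifying over pairs rather than records lets a function be tested with any gradient that the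
    calculus produces for it. *)
Definition solves u G : Prop := forall phi H, W0app setT phi H ->
  I (fun x => enorm (G x) `^ (p - 2) * dotp (G x) (H x)) =
  lambda * I (fun x => `|u x| `^ (p - 2) * u x * phi x) + I (fun x => f x * phi x).

Definition sol u G : Prop := W0app setT u G /\ solves u G.

Lemma W0app_Lp J u G : W0app J u G -> Lp u. Proof. by case. Qed.

Lemma W0app_LpV J u G : W0app J u G -> LpV Omega p G. Proof. by case. Qed.

Lemma power_term_self u : I (fun x => `|u x| `^ (p - 2) * u x * u x) = Np u.
Proof.
apply: eq_Rintegral => x _; rewrite -mulrA -expr2 -[X in _ * X]real_normK ?num_real//.
by rewrite powR2_mul.
Qed.

Lemma energy_self G : I (fun x => enorm (G x) `^ (p - 2) * dotp (G x) (G x)) = energy G.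
Proof. by apply: eq_Rintegral => x _; exact: flux_dotp. Qed.

Lemma solves_self u G : sol u G -> energy G = lambda * Np u + I (fun x => f x * u x).
Proof. by move=> [hu su]; rewrite -energy_self (su _ _ hu) power_term_self. Qed.

Lemma energy_eq0 G : LpV Omega p G -> energy G = 0 -> aeO (fun x => G x = 0).
Proof.
move=> lG /(I_eq0 mO (intg_enorm_powR oO bO hp lG)) h.
have := h (fun x _ => powR_ge0 _ _); apply: filterS => x + Ox => /(_ Ox) /powR_eq0_eq0.
exact: enorm_eq0.
Qed.

(* Test with the pair [(0, 1_{u = 0} grad u)], which is the function
   [u - u^+ + u^-] with its gradient. *)
Lemma solves_grad_zero_level u G : sol u G -> aeO (fun x => u x = 0 -> G x = 0).
Proof.
move=> [hu su]; have hz := W0app_zero_level oO bO hp hu.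
have := su _ _ hz.
have -> : I (fun x => `|u x| `^ (p - 2) * u x * 0) = 0.
  by under eq_Rintegral do rewrite mulr0; rewrite Rintegral_cst// mul0r.
have -> : I (fun x => f x * 0) = 0.
  by under eq_Rintegral do rewrite mulr0; rewrite Rintegral_cst// mul0r.
rewrite mulr0 addr0 => E.
have lz := W0app_LpV hz.
have : energy (fun x => if u x == 0 then G x else 0) = 0.
  rewrite -[RHS]E; apply: eq_Rintegral => x _; case: (u x == 0).
    by rewrite flux_dotp.
  by rewrite enorm0 dotp0r mulr0 powR0// gt_eqF.
move=> /(energy_eq0 lz); apply: filterS => x h Ox ux.
by have := h Ox; rewrite ux eqxx.
Qed.

Lemma solves_pos_part u G : sol u G ->
  energy (fun x => if 0 < u x then G x else 0) =
  lambda * Np (fun x => Num.max (u x) 0) + I (fun x => f x * Num.max (u x) 0).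
Proof.
move=> [hu su]; have hup := W0appS (@subsetT _ _) (W0app_pos oO bO hp hu).
have := su _ _ hup.
have -> : I (fun x => `|u x| `^ (p - 2) * u x * Num.max (u x) 0) = Np (fun x => Num.max (u x) 0).
  rewrite -power_term_self; apply: eq_Rintegral => x _.
  have [h|h] := leP (u x) 0; first by rewrite !mulr0.
  by [].
move=> <-; apply: eq_Rintegral => x _; case: (0 < u x); first by rewrite flux_dotp.
by rewrite enorm0 dotp0r mulr0 powR0// gt_eqF.
Qed.

Lemma solves_neg_part u G : sol u G ->
  energy (fun x => if 0 < - u x then - G x else 0) =
  lambda * Np (fun x => Num.max (- u x) 0) - I (fun x => f x * Num.max (- u x) 0).
Proof.
move=> [hu su]; have hum := W0appS (@subsetT _ _) (W0app_neg oO bO hp hu).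
have lum := W0app_Lp hum; have lu := W0app_Lp hu.
have := su _ _ hum.
have -> : I (fun x => `|u x| `^ (p - 2) * u x * Num.max (- u x) 0) = - Np (fun x => Num.max (- u x) 0).
  rewrite -power_term_self -[RHS]mulN1r -RintegralZl//; last exact: intg_power_term.
  apply: eq_Rintegral => x _; have [h|h] := leP (- u x) 0; first by rewrite !mulr0.
  by rewrite normrN; ring.
have -> : I (fun x => enorm (G x) `^ (p - 2) * dotp (G x) (if 0 < - u x then - G x else 0)) =
   - energy (fun x => if 0 < - u x then - G x else 0).
  rewrite -[RHS]mulN1r -RintegralZl//; last exact: (intg_enorm_powR oO bO hp (W0app_LpV hum)).
  apply: eq_Rintegral => x _; case: (0 < - u x); last by rewrite dotp0r mulr0 enorm0 powR0 ?mulr0// gt_eqF.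
  by rewrite dotpNr mulrN flux_dotp// enormN mulN1r.
move=> /(congr1 -%R); rewrite opprK => ->; ring.
Qed.

Lemma max0_ge0 (t : R) : 0 <= Num.max t 0.
Proof. by have [h|/ltW] := leP t 0. Qed.

Lemma max_decomp (t : R) : t = Num.max t 0 - Num.max (- t) 0.
Proof.
have [h|h] := leP t 0.
  by rewrite max_l ?oppr_ge0// sub0r opprK.
by rewrite max_r ?subr0// oppr_le0 ltW.
Qed.

Lemma aeO_nonneg u : aeO (fun x => Num.max (- u x) 0 = 0) -> aeO (fun x => 0 <= u x).
Proof.
apply: filterS => x h Ox; rewrite (max_decomp (u x)) h// subr0; exact: max0_ge0.
Qed.

Lemma solves_nonneg_below_lambda1 u G : sol u G -> (lambda%:E < lambda1 Omega p)%E ->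
  aeO (fun x => 0 <= u x).
Proof.
move=> hu hl; apply: aeO_nonneg; apply: contrapT => nz.
have := lambda1_lt oO bO hp hl (W0app_neg oO bO hp hu.1) nz.
rewrite (solves_neg_part hu) ltNge => /negP; apply.
by rewrite gerBl; apply: source_ge0 => x; exact: max0_ge0.
Qed.

Lemma solves_nonneg_below_lambda_star u G : sol u G -> (lambda%:E < lambda_star Omega p f)%E ->
  0 <= I (fun x => f x * u x) -> aeO (fun x => 0 <= u x).
Proof.
move=> hu hl fu0; apply: aeO_nonneg; apply: contrapT => nz.
have hup := W0appS (@subsetT _ _) (W0app_pos oO bO hp hu.1).
have hum := W0appS (@subsetT _ _) (W0app_neg oO bO hp hu.1).
have lup := W0app_Lp hup; have lum := W0app_Lp hum.
set a := I (fun x => f x * Num.max (u x) 0).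
set b := I (fun x => f x * Num.max (- u x) 0).
have Eup := solves_pos_part hu; have Eum := solves_neg_part hu.
have b0 : 0 <= b by apply: source_ge0 => x; exact: max0_ge0.
have ab : b <= a.
  have : I (fun x => f x * u x) = a - b.
    have := source_combination 1 (-1) lup lum; rewrite mul1r mulN1r => <-.
    by apply: eq_Rintegral => x _; rewrite mul1r mulN1r -max_decomp.
  by move=> E; rewrite -subr_ge0 -E.
have bgt0 : 0 < b.
  rewrite lt_neqAle b0 andbT; apply/negP => /eqP/esym bE.
  have := lambda_star_lt oO bO hp hl hum nz bE.
  by rewrite Eum -/b bE subr0 ltxx.
have agt0 : 0 < a by exact: lt_le_trans ab.
have aE : a = I (fun x => f x * Num.max (u x) 0) by [].
have bE : b = I (fun x => f x * Num.max (- u x) 0) by [].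
clearbody a b.
pose v x := b * Num.max (u x) 0 + (- a) * Num.max (- u x) 0.
pose V x := b *: (if 0 < u x then G x else 0) + (- a) *: (if 0 < - u x then - G x else 0).
have hv : W0app setT v V by exact: W0appD.
(* At each point one of the two parts vanishes, so p-th powers of the combination split without
   cross terms; the same happens for the gradients in [EV]. *)
have split_abs (s t : R) : (s = 0 \/ t = 0) -> 0 <= s -> 0 <= t ->
    `|b * s + - a * t| `^ p = b `^ p * `|s| `^ p + a `^ p * `|t| `^ p.
  have z : `|0 : R| `^ p = 0 by rewrite normr0 powR0// gt_eqF.
  move=> [->|->] s0 t0; rewrite z.
    have -> : b * 0 + - a * t = - (a * t) by ring.
    rewrite normrN normrM (gtr0_norm agt0) (powRM p (ltW agt0) (normr_ge0 t)).
    by rewrite (mulr0 (b `^ p)) (add0r (a `^ p * _)).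
  have -> : b * s + - a * 0 = b * s by ring.
  rewrite normrM (gtr0_norm bgt0) (powRM p (ltW bgt0) (normr_ge0 s)).
  by rewrite (mulr0 (a `^ p)) (addr0 (b `^ p * _)).
have Nv : Np v = b `^ p * Np (fun x => Num.max (u x) 0) + a `^ p * Np (fun x => Num.max (- u x) 0).
  rewrite /Np -(I_lincomb mO _ _ lup.2 lum.2).
  apply: eq_Rintegral => x _; rewrite /v split_abs ?max0_ge0//.
  have [h|h] := leP (u x) 0; [by left|right].
  by rewrite max_r// oppr_le0 ltW.
have EV : energy V = b `^ p * energy (fun x => if 0 < u x then G x else 0) +
    a `^ p * energy (fun x => if 0 < - u x then - G x else 0).
  have i1 := intg_enorm_powR oO bO hp (W0app_LpV hup).
  have i2 := intg_enorm_powR oO bO hp (W0app_LpV hum).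
  rewrite /energy -(I_lincomb mO _ _ i1 i2).
  apply: eq_Rintegral => x _; rewrite /V oppr_gt0.
  have z : enorm (0 : 'rV[R]_n) `^ p = 0 by rewrite enorm0 powR0// gt_eqF.
  have [h|h|h] := ltgtP (u x) 0.
  - rewrite z (scaler0 _ b) (add0r (- a *: _)) (mulr0 (b `^ p)) (add0r (a `^ p * _)).
    rewrite enormZ normrN (gtr0_norm agt0).
    exact: powRM (ltW agt0) (enorm_ge0 _).
  - rewrite z (scaler0 _ (- a)) (addr0 (b *: _)) (mulr0 (a `^ p)) (addr0 (b `^ p * _)).
    rewrite enormZ (gtr0_norm bgt0).
    exact: powRM (ltW bgt0) (enorm_ge0 _).
  - rewrite (scaler0 _ b) (scaler0 _ (- a)) (addr0 (0 : 'rV[R]_n)) z.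
    by rewrite (mulr0 (b `^ p)) (mulr0 (a `^ p)) (addr0 (0 : R)).
have nv : ~ aeO (fun x => v x = 0).
  move=> h; apply: nz; apply: filterS h => x h Ox.
  have := h Ox; rewrite /v; have [u0|u0] := leP (u x) 0.
    rewrite mulr0 add0r => /eqP; rewrite mulf_eq0 oppr_eq0 gt_eqF//=.
    by move=> /eqP.
  by move=> _; rewrite max_r// oppr_le0 ltW.
have fv : I (fun x => f x * v x) = 0.
  by rewrite source_combination// -aE -bE; ring.
have := lambda_star_lt oO bO hp hl hv nv fv.
rewrite Nv EV Eup Eum -aE -bE ltNge => /negP; apply.
rewrite -subr_ge0.
have e1 := mulr_powRB1 (ltW bgt0) p0; have e2 := mulr_powRB1 (ltW agt0) p0.
have -> : lambda * (b `^ p * Np (fun x => Num.max (u x) 0) + a `^ p * Np (fun x => Num.max (- u x) 0)) -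
  (b `^ p * (lambda * Np (fun x => Num.max (u x) 0) + a) +
   a `^ p * (lambda * Np (fun x => Num.max (- u x) 0) - b)) =
  a * b * (a `^ (p - 1) - b `^ (p - 1)).
  rewrite -e1 -e2; move: (Np _) (Np _) (a `^ (p - 1)) (b `^ (p - 1)) => X Y A B; ring.
rewrite !mulr_ge0 ?(ltW agt0)// subr_ge0 ge0_ler_powR ?nnegrE//.
- by rewrite subr_ge0 ltW.
- exact: ltW.
Qed.

(* On nonnegative solutions one may pass to an everywhere nonnegative
   representative which is approximated by nonnegative test functions. *)
Lemma solves_nonneg_representative u G : sol u G -> aeO (fun x => 0 <= u x) ->
  exists v H, [/\ W0app [set t | 0 <= t] v H, solves v H, forall x, 0 <= v x &
    aeO (fun x => v x = u x)].
Proof.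
move=> hu u0; have hg := solves_grad_zero_level hu.
pose v x := Num.max (u x) 0; pose H x := if 0 < u x then G x else 0.
have hv : W0app [set t | 0 <= t] v H by exact: W0app_pos hu.1.
have vu : aeO (fun x => v x = u x).
  by apply: filterS u0 => x h Ox; rewrite /v max_l// h.
(* Restricting the gradient to {u > 0} loses nothing: G vanishes a.e. on {u = 0}. *)
have HG : aeO (fun x => H x = G x).
  apply: filterS2 u0 hg => x h1 h2 Ox; rewrite /H; case: ifPn => // /negP.
  by move=> ux; rewrite h2//; apply/eqP; rewrite eq_le h1// andbT leNgt; exact/negP.
exists v, H; split => //; last by move=> x; exact: max0_ge0.
have lu := W0app_Lp hu.1; have lG := W0app_LpV hu.1.
have lv := W0app_Lp hv; have lH := W0app_LpV hv.
move=> phi K hphi; have lphi := W0app_Lp hphi; have lK := W0app_LpV hphi.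
have -> : I (fun x => enorm (H x) `^ (p - 2) * dotp (H x) (K x)) =
   I (fun x => enorm (G x) `^ (p - 2) * dotp (G x) (K x)).
  apply: (I_ae_eq mO).
  - exact: measurable_flux.
  - exact: measurable_flux.
  - by apply: filterS HG => x h Ox; rewrite h.
have -> : I (fun x => `|v x| `^ (p - 2) * v x * phi x) =
   I (fun x => `|u x| `^ (p - 2) * u x * phi x).
  apply: (I_ae_eq mO).
  - exact: measurable_power_term.
  - exact: measurable_power_term.
  - by apply: filterS vu => x h Ox; rewrite h.
exact: hu.2.
Qed.

End solutions.

(** * Picone's inequality *)

Section young.
Context {R : realType}.

(** Young's inequality for the exponents p / (p - 1) and p, multiplied by [p]. The constants match
    those of [quotient_flux_le] exactly, so nothing is lost in Picone's inequality. *)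
Lemma young_powR (p a b : R) : 1 < p -> 0 <= a -> 0 <= b ->
  p * a `^ (p - 1) * b <= (p - 1) * a `^ p + b `^ p.
Proof.
move=> hp a0 b0; have p0 : 0 < p by exact: lt_trans hp.
have p10 : 0 < p - 1 by rewrite subr_gt0.
pose q := p / (p - 1).
have q0 : 0 < q by rewrite divr_gt0.
have := @conjugate_powR R (a `^ (p - 1)) b q p (powR_ge0 _ _) b0 q0 p0.
have pq : q^-1 + p^-1 = 1 by rewrite /q; field; rewrite !gt_eqF.
move=> /(_ pq); rewrite -powRrM.
have -> : (p - 1) * q = p by rewrite /q mulrC divfK// gt_eqF.
move=> h; have {}h := ler_wpM2l (ltW p0) h; rewrite -mulrA; apply: le_trans h _.
rewrite le_eqVlt; apply/orP; left; apply/eqP; move: (a `^ p) (b `^ p) => s t.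
by rewrite /q; field; rewrite !gt_eqF.
Qed.

(** Rescaling [a] by s with s^p = 1 / 2 leaves half of the coefficient (p - 1), so that the other
    half survives when the term is absorbed. *)
Lemma young_powR_half (p : R) : 1 < p -> exists2 C, 0 < C & forall a b, 0 <= a -> 0 <= b ->
  p * a `^ (p - 1) * b <= (p - 1) / 2 * a `^ p + C * b `^ p.
Proof.
move=> hp; have p0 : 0 < p by exact: lt_trans hp.
have p10 : 0 < p - 1 by rewrite subr_gt0.
pose s : R := 2^-1 `^ p^-1.
have s0 : 0 < s by rewrite powR_gt0// invr_gt0.
have sp : s `^ p = 2^-1 by rewrite /s -powRrM mulVf ?gt_eqF// powRr1// invr_ge0.
pose t := s `^ (p - 1).
have t0 : 0 < t by rewrite powR_gt0.
exists ((t^-1) `^ p); first by rewrite powR_gt0// invr_gt0.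
move=> a b a0 b0.
have tb0 : 0 <= t^-1 * b by rewrite mulr_ge0// invr_ge0 ltW.
have := young_powR hp (mulr_ge0 (ltW s0) a0) tb0.
rewrite (powRM _ (ltW s0) a0) (powRM _ (ltW s0) a0) sp (@powRM _ (t^-1)) ?invr_ge0 ?(ltW t0)//.
rewrite -/t; move: (a `^ (p - 1)) (a `^ p) (b `^ p) (t^-1 `^ p) => x y z w h.
have -> : p * x * b = p * (t * x) * (t^-1 * b) by field; exact: lt0r_neq0.
have -> : (p - 1) / 2 * y = (p - 1) * (2^-1 * y) by ring.
exact: h.
Qed.

Lemma flatM (a b c d t : R) : flat a c t * flat b d t = flat (a + b) (c + d) t.
Proof.
rewrite /flat; case: ifPn => t0; last by rewrite mulr0.
rewrite powRD; last by rewrite (gt_eqF t0) implybT.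
rewrite (_ : - (c + d) / t = - c / t + - d / t); last by ring.
rewrite expRD; ring.
Qed.

(** The chain rule for the p-th power, checked inside the family so that no division by 0 occurs
    where [flat] vanishes. *)
Lemma dflat_powR (a c p t : R) : 1 < p -> 
  dflat (a * p) (c * p) t = p * flat a c t `^ (p - 1) * dflat a c t.
Proof.
move=> hp; have p10 : 0 < p - 1 by rewrite subr_gt0.
have E1 : flat (a * (p - 1)) (c * (p - 1)) t * flat (a - 1) c t = flat (a * p - 1) (c * p) t.
  by rewrite flatM; congr (flat _ _ t); ring.
have E2 : flat (a * (p - 1)) (c * (p - 1)) t * flat (a - 2) c t = flat (a * p - 2) (c * p) t.
  by rewrite flatM; congr (flat _ _ t); ring.
rewrite /dflat flat_powR// -E1 -E2.
by move: (flat _ _ _) (flat _ _ _) (flat _ _ _) => x y z; ring.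
Qed.

End young.

Section picone.
Context {R : realType} {n : nat}.
Variables (Omega : set 'rV[R]_n) (p : R).
Hypotheses (oO : open Omega) (bO : bounded_set Omega) (hp : 1 < p).
Local Notation test := (test_function Omega).
Local Notation W0app := (W0app Omega p).
Local Notation nonneg := [set t : R | 0 <= t].
Implicit Types (v phi psi w : 'rV[R]_n -> R) (H : 'rV[R]_n -> 'rV[R]_n) (J : set R).

Lemma powR_antitone (a s t : R) : a <= 0 -> 0 < s -> s <= t -> t `^ a <= s `^ a.
Proof.
move=> a0 s0 st; have t0 : 0 < t by exact: lt_le_trans st.
rewrite -[a]opprK !(powRN _ (- a)) lef_pV2 ?posrE ?powR_gt0//.
by apply: ge0_ler_powR; rewrite ?oppr_ge0 ?nnegrE ?(ltW s0) ?(ltW t0).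
Qed.

Lemma is_derive_shift_powR (e a t : R) : 0 < t + e ->
  is_derive t (1 : R) (fun s => (s + e) `^ a) (a * (t + e) `^ (a - 1)).
Proof.
move=> te; have d1 := is_derive1_powR a te.
have d0 : is_derive t (1 : R) (fun s : R => s + e) 1.
  apply: (is_derive_eq (is_deriveD (is_derive_id t 1) (is_derive_cst e t 1))).
  exact: addr0.
apply: (is_derive_eq (is_derive1_comp (f := fun s : R => s `^ a) (g := fun s : R => s + e) d1 d0)).
exact: mulr1.
Qed.

Lemma smooth_shift_powR (e a : R) psi : 0 < e -> smooth psi -> (forall x, 0 <= psi x) ->
  smooth (fun x => (psi x + e) `^ a) /\
  forall i, partial i (fun x => (psi x + e) `^ a) =
    fun x => a * (psi x + e) `^ (a - 1) * partial i psi x.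
Proof.
move=> e0 sp psi0; have pe x : 0 < psi x + e by rewrite ltr_wpDl.
split=> [|i].
  apply/smoothP => k; apply: Ck_powR => //; apply: CkD; last exact: Ck_cst.
  exact: (smoothP _).1.
have [_ ->] := partial_comp (h := fun s => (s + e) `^ a) (h' := fun s => a * (s + e) `^ (a - 1)) i
  (fun x => smooth_diff x sp) (fun x => is_derive_shift_powR a (pe x)).
by [].
Qed.

Lemma measurable_shift_powR (e a : R) : measurable_fun setT (fun s : R => (s + e) `^ a).
Proof. by apply: (measurableT_comp (measurable_powR a)); exact: measurable_funD. Qed.

(** This needs nonnegative approximants: (t + e)^a has bounded derivatives only on t >= 0. Compact
    support has to come from [eta], since e^a is not 0. *)
Lemma W0app_quotient (eta : 'rV[R]_n -> R) v H (a e : R) : a < 0 -> 0 < e -> test eta ->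
  (forall x, 0 <= v x) -> W0app nonneg v H ->
  W0app setT (fun x => eta x * (v x + e) `^ a)
    (fun x => \row_i (partial i eta x * (v x + e) `^ a
       + eta x * (a * (v x + e) `^ (a - 1)) * H x ord0 i)).
Proof.
move=> a0 e0 teta v0 hv.
have [M0 hM0] := test_bounded teta.
have /choice[M1 hM1] i := test_bounded (test_partial i teta).
have M00 : 0 <= M0 by apply: le_trans (hM0 0).
have M10 i : 0 <= M1 i by apply: le_trans (hM1 i 0).
(* [L1] and [L2] bound the first two derivatives of (t + e)^a on t >= 0; the exponents being
   negative, the maximum is at t = 0. *)
pose L1 := - a * e `^ (a - 1).
pose L2 := a * (a - 1) * e `^ (a - 2).
have a1 : a - 1 < 0 by rewrite subr_lt0 (lt_trans a0).
have a2 : a - 2 < 0 by rewrite subr_lt0 (lt_trans a0).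
have L10 : 0 <= L1 by rewrite mulr_ge0 ?powR_ge0// oppr_ge0 ltW.
have aa : 0 <= a * (a - 1) by rewrite mulr_le0// ltW.
have L20 : 0 <= L2 by rewrite mulr_ge0 ?powR_ge0.
have te (t : R) : 0 <= t -> 0 < t + e by move=> t0; rewrite ltr_wpDl.
have bk1 (t : R) : 0 <= t -> `|a * (t + e) `^ (a - 1)| <= L1.
  move=> t0; rewrite normrM (ltr0_norm a0) (ger0_norm (powR_ge0 _ _)).
  apply: ler_wpM2l; first by rewrite oppr_ge0 ltW.
  by apply: powR_antitone; rewrite ?(ltW a1)// lerDr.
have bk2 (t : R) : 0 <= t -> `|a * ((a - 1) * (t + e) `^ (a - 1 - 1))| <= L2.
  move=> t0; rewrite mulrA normrM (ger0_norm aa) (ger0_norm (powR_ge0 _ _)).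
  apply: ler_wpM2l => //; rewrite (_ : a - 1 - 1 = a - 2); last by ring.
  by apply: powR_antitone; rewrite ?(ltW a2)// lerDr.
have hL1 : L1 <= L1 + L2 by rewrite lerDl.
have hL2 : L2 <= L1 + L2 by rewrite lerDr.
have S0 : 0 <= \sum_(i < n) M1 i by exact: sumr_ge0.
apply: (W0app_chain oO bO hp (J := nonneg) (k := fun t => (t + e) `^ a)
  (k' := fun t => a * (t + e) `^ (a - 1)) (L := L1 + L2) (M := M0 + \sum_(i < n) M1 i)) => //=.
- exact: addr_ge0.
- exact: addr_ge0.
- exact: test_smooth teta.
- by move=> x; apply: le_trans (hM0 x) _; rewrite lerDl.
- move=> i x; apply: le_trans (hM1 i x) _; rewrite (bigD1 i)//=.
  by rewrite addrCA lerDl addr_ge0// sumr_ge0.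
- by left.
- by move=> psi tpsi psi0; exact: (smooth_shift_powR a e0 (test_smooth tpsi) psi0).
- move=> s t s0 t0; apply: le_trans (ler_wpM2r (normr_ge0 _) hL1).
  apply: (lip_derive_nng (g := fun t => (t + e) `^ a)
    (g' := fun t => a * (t + e) `^ (a - 1))) => // x x0.
  exact: is_derive_shift_powR (te _ x0).
- by move=> t t0; exact: le_trans (bk1 t t0) hL1.
- move=> s t s0 t0; apply: le_trans (ler_wpM2r (normr_ge0 _) hL2).
  apply: (lip_derive_nng (g := fun t => a * (t + e) `^ (a - 1))
    (g' := fun t => a * ((a - 1) * (t + e) `^ (a - 1 - 1)))) => // x x0.
  exact: (is_deriveZ (f := fun t => (t + e) `^ (a - 1)) a (is_derive_shift_powR (a - 1) (te _ x0))).
- exact: measurable_shift_powR.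
- by apply: measurable_funM => //; exact: measurable_shift_powR.
Qed.

End picone.

Section picone_estimates.
Context {R : realType} {n : nat}.
Variables (Omega : set 'rV[R]_n) (p : R).
Hypotheses (oO : open Omega) (bO : bounded_set Omega) (hp : 1 < p).
Local Notation mu := (@lebesgue_rV R n).
Local Notation test := (test_function Omega).
Local Notation Lp := (Lp mu Omega p).
Local Notation Np := (Np mu Omega p).
Local Notation intg := (intg mu Omega).
Local Notation W0app := (W0app Omega p).
Local Notation I f := (\int[mu]_(x in Omega) f x).
Local Notation nonneg := [set t : R | 0 <= t].
Let mO : measurable Omega := measurable_domain oO.
Let p0 : 0 < p. Proof. exact: lt_trans hp. Qed.
Let p10 : 0 < p - 1. Proof. by rewrite subr_gt0. Qed.
Variables (f : 'rV[R]_n -> R) (F : R) (lambda : R).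
Hypotheses (mf : measurable_fun Omega f) (f0 : forall x, Omega x -> 0 <= f x)
  (fF : forall x, Omega x -> f x <= F).
Variables (v : 'rV[R]_n -> R) (H : 'rV[R]_n -> 'rV[R]_n).
Hypotheses (hv : W0app nonneg v H) (sv : solves Omega p f lambda v H)
  (v0 : forall x, 0 <= v x).

Let ve e x : 0 < e -> 0 < v x + e. Proof. by move=> e0; rewrite ltr_wpDl. Qed.
Let lv : Lp v := W0app_Lp hv.
Let lH : LpV Omega p H := W0app_LpV hv.

(* [|grad ln (v + e)|] *)
Definition log_slope e x := enorm (H x) * (v x + e) `^ (-1).

Definition gradient (phi : 'rV[R]_n -> R) x : 'rV[R]_n := \row_i partial i phi x.

Lemma powR_inv_powR (s r : R) : 0 < s -> (s `^ (-1)) `^ r = s `^ (- r).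
Proof. by move=> s0; rewrite -powRrM mulN1r. Qed.

(** The pointwise core of Picone's inequality. The left side is the flux of [Hx] against the
    gradient of h^p s^(1-p); Cauchy-Schwarz on the term with [dh] leaves an expression in |dh| and X
    = h |Hx| / s only, ready for Young's inequality. *)
Lemma quotient_flux_le (h eta e : R) (Hx dh : 'rV[R]_n) (s : R) : 0 <= h -> 0 < s ->
  eta = h `^ p ->
  enorm Hx `^ (p - 2) * (s `^ (1 - p) * (p * h `^ (p - 1)) * dotp Hx dh
     + eta * ((1 - p) * s `^ (1 - p - 1)) * dotp Hx Hx) <=
  p * (h * (enorm Hx * s `^ (-1))) `^ (p - 1) * enorm dh -
  (p - 1) * (h * (enorm Hx * s `^ (-1))) `^ p.
Proof.
move=> h0 s0 ->.
have E0 := enorm_ge0 Hx; have i0 := powR_ge0 s (-1).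
have m0 : 0 <= enorm Hx * s `^ (-1) by exact: mulr_ge0.
rewrite (powRM (p - 1) h0 m0) (powRM p h0 m0) (powRM (p - 1) E0 i0) (powRM p E0 i0).
rewrite !powR_inv_powR//.
rewrite (_ : - (p - 1) = 1 - p); last by ring.
rewrite (_ : 1 - p - 1 = - p); last by ring.
have h1 : enorm Hx `^ (p - 2) * dotp Hx dh <= enorm Hx `^ (p - 1) * enorm dh.
  by apply: le_trans (flux_le _ _ hp); exact: ler_norm.
have h2 := flux_dotp Hx hp.
have c0 : 0 <= s `^ (1 - p) * (p * h `^ (p - 1)).
  by rewrite mulr_ge0 ?powR_ge0// mulr_ge0 ?powR_ge0// ltW.
have h3 := ler_wpM2l c0 h1.
move: h2 h3.
move: (enorm Hx `^ (p - 2)) (enorm Hx `^ (p - 1)) (enorm Hx `^ p) (dotp Hx dh) (dotp Hx Hx)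
  (s `^ (1 - p)) (s `^ (- p)) (h `^ (p - 1)) (h `^ p) (enorm dh) => A B C D E s1 s2 h1' h2' g <- h3.
rewrite -subr_ge0; rewrite -subr_ge0 in h3; apply: le_trans h3 _.
by rewrite le_eqVlt; apply/orP; left; apply/eqP; ring.
Qed.

(* The equation tested with [h^p / (v + e)^{p-1}]; [f >= 0] discards the source. *)
Lemma test_quotient (a c e : R) (w : 'rV[R]_n -> R) (Q : 'rV[R]_n -> R) :
  0 < c -> 0 < e -> smooth w -> test (fun x => flat a c (w x)) -> intg Q ->
  let h x := flat a c (w x) in
  (forall x, Omega x -> p * (h x * log_slope e x) `^ (p - 1) * enorm (gradient h x) -
      (p - 1) * (h x * log_slope e x) `^ p <= Q x) ->
  lambda * I (fun x => h x `^ p * (v x * (v x + e) `^ (-1)) `^ (p - 1)) <= I Q.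
Proof.
move=> c0 e0 sw th iQ h hQ.
have cp0 : 0 < c * p by exact: mulr_gt0.
(* This is h^p, written inside the family so that it is smooth where h vanishes too. *)
pose eta x := flat (a * p) (c * p) (w x).
have etaE x : eta x = h x `^ p by rewrite /eta /h flat_powR.
have [seta deta] := smooth_flat_comp (a * p) cp0 sw.
have [sh dh] := smooth_flat_comp a c0 sw.
have teta : test eta.
  apply/testP; split => //; have /testP[_ [K [cK KO hK]]] := th.
  exists K; split => // x /hK hx; rewrite etaE.
  by rewrite /h hx powR0// gt_eqF.
have dE i x : partial i eta x = p * h x `^ (p - 1) * partial i h x.
  by rewrite /eta deta /h dh dflat_powR// mulrA.
have a0 : 1 - p < 0 by rewrite subr_lt0.
have hz := W0app_quotient oO bO hp a0 e0 teta v0 hv.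
have := sv hz.
set phi := (fun x => eta x * (v x + e) `^ (1 - p)).
have lphi : Lp phi := W0app_Lp hz.
have phi0 x : 0 <= phi x by rewrite /phi etaE mulr_ge0 ?powR_ge0.
have -> : I (fun x => `|v x| `^ (p - 2) * v x * phi x) =
  I (fun x => h x `^ p * (v x * (v x + e) `^ (-1)) `^ (p - 1)).
  apply: eq_Rintegral => x _; rewrite /phi etaE (ger0_norm (v0 x)) (powR1_mul hp (v0 x)).
  rewrite (powRM (p - 1) (v0 x) (powR_ge0 _ _)) (powR_inv_powR _ (ve x e0)).
  rewrite (_ : - (p - 1) = 1 - p); last by ring.
  by rewrite mulrCA.
have fphi : 0 <= I (fun x => f x * phi x).
  by apply: Rintegral_ge0 => x Ox; rewrite mulr_ge0// f0.
move=> E; apply: (@le_trans _ _ (lambda * I (fun x => h x `^ p * (v x * (v x + e) `^ (-1)) `^ (p - 1)) + I (fun x => f x * phi x))).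
  by rewrite lerDl.
rewrite -E; apply: (I_le mO) => //.
  exact: (intg_flux oO bO hp lH (W0app_LpV hz)).
move=> x Ox; apply: le_trans (hQ x Ox).
have := quotient_flux_le e (H x) (gradient h x) (flat_ge0 a c (w x)) (ve x e0) (etaE x).
apply: le_trans; rewrite le_eqVlt; apply/orP; left; apply/eqP; congr (_ * _).
rewrite /dotp !mulr_sumr -big_split; apply: eq_bigr => i _.
rewrite !mxE dE -/(h x) /=.
by move: (H x ord0 i) (partial i h x) ((v x + e) `^ (1 - p)) (h x `^ (p - 1)) => b1 b2 b3 b4; ring.
Qed.

Lemma LpV_gradient phi : test phi -> LpV Omega p (gradient phi).
Proof.
by move=> tphi i; under eq_fun do rewrite mxE; apply: test_Lp => //; exact: test_partial.
Qed.

Lemma ratio_le1 e x : 0 < e -> 0 <= (v x * (v x + e) `^ (-1)) `^ (p - 1) <= 1.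
Proof.
move=> e0; rewrite powR_ge0/=; have vx := ve x e0.
have r0 : 0 <= v x * (v x + e) `^ (-1) by rewrite mulr_ge0// powR_ge0.
apply: (@le_trans _ _ (1 `^ (p - 1))); last by rewrite powR1.
rewrite ge0_ler_powR ?nnegrE ?(ltW p10)//.
by rewrite powR_inv1 ?(ltW vx)// ler_pdivrMr// mul1r lerDl ltW.
Qed.

Lemma measurable_ratio e : measurable_fun Omega (fun x => (v x * (v x + e) `^ (-1)) `^ (p - 1)).
Proof.
apply: (measurableT_comp (measurable_powR (p - 1))).
apply: measurable_funM; first exact: lv.1.
exact: (measurableT_comp (measurable_shift_powR e (-1)) lv.1).
Qed.

Lemma Lp_log_slope e : 0 < e -> Lp (log_slope e).
Proof.
move=> e0; have lE := Lp_enorm oO bO hp lH.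
apply: (Lp_le mO hp _ _ (LpZ mO (e `^ (-1)) lE)).
  apply: measurable_funM; first exact: lE.1.
  exact: (measurableT_comp (measurable_shift_powR e (-1)) lv.1).
move=> x _; rewrite /log_slope !normrM mulrC.
apply: ler_wpM2r => //; rewrite !(ger0_norm (powR_ge0 _ _)).
by apply: powR_antitone => //; rewrite lerDr.
Qed.

Lemma log_slope_ge0 e x : 0 <= log_slope e x.
Proof. by rewrite mulr_ge0 ?enorm_ge0 ?powR_ge0. Qed.

Lemma Lp_mul_test e phi : 0 < e -> test phi -> Lp (fun x => phi x * log_slope e x).
Proof.
move=> e0 tphi; have [M hM] := test_bounded tphi.
have lls := Lp_log_slope e0.
apply: (Lp_le mO hp _ _ (LpZ mO M lls)).
  by apply: measurable_funM; [exact: test_measurable|exact: lls.1].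
move=> x _; rewrite !normrM; apply: ler_wpM2r => //.
by apply: le_trans (hM x) _; exact: ler_norm.
Qed.

(** [young_powR_half] leaves a negative multiple of the wanted integral on the right. The remaining
    terms are bounded independently of [e], because v / (v + e) lies in [0, 1]. *)
Lemma log_estimate (a c : R) (w : 'rV[R]_n -> R) : 0 < c -> smooth w ->
  test (fun x => flat a c (w x)) ->
  exists C, forall e, 0 < e -> I (fun x => (flat a c (w x) * log_slope e x) `^ p) <= C.
Proof.
move=> c0 sw th; pose h x := flat a c (w x).
have [C C0 hC] := young_powR_half hp.
have lh : Lp h := test_Lp oO bO hp th.
have lg := LpV_gradient th.
pose A := C * I (fun x => enorm (gradient h x) `^ p) + `|lambda| * Np h.
exists (((p - 1) / 2)^-1 * A) => e e0.
have lhs := Lp_mul_test e0 th.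
have h0 x : 0 <= h x by exact: flat_ge0.
have hs0 x : 0 <= h x * log_slope e x by rewrite mulr_ge0 ?log_slope_ge0.
have i1 := intg_enorm_powR oO bO hp lg.
have i2 : intg (fun x => (h x * log_slope e x) `^ p).
  by apply: (eq_intg mO _ lhs.2) => x _; rewrite (ger0_norm (hs0 x)).
have iQ : intg (fun x => C * enorm (gradient h x) `^ p + (- ((p - 1) / 2)) * (h x * log_slope e x) `^ p).
  by apply: intgD => //; exact: intgZ.
have hQ x : Omega x -> p * (h x * log_slope e x) `^ (p - 1) * enorm (gradient h x) -
    (p - 1) * (h x * log_slope e x) `^ p <=
    C * enorm (gradient h x) `^ p + (- ((p - 1) / 2)) * (h x * log_slope e x) `^ p.
  move=> Ox; have := hC _ _ (hs0 x) (enorm_ge0 (gradient h x)).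
  move: ((h x * log_slope e x) `^ (p - 1)) ((h x * log_slope e x) `^ p) (enorm (gradient h x) `^ p) (enorm (gradient h x)) => y z t s.
  lra.
have := test_quotient c0 e0 sw th iQ hQ.
rewrite (I_lincomb mO _ _ i1 i2) => hle.
have p12 : 0 < (p - 1) / 2 by rewrite divr_gt0.
rewrite (ler_pdivlMl _ _ p12) /A.
have hN : - (`|lambda| * Np h) <= lambda * I (fun x => h x `^ p * (v x * (v x + e) `^ (-1)) `^ (p - 1)).
  have mr := measurable_ratio e.
  have i3 : intg (fun x => h x `^ p * (v x * (v x + e) `^ (-1)) `^ (p - 1)).
    apply: (intg_le mO (g := fun x => `|h x| `^ p)); last exact: lh.2.
      apply: measurable_funM => //; apply: (measurableT_comp (measurable_powR p)); exact: lh.1.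
    move=> x _; have /andP[r0 r1] := ratio_le1 x e0.
    by rewrite normrM (ger0_norm r0) !ger0_norm ?powR_ge0// ler_piMr// powR_ge0.
  have h4 : `|I (fun x => h x `^ p * (v x * (v x + e) `^ (-1)) `^ (p - 1))| <= Np h.
    apply: (I_abs_le mO (intg_measurable i3)); last exact: lh.2.
    move=> x _; have /andP[r0 r1] := ratio_le1 x e0.
    by rewrite normrM (ger0_norm r0) !ger0_norm ?powR_ge0// ler_piMr// powR_ge0.
  have := ler_wpM2l (normr_ge0 lambda) h4; rewrite -normrM ler_norml => /andP[+ _]; exact.
have key (x y z t L q C' : R) : L * x <= C' * y + - q * z -> - (`|L| * t) <= L * x ->
    q * z <= C' * y + `|L| * t by move: `|L| => l; lra.
exact: (key _ _ _ _ _ _ _ hle hN).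
Qed.

End picone_estimates.

Section picone_inequality.
Context {R : realType} {n : nat}.
Variables (Omega : set 'rV[R]_n) (p : R).
Hypotheses (oO : open Omega) (bO : bounded_set Omega) (hp : 1 < p).
Local Notation mu := (@lebesgue_rV R n).
Local Notation test := (test_function Omega).
Local Notation Lp := (Lp mu Omega p).
Local Notation Np := (Np mu Omega p).
Local Notation intg := (intg mu Omega).
Local Notation W0app := (W0app Omega p).
Local Notation I f := (\int[mu]_(x in Omega) f x).
Local Notation aeO P := {ae mu, forall x, Omega x -> P x}.
Local Notation nonneg := [set t : R | 0 <= t].
Local Notation energy := (energy Omega p).
Let mO : measurable Omega := measurable_domain oO.
Let p0 : 0 < p. Proof. exact: lt_trans hp. Qed.
Let p10 : 0 < p - 1. Proof. by rewrite subr_gt0. Qed.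

Lemma cvg_powR_pos (a s : R) (u : nat -> R) : 0 < s -> u m @[m --> \oo] --> s ->
  (u m) `^ a @[m --> \oo] --> s `^ a.
Proof.
move=> s0 us; have c : {for s, continuous (fun t : R => t `^ a)}.
  apply: differentiable_continuous; apply/derivable1_diffP.
  by have [] := is_derive1_powR a s0.
exact: (cvg_comp _ _ us c).
Qed.

Lemma cvg_le (u : nat -> R) (l b : R) : u m @[m --> \oo] --> l ->
  (forall m, u m <= b) -> l <= b.
Proof.
move=> ul ub; rewrite -(cvg_lim _ ul)//; apply: limr_le; last exact: nearW.
by apply/cvg_ex; exists l.
Qed.

Lemma gradientN phi : test phi -> forall x, gradient (fun x => - phi x) x = - gradient phi x.
Proof.
move=> tphi x; apply/rowP => i; rewrite !mxE.
have -> : (fun x => - phi x) = (fun x => (-1) * phi x) by apply/funext => y; rewrite mulN1r.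
rewrite partialM.
- by rewrite partial_cst mulr0 addr0 mulN1r.
- by move=> y; exact: differentiable_cst.
- by move=> y; exact: smooth_diff (test_smooth tphi).
Qed.

Section with_positive_solution.
Variables (f : 'rV[R]_n -> R) (F : R) (lambda : R).
Hypotheses (mf : measurable_fun Omega f) (f0 : forall x, Omega x -> 0 <= f x)
  (fF : forall x, Omega x -> f x <= F).
Variables (v : 'rV[R]_n -> R) (H : 'rV[R]_n -> 'rV[R]_n).
Hypotheses (hv : W0app nonneg v H) (sv : solves Omega p f lambda v H)
  (v0 : forall x, 0 <= v x) (vpos : aeO (fun x => 0 < v x)).

Let h0 m : 0 < harmonic m :> R. Proof. by rewrite /harmonic invr_gt0. Qed.
Let lv : Lp v := W0app_Lp hv.

(** The sharp Young inequality turns the bound of [test_quotient] into |grad h|^p. As the shift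
    tends to 0, v / (v + e) tends to 1 a.e., because v > 0 a.e. *)
Lemma picone_flat phi c : test phi -> 0 < c ->
  lambda * Np (fun x => flat 1 c (phi x)) <=
  I (fun x => enorm (gradient (fun x => flat 1 c (phi x)) x) `^ p).
Proof.
move=> tphi c0; pose h x := flat 1 c (phi x).
have [sh dh] := smooth_flat_comp 1 c0 (test_smooth tphi).
have th : test h by apply: test_comp => //; exact: flat_le0.
have hge x : 0 <= h x by exact: flat_ge0.
have lh := test_Lp oO bO hp th; have lg := LpV_gradient oO bO hp th.
pose r m x := (v x * (v x + harmonic m) `^ (-1)) `^ (p - 1).
have mhp : measurable_fun Omega (fun x => h x `^ p).
  exact: (measurableT_comp (measurable_powR p) lh.1).
have mr m : measurable_fun Omega (fun x => h x `^ p * r m x).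
  by apply: measurable_funM => //; exact: measurable_ratio hv _.
have mlim : measurable_fun Omega (fun x => if 0 < v x then h x `^ p else 0).
  by apply: measurable_if => //; apply: measurable_fun_ltr => //; exact: lv.1.
have cvg_r : I (fun x => h x `^ p * r m x) @[m --> \oo] --> I (fun x => if 0 < v x then h x `^ p else 0).
  apply: (I_dominated mO (h := fun x => `|h x| `^ p)) => //; first exact: lh.2.
    move=> m x _; have /andP[r0 r1] := ratio_le1 hp v0 x (h0 m).
    rewrite normrM (ger0_norm r0) (ger0_norm (powR_ge0 _ _)) (ger0_norm (hge x)).
    by apply: ler_piMr => //; exact: powR_ge0.
  move=> x _; case: ifPn => vx; last first.
    rewrite (_ : (fun m => _) = fun=> 0); first exact: cvg_cst.
    apply/funext => m; rewrite /r (_ : v x = 0) ?mul0r ?powR0 ?mulr0 ?gt_eqF//.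
    by apply/eqP; rewrite eq_le v0 andbT leNgt.
  rewrite -[X in _ --> X](mulr1 (h x `^ p)); apply: cvgMr.
  have -> : (1 : R) = (v x * (v x) `^ (-1)) `^ (p - 1).
    by rewrite powR_inv1 ?(ltW vx)// mulfV ?gt_eqF// powR1.
  apply: cvg_powR_pos; first by rewrite mulr_gt0// powR_gt0.
  apply: cvgMr; apply: cvg_powR_pos => //.
  by rewrite -[X in _ --> X](addr0 (v x)); apply: cvgD; [exact: cvg_cst|exact: cvg_harmonic].
have E : I (fun x => if 0 < v x then h x `^ p else 0) = Np h.
  apply: (I_ae_eq mO mlim); first exact: measurable_norm_powR lh.1.
  by apply: filterS vpos => x vx Ox; rewrite vx// (ger0_norm (hge x)).
rewrite -/h -E.
have cl : lambda * I (fun x => h x `^ p * r m x) @[m --> \oo] -->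
    lambda * I (fun x => if 0 < v x then h x `^ p else 0) by exact: cvgMr.
apply: (cvg_le cl) => m.
apply: (test_quotient oO bO hp f0 hv sv v0 c0 (h0 m) (test_smooth tphi) th).
  exact: intg_enorm_powR.
move=> x Ox; have := young_powR hp (mulr_ge0 (hge x) (log_slope_ge0 v H (harmonic m) x)) (enorm_ge0 (gradient h x)).
rewrite -/(h x).
move: ((h x * _) `^ (p - 1)) ((h x * _) `^ p) (enorm (gradient h x) `^ p) (enorm (gradient h x)) => y z t s.
lra.
Qed.

(** Let c tend to 0. The gradient of the truncation is that of phi times a factor in [0, 1] which
    vanishes where phi <= 0, so the right side is bounded before the limit is taken. *)
Lemma picone_pos phi : test phi ->
  lambda * Np (fun x => Num.max (phi x) 0) <=
  I (fun x => if 0 < phi x then enorm (gradient phi x) `^ p else 0).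
Proof.
move=> tphi; have lphi := test_Lp oO bO hp tphi; have lg := LpV_gradient oO bO hp tphi.
have cl : lambda * Np (fun x => flat 1 (harmonic m) (phi x)) @[m --> \oo] -->
    lambda * Np (fun x => Num.max (phi x) 0).
  apply: cvgMr; apply: (I_dominated mO (h := fun x => `|phi x| `^ p)).
  - move=> m; apply: measurable_norm_powR.
    exact: (measurableT_comp (measurable_flat 1 (h0 m)) lphi.1).
  - by apply: measurable_norm_powR; apply: measurable_maxr => //; exact: lphi.1.
  - exact: lphi.2.
  - move=> m x _; rewrite (ger0_norm (powR_ge0 _ _)).
    apply: ge0_ler_powR; rewrite ?nnegrE ?(ltW p0)//.
    by have := flat_lip1 (h0 m) (phi x) 0; rewrite (@flat_le0 _ _ _ 0)// !subr0.
  - move=> x _; have [h|h] := leP (phi x) 0.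
      rewrite (_ : (fun m => _) = fun=> `|0 : R| `^ p); first exact: cvg_cst.
      by apply/funext => m; rewrite flat_le0.
    rewrite (gtr0_norm h).
    have -> : (fun m => `|flat 1 (harmonic m) (phi x)| `^ p) = (fun m => flat 1 (harmonic m) (phi x) `^ p).
      by apply/funext => m; rewrite (ger0_norm (flat_ge0 _ _ _)).
    apply: cvg_powR_pos => //; have := @cvg_flat1 R (phi x).
    by rewrite max_l// ltW.
apply: (cvg_le cl) => m; apply: (le_trans (picone_flat tphi (h0 m))).
have [sh dh] := smooth_flat_comp 1 (h0 m) (test_smooth tphi).
have th : test (fun x => flat 1 (harmonic m) (phi x)) by apply: test_comp => //; exact: flat_le0.
apply: (I_le mO).
- exact: intg_enorm_powR (LpV_gradient oO bO hp th).
- apply: (intg_le mO _ _ (intg_enorm_powR oO bO hp lg)).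
    apply: measurable_if => //; first by apply: measurable_fun_ltr => //; exact: lphi.1.
    by apply: intg_measurable; exact: intg_enorm_powR.
  by move=> x _; case: ifP => _; rewrite ?normr0 ?powR_ge0// ger0_norm// powR_ge0.
- move=> x _.
  have -> : gradient (fun x => flat 1 (harmonic m) (phi x)) x = dflat 1 (harmonic m) (phi x) *: gradient phi x.
    by apply/rowP => i; rewrite !mxE dh.
  rewrite enormZ; case: ifPn => hx; last first.
    have hx' : phi x <= 0 by rewrite leNgt.
    by rewrite /dflat !(flat_le0 _ _ hx') !mulr0 addr0 normr0 mul0r powR0// (gt_eqF p0).
  apply: ge0_ler_powR; rewrite ?nnegrE ?(ltW p0)// ?mulr_ge0 ?enorm_ge0//.
  rewrite ger0_norm ?dflat1_ge0//; apply: ler_piMl; first exact: enorm_ge0.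
  exact: dflat1_le1.
Qed.

(** Add the inequalities for phi and - phi: the masses of the two parts add up to that of phi, and
    their energies to at most that of phi. *)
Lemma picone_test phi : test phi -> lambda * Np phi <= energy (gradient phi).
Proof.
move=> tphi; have tN : test (fun x => - phi x).
  by have := testZ (-1) tphi; under eq_fun do rewrite mulN1r.
have lphi := test_Lp oO bO hp tphi; have lg := LpV_gradient oO bO hp tphi.
have h1 := picone_pos tphi; have h2 := picone_pos tN.
have lmax w : Lp w -> intg (fun x => `|Num.max (w x) 0| `^ p).
  move=> lw; apply: (intg_le mO _ _ lw.2).
    by apply: measurable_norm_powR; apply: measurable_maxr => //; exact: lw.1.
  move=> x _; rewrite (ger0_norm (powR_ge0 _ _)); apply: ge0_ler_powR; rewrite ?nnegrE ?(ltW p0)//.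
  by have [h|h] := leP (w x) 0; rewrite ?normr0.
have iE w : Lp w -> intg (fun x => if 0 < w x then enorm (gradient phi x) `^ p else 0).
  move=> lw; apply: (intg_le mO _ _ (intg_enorm_powR oO bO hp lg)).
    apply: measurable_if => //; first by apply: measurable_fun_ltr => //; exact: lw.1.
    by apply: intg_measurable; exact: intg_enorm_powR.
  by move=> x _; case: ifP => _; rewrite ?normr0 ?powR_ge0// ger0_norm// powR_ge0.
have lN := test_Lp oO bO hp tN.
have E1 : Np phi = 1 * Np (fun x => Num.max (phi x) 0) + 1 * Np (fun x => Num.max (- phi x) 0).
  rewrite -(I_lincomb mO _ _ (lmax _ lphi) (lmax _ lN)); apply: eq_Rintegral => x _; rewrite !mul1r.
  have z : `|0 : R| `^ p = 0 by rewrite normr0 powR0// gt_eqF.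
  have [h|h] := leP (phi x) 0; have [h'|h'] := leP (- phi x) 0; rewrite ?z ?normrN.
  - have -> : phi x = 0 by apply/eqP; rewrite eq_le h -oppr_le0 h'.
    by rewrite z (addr0 (0 : R)).
  - by rewrite (add0r (_ `^ _)).
  - by rewrite (addr0 (_ `^ _)).
  - by move: h'; rewrite oppr_gt0 ltNge (ltW h).
have {}h2 : lambda * Np (fun x => Num.max (- phi x) 0) <=
    I (fun x => if 0 < - phi x then enorm (gradient phi x) `^ p else 0).
  apply: (le_trans h2); rewrite le_eqVlt; apply/orP; left; apply/eqP.
  by apply: eq_Rintegral => x _; rewrite (gradientN tphi x) enormN.
have dist (x y z : R) : x * (1 * y + 1 * z) = x * y + x * z by ring.
rewrite E1 dist; apply: (le_trans (lerD h1 h2)).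
have := I_lincomb mO 1 1 (iE _ lphi) (iE _ lN).
rewrite (mul1r (Rintegral _ _ _)) (mul1r (Rintegral _ _ _)) => <-.
apply: (I_le mO).
- exact: (intgD mO (intgZ mO 1 (iE _ lphi)) (intgZ mO 1 (iE _ lN))).
- exact: intg_enorm_powR.
- move=> x _; rewrite !mul1r oppr_gt0; have [h|h|h] := ltgtP (phi x) 0.
  + by rewrite (add0r (_ `^ _)).
  + by rewrite (addr0 (_ `^ _)).
  + by rewrite (addr0 (0 : R)); exact: powR_ge0.
Qed.

End with_positive_solution.

(* Replaces continuity of the [p]-th power of the norm. *)
Lemma powR_add_split (eta a b : R) : 0 < eta -> 0 <= a -> 0 <= b ->
  (a + b) `^ p <= (1 + eta) `^ p * a `^ p + (1 + eta^-1) `^ p * b `^ p.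
Proof.
move=> e0 a0 b0; have e1 : 0 <= 1 + eta by rewrite addr_ge0// ltW.
have e2 : 0 <= 1 + eta^-1 by rewrite addr_ge0// invr_ge0 ltW.
rewrite -(powRM p e1 a0) -(powRM p e2 b0).
have [h|h] := leP b (eta * a).
  apply: (@le_trans _ _ (((1 + eta) * a) `^ p)); last by rewrite lerDl powR_ge0.
  apply: ge0_ler_powR; rewrite ?nnegrE ?addr_ge0 ?mulr_ge0 ?(ltW p0)//.
  by rewrite mulrDl mul1r lerD2l.
apply: (@le_trans _ _ (((1 + eta^-1) * b) `^ p)); last by rewrite lerDr powR_ge0.
apply: ge0_ler_powR; rewrite ?nnegrE ?addr_ge0 ?mulr_ge0 ?(ltW p0)//.
by rewrite mulrDl mul1r addrC lerD2l mulrC ler_pdivlMr// mulrC ltW.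
Qed.

Lemma Np_split eta u w : 0 < eta -> Lp u -> Lp w ->
  Np u <= (1 + eta) `^ p * Np w + (1 + eta^-1) `^ p * Np (fun x => w x - u x).
Proof.
move=> e0 lu lw; have lwu := LpB mO hp lw lu.
rewrite -(I_lincomb mO _ _ lw.2 lwu.2); apply: (I_le mO); first exact: lu.2.
  by apply: intgD => //; apply: intgZ => //; [exact: lw.2|exact: lwu.2].
move=> x _; apply: (le_trans _ (powR_add_split e0 (normr_ge0 _) (normr_ge0 _))).
apply: ge0_ler_powR; rewrite ?nnegrE ?addr_ge0 ?(ltW p0)//.
by rewrite -[X in `|X| <= _](subKr (w x)); exact: ler_normB.
Qed.

(** Each term is at most the p-th root of the sum of the p-th powers. *)
Lemma sum_powR_le (a : 'I_n -> R) : (forall i, 0 <= a i) ->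
  (\sum_i a i) `^ p <= n%:R `^ p * \sum_i a i `^ p.
Proof.
move=> a0; pose S := \sum_i a i `^ p.
have S0 : 0 <= S by apply: sumr_ge0 => i _; exact: powR_ge0.
have -> : n%:R `^ p * S = (n%:R * S `^ p^-1) `^ p.
  by rewrite powRM ?powR_ge0// -powRrM mulVf ?gt_eqF// powRr1.
apply: ge0_ler_powR; rewrite ?nnegrE ?(ltW p0) ?sumr_ge0 ?mulr_ge0 ?powR_ge0//.
apply: (@le_trans _ _ (\sum_(i < n) S `^ p^-1)).
  apply: ler_sum => i _.
  have -> : a i = (a i `^ p) `^ p^-1 by rewrite -powRrM mulfV ?gt_eqF// powRr1.
  apply: ge0_ler_powR; rewrite ?nnegrE ?invr_ge0 ?(ltW p0) ?powR_ge0//.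
  by rewrite /S (bigD1 i)//= lerDl; apply: sumr_ge0 => j _; exact: powR_ge0.
by rewrite sumr_const card_ord mulr_natl.
Qed.

Lemma energy_split eta G K : 0 < eta -> LpV Omega p G -> LpV Omega p K ->
  energy G <= (1 + eta) `^ p * energy K +
    (1 + eta^-1) `^ p * (n%:R `^ p * \sum_i Np (fun x => G x ord0 i - K x ord0 i)).
Proof.
move=> e0 lG lK.
have lGK i : Lp (fun x => G x ord0 i - K x ord0 i) by exact: LpB.
have iS : intg (fun x => n%:R `^ p * \sum_i `|G x ord0 i - K x ord0 i| `^ p).
  by apply: intgZ => //; apply: (intg_sum mO) => i; exact: (lGK i).2.
have -> : n%:R `^ p * \sum_i Np (fun x => G x ord0 i - K x ord0 i) =
    I (fun x => n%:R `^ p * \sum_i `|G x ord0 i - K x ord0 i| `^ p).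
  rewrite RintegralZl//; last by apply: (intg_sum mO) => i; exact: (lGK i).2.
  by rewrite (I_sum mO)// => i; exact: (lGK i).2.
have iK := intg_enorm_powR oO bO hp lK.
rewrite -(I_lincomb mO _ _ iK iS); apply: (I_le mO); first exact: intg_enorm_powR.
  by apply: intgD => //; exact: intgZ.
move=> x _; have GK : enorm (G x) <= enorm (K x) + \sum_i `|G x ord0 i - K x ord0 i|.
  apply: (@le_trans _ _ (enorm (K x) + enorm (G x - K x))).
    (* The Euclidean triangle inequality, by squaring and Cauchy-Schwarz. *)
    rewrite -(@ler_pXn2r _ 2) ?nnegrE ?addr_ge0 ?enorm_ge0// sqrrD !sqr_enorm.
    have -> : dotp (G x) (G x) = dotp (K x) (K x) + dotp (K x) (G x - K x) *+ 2 + dotp (G x - K x) (G x - K x).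
      have dsq (k d : 'rV[R]_n) : dotp (k + d) (k + d) = dotp k k + dotp k d *+ 2 + dotp d d.
        by rewrite dotpDr (dotpC (k + d) k) (dotpC (k + d) d) !dotpDr (dotpC d k); ring.
      by rewrite -dsq addrC subrK.
    rewrite lerD2r lerD2l lerMn2r /=; apply: le_trans (dotp_le _ _); exact: ler_norm.
  rewrite lerD2l; apply: le_trans (enorm_le_sum _) _.
  by apply: ler_sum => i _; rewrite !mxE.
have S0 : 0 <= \sum_i `|G x ord0 i - K x ord0 i| by exact: sumr_ge0.
apply: (@le_trans _ _ ((enorm (K x) + \sum_i `|G x ord0 i - K x ord0 i|) `^ p)).
  by apply: ge0_ler_powR; rewrite ?nnegrE ?(ltW p0) ?addr_ge0 ?enorm_ge0.
apply: (le_trans (powR_add_split e0 (enorm_ge0 _) S0)).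
rewrite lerD2l; apply: ler_wpM2l; first exact: powR_ge0.
exact: sum_powR_le.
Qed.

(** Approximation errors enter with the weight (1 + 1 / eta)^p, so they are sent to 0 at fixed
    [eta], and only afterwards does [eta] tend to 0. *)
Lemma density_mass_energy (lambda : R) w G : 0 <= lambda ->
  (forall phi, test phi -> lambda * Np phi <= energy (gradient phi)) ->
  W0app setT w G -> lambda * Np w <= energy G.
Proof.
move=> l0 hphi [lw lG hap].
suff key eta : 0 < eta -> lambda * Np w <= (1 + eta) `^ p * ((1 + eta) `^ p * energy G).
  have c : (1 + harmonic m) `^ p * ((1 + harmonic m) `^ p * energy G) @[m --> \oo] -->
      1 `^ p * (1 `^ p * energy G).
    have c1 : (1 + harmonic m) `^ p @[m --> \oo] --> (1 : R) `^ p.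
      apply: cvg_powR_pos => //; rewrite -[X in _ --> X](addr0 (1 : R)).
      by apply: cvgD; [exact: cvg_cst|exact: cvg_harmonic].
    by apply: cvgM => //; apply: cvgMl.
  have : lambda * Np w <= 1 `^ p * (1 `^ p * energy G).
    rewrite -(cvg_lim _ c)//; apply: limr_ge; first by apply/cvg_ex; eexists; exact: c.
    by apply: nearW => m; apply: key; rewrite /harmonic invr_gt0.
  by rewrite powR1 !mul1r.
move=> e0; apply/ler_addgt0Pr => e egt0.
set A := (1 + eta) `^ p; set B := (1 + eta^-1) `^ p.
have A0 : 0 <= A by exact: powR_ge0.
have B0 : 0 <= B by exact: powR_ge0.
(* The total coefficient with which the approximation error enters, plus 1 to keep it positive. *)
pose K := A * (B * (n%:R `^ p * n%:R)) + lambda * B + 1.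
have K0 : 0 < K.
  by rewrite ltr_wpDl// addr_ge0// ?mulr_ge0// powR_ge0.
have eK : 0 < e / K by rewrite divr_gt0.
have [phi [tphi _ h1 h2]] := hap _ eK.
have lphi := test_Lp oO bO hp tphi; have lg := LpV_gradient oO bO hp tphi.
have s1 := Np_split e0 lw lphi; rewrite -/A -/B in s1.
have s2 := energy_split e0 lg lG; rewrite -/A -/B in s2.
have s3 := hphi _ tphi.
have s4 : \sum_i Np (fun x => gradient phi x ord0 i - G x ord0 i) <= n%:R * (e / K).
  apply: (@le_trans _ _ (\sum_(i < n) (e / K))); last by rewrite sumr_const card_ord mulr_natl.
  apply: ler_sum => i _; have := h2 i.
  rewrite (_ : (fun x => gradient phi x ord0 i - _) = (fun x => partial i phi x - G x ord0 i))//.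
  by apply/funext => y; rewrite mxE.
have N0 : 0 <= n%:R `^ p :> R by exact: powR_ge0.
have s5 := ler_wpM2l N0 s4; have s6 := ler_wpM2l B0 s5.
have s7 := ler_wpM2l A0 (le_trans s2 (lerD (lexx _) s6)).
have s8 := ler_wpM2l l0 (le_trans s1 (lerD (lexx _) (ler_wpM2l B0 h1))).
have s9 := ler_wpM2l A0 s3.
have eKK : K * (e / K) = e by rewrite mulrC divfK// gt_eqF.
have fin (l x1 x2 E' EG a b nn m d : R) : 0 < d -> l * x1 <= l * (a * x2 + b * d) ->
    a * (l * x2) <= a * E' -> a * E' <= a * (a * EG + b * (nn * (m * d))) ->
    l * x1 <= a * (a * EG) + (a * (b * (nn * m)) + l * b + 1) * d.
  move=> d0 h8 h9 h7; apply: (le_trans h8); rewrite (_ : l * (a * x2 + b * d) = a * (l * x2) + l * b * d); last by ring.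
  apply: (le_trans (lerD (le_trans h9 h7) (lexx _))); rewrite -subr_ge0.
  rewrite (_ : _ - _ = d); last by ring.
  exact: ltW.
rewrite -eKK; exact: fin eK s8 s9 s7.
Qed.

End picone_inequality.

Lemma ler_dist_split (R : realDomainType) (a b c d : R) :
  `|a - b| <= `|c - d| + (`|c - a| + `|d - b|).
Proof.
rewrite (_ : a - b = (c - d) + (- (c - a) + (d - b))); last by ring.
apply: le_trans (ler_normD _ _) _; rewrite lerD2l -(normrN (c - a)).
exact: ler_normD.
Qed.

(** * Almost everywhere positivity *)

Section almost_everywhere.
Context {R : realType} {n : nat}.
Local Notation mu := (@lebesgue_rV R n).

Definition ae_on (A : set 'rV[R]_n) (P : 'rV[R]_n -> Prop) : Prop :=
  {ae mu, forall x, A x -> P x}.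

Lemma ae_onS (A B : set 'rV[R]_n) P : A `<=` B -> ae_on B P -> ae_on A P.
Proof.
move=> AB; apply: negligibleS => x /= /not_implyP[Ax nP] h.
by apply: nP; apply: h; exact: AB.
Qed.

Lemma ae_onI (A : set 'rV[R]_n) P Q : ae_on A P -> ae_on A Q ->
  ae_on A (fun x => P x /\ Q x).
Proof.
move=> h1 h2; apply: negligibleS (negligibleU h1 h2) => x /=.
move=> /not_implyP[Ax /not_andP[nP|nQ]]; [left|right] => h.
  by apply: nP; exact: h.
by apply: nQ; exact: h.
Qed.

Lemma box_sub_ball (x : 'rV[R]_n) e : 0 < e ->
  box (x - const_mx (e / 2)) e `<=` ball x e.
Proof.
move=> e0 y hy; split => // a i; rewrite ord1; have := hy i.
rewrite in_itv/= !mxE /ball/= => /andP[h1 h2]; rewrite ltr_distl; lra.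
Qed.

(** A ball contains a box of positive measure, so it is not null. *)
Lemma ae_on_exists (x : 'rV[R]_n) e P : 0 < e -> ae_on (ball x e) P -> exists2 y, ball x e y & P y.
Proof.
move=> e0 [N [mN N0 hN]]; apply: contrapT => h.
have : (mu (box (x - const_mx (e / 2)%R) e) <= mu N)%E.
  apply: le_measure; rewrite ?inE//; first exact: measurable_box.
  move=> y /(box_sub_ball e0) xy; apply: hN => /= hP; apply: h.
  by exists y => //; exact: hP.
rewrite N0 mu_box ?(ltW e0)// lee_fin leNgt exprn_gt0//.
Qed.

(* Second countability: rational balls. *)
Lemma ae_local (A : set 'rV[R]_n) (P : 'rV[R]_n -> Prop) :
  (forall x, A x -> exists2 e, 0 < e & ae_on (ball x e) P) -> ae_on A P.
Proof.
move=> h.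
pose q2r (q : 'rV[rat]_n) : 'rV[R]_n := map_mx ratr q.
pose good (z : 'rV[rat]_n * nat) := ae_on (ball (q2r z.1) z.2.+1%:R^-1) P.
pose B (k : nat) : set 'rV[R]_n := if unpickle k is Some z then
  (if pselect (good z) then ball (q2r z.1) z.2.+1%:R^-1 `&` ~` [set x | P x] else set0) else set0.
have nB k : mu.-negligible (B k).
  rewrite /B; case: (unpickle k) => [z|]; last exact: negligible_set0.
  case: (pselect (good z)) => [g|_] /=; last exact: negligible_set0.
  by apply: negligibleS g => x /= [bx nP] /(_ bx).
apply: negligibleS (negligible_bigcup nB) => x /= /not_implyP[Ax nP].
have [e e0 he] := h x Ax.
have [k ke] : exists k : nat, k.+1%:R^-1 < e / 2 :> R.
  have e2 : 0 < e / 2 by rewrite divr_gt0.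
  exists (Num.truncn (e / 2)^-1); rewrite invf_plt ?posrE//.
  exact: truncnS_gt.
have k0 : 0 < k.+1%:R^-1 :> R by rewrite invr_gt0.
have /choice[q hq] : forall i : 'I_n, exists q : rat,
    ball (ratr q : R) k.+1%:R^-1 (x ord0 i).
  move=> i.
  have /rat_in_itvoo[q] : x ord0 i - k.+1%:R^-1 < x ord0 i + k.+1%:R^-1.
    by rewrite ltrBlDr -addrA ltrDl addr_gt0.
  rewrite in_itv/= => /andP[q1 q2]; exists q.
  by rewrite /ball/= ltr_distlC; rewrite ltrBlDr q2 -ltrBlDr q1.
have xq : ball (q2r (\row_i q i)) k.+1%:R^-1 x.
  by split => // i j; rewrite ord1 !mxE; exact: hq.
exists (pickle (\row_i q i, k)) => //; rewrite /B pickleK.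
case: (pselect (good _)) => [//|ng]; exfalso; apply: ng; apply: ae_onS he => y qy.
rewrite [e]splitr; apply: (@ball_triangle _ _ (q2r (\row_i q i))).
  by apply: ball_sym; apply: le_ball xq; exact: ltW.
by apply: le_ball qy; exact: ltW.
Qed.

(** The points near which v is a.e. zero, and those near which it is a.e. positive, form open sets
    that cover [Omega]; they are disjoint because no ball is null. *)
Lemma connected_dichotomy (Omega : set 'rV[R]_n) (v : 'rV[R]_n -> R) :
  connected Omega ->
  (forall x, Omega x -> exists2 e, 0 < e &
     ae_on (ball x e) (fun y => v y = 0) \/ ae_on (ball x e) (fun y => 0 < v y)) ->
  ae_on Omega (fun x => v x = 0) \/ ae_on Omega (fun x => 0 < v x).
Proof.
move=> cO h.
pose U (P : 'rV[R]_n -> Prop) := [set x | exists2 e, 0 < e & ae_on (ball x e) P].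
have oU P : open (U P).
  rewrite openE => x [e e0 he]; rewrite /interior.
  apply/nbhs_ballP; exists (e / 2) => /=; first by rewrite divr_gt0.
  move=> y xy; exists (e / 2); first by rewrite divr_gt0.
  apply: ae_onS he => z yz; rewrite [e]splitr; exact: ball_triangle yz.
pose U0 := U (fun y => v y = 0); pose U1 := U (fun y => 0 < v y).
have disj x : U0 x -> U1 x -> False.
  move=> [e e0 he] [d d0 hd]; pose m := Num.min e d.
  have m0 : 0 < m by rewrite lt_min e0.
  have hb : ae_on (ball x m) (fun y => v y = 0 /\ 0 < v y).
    have h1 : ae_on (ball x m) (fun y => v y = 0).
      by apply: ae_onS he; apply: le_ball; rewrite ge_min lexx.
    have h2 : ae_on (ball x m) (fun y => 0 < v y).
      by apply: ae_onS hd; apply: le_ball; rewrite ge_min lexx orbT.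
    exact: ae_onI h1 h2.
  by have [y _ [->]] := ae_on_exists m0 hb; rewrite ltxx.
have cover x : Omega x -> U0 x \/ U1 x.
  by move=> /h[e e0 [?|?]]; [left|right]; exists e.
have [[x1 [Ox1 U1x1]]|no1] := pselect (exists x, Omega x /\ U1 x); last first.
  left; apply: ae_local => x Ox; have [//|U1x] := cover x Ox.
  by exfalso; apply: no1; exists x.
right; apply: ae_local => x Ox.
suff E : Omega `&` U1 = Omega by have : (Omega `&` U1) x by [rewrite E]; case.
apply: cO.
- by exists x1.
- by exists U1 => //; exact: oU.
- exists (~` U0); first by apply: open_closedC; exact: oU.
  apply/seteqP; split => y [Oy Uy]; split => //.
    by move=> U0y; exact: disj U0y Uy.
  by have [/Uy|] := cover y Oy.
Qed.

End almost_everywhere.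

Section poincare_sobolev.
Context {R : realType} {n : nat}.
Variables (Omega : set 'rV[R]_n) (p : R).
Hypotheses (oO : open Omega) (bO : bounded_set Omega) (hp : 1 < p).
Local Notation mu := (@lebesgue_rV R n).
Local Notation intg := (intg mu Omega).
Local Notation W0app := (W0app Omega p).
Local Notation I f := (\int[mu]_(x in Omega) f x).
Let mO : measurable Omega := measurable_domain oO.
Let fO := finite_domain oO bO.
Local Open Scope ereal_scope.

Lemma EFin_I (h : 'rV[R]_n -> R) : intg h -> \int[mu]_(x in Omega) (h x)%:E = (I h)%:E.
Proof. by move=> ih; rewrite /Rintegral fineK//; exact: integrable_fin_num. Qed.

Lemma integral_box_le_I (a : 'rV[R]_n) l (h : 'rV[R]_n -> R) : box a l `<=` Omega ->
  intg h -> (forall x, (0 <= h x)%R) ->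
  \int[mu]_(x in box a l) (h x)%:E <= (I h)%:E.
Proof.
move=> bo ih h0; rewrite -EFin_I//; apply: ge0_subset_integral => //.
- exact: measurable_box.
- by apply/measurable_EFinP; exact: (intg_measurable ih).
- by move=> x _; rewrite lee_fin.
Qed.

(** [poincare_box] applies to test functions close to (g, G), and [L1_small] converts closeness in
    [Np] into closeness in L^1. The bound is only asked for the integrals of the gradient over the
    box, which is what the logarithmic estimate gives. *)
Lemma poincare_W0app J (g : 'rV[R]_n -> R) (G : 'rV[R]_n -> 'rV[R]_n) (a : 'rV[R]_n) (l C : R) :
  (0 < l)%R -> box a l `<=` Omega -> W0app J g G ->
  (forall i, \int[mu]_(x in box a l) (`|G x ord0 i|%R)%:E <= C%:E) ->
  \int[mu]_(x in box a l) \int[mu]_(y in box a l) (`|g x - g y|%R)%:E <=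
  (l ^+ n.+1 * (n%:R * C))%:E.
Proof.
move=> l0 bo [lg lG hap] GC.
have mb := measurable_box a l.
have ll := ltW l0.
apply/lee_addgt0Pr => e e0.
(* The errors come from the derivatives, through the Poincaré constant, and twice from the values,
   once for each variable. *)
pose K := (l ^+ n.+1 * n%:R + 2 * l ^+ n + 1)%R.
have K0 : (0 < K)%R by rewrite ltr_wpDl// addr_ge0// mulr_ge0// exprn_ge0.
have eK : (0 < e / K)%R by rewrite divr_gt0.
have [del del0 hdel] := L1_small mO hp fO eK.
have [phi [tphi _ h1 h2]] := hap _ del0.
have lphi := test_Lp oO bO hp tphi.
have ldiff := LpB mO hp lphi lg.
have ldiffi i := LpB mO hp (test_Lp oO bO hp (test_partial i tphi)) (lG i).
pose d x := (`|phi x - g x|%R)%:E.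
have d0 x : 0 <= d x by rewrite lee_fin.
have E1 : \int[mu]_(x in box a l) d x <= (e / K)%:E.
  apply: le_trans (integral_box_le_I bo (Lp_intg mO hp fO ldiff) (fun x => normr_ge0 _)) _.
  by rewrite lee_fin; exact: hdel.
have E2 i : \int[mu]_(x in box a l) (`|partial i phi x - G x ord0 i|%R)%:E <= (e / K)%:E.
  apply: le_trans (integral_box_le_I bo (Lp_intg mO hp fO (ldiffi i)) (fun x => normr_ge0 _)) _.
  by rewrite lee_fin; exact: hdel.
have mg : measurable_fun (box a l) g by apply: measurable_funS lg.1.
have mphi : measurable_fun setT phi by apply: measurable_continuous_rV; exact: smooth_continuous (test_smooth tphi).
have md : measurable_fun (box a l) d.
  apply/measurable_EFinP; apply: measurableT_comp => //; apply: measurable_funB => //.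
  exact: measurable_funTS.
pose G2 (z : 'rV[R]_n * 'rV[R]_n) := (`|phi z.1 - phi z.2|%R)%:E.
have mG2 : measurable_fun setT G2.
  apply/measurable_EFinP; apply: measurableT_comp => //; apply: measurable_funB.
    exact: (measurableT_comp mphi measurable_fst).
  exact: (measurableT_comp mphi measurable_snd).
have G20 z : 0 <= G2 z by rewrite lee_fin.
have step x : \int[mu]_(y in box a l) (`|g x - g y|%R)%:E <=
   \int[mu]_(y in box a l) G2 (x, y) + ((l ^+ n)%:E * d x + (e / K)%:E).
  apply: (@le_trans _ _ (\int[mu]_(y in box a l) (G2 (x, y) + (d x + d y)))).
    apply: le_ge0_integral => y _; first by rewrite lee_fin.
    rewrite /G2 /d -!EFinD lee_fin /=.
    exact: ler_dist_split.
  have mGx : measurable_fun (box a l) (fun y => G2 (x, y)).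
    apply: measurable_funTS; apply/measurable_EFinP; apply: measurableT_comp => //.
    have mc : measurable_fun setT (fun _ : 'rV[R]_n => phi x : R) by exact: measurable_cst.
    exact: (measurable_funB mc mphi).
  have mdx : measurable_fun (box a l) (fun y => d x + d y).
    by apply: emeasurable_funD => //; exact: measurable_cst.
  rewrite ge0_integralD//; last by move=> y _; exact: adde_ge0.
  apply: leeD => //.
  rewrite ge0_integralD//.
  by rewrite integral_box_ecst//; exact: leeD.
apply: (@le_trans _ _ (\int[mu]_(x in box a l) (\int[mu]_(y in box a l) G2 (x, y) + ((l ^+ n)%:E * d x + (e / K)%:E)))).
  by apply: le_ge0_integral => x _; [apply: integral_ge0|exact: step].
have ms1 : measurable_fun (box a l) (fun x => \int[mu]_(y in box a l) G2 (x, y)).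
  by apply: measurable_funTS; exact: measurable_inner_integral.
have ln0 : 0 <= (l ^+ n)%:E by rewrite lee_fin exprn_ge0.
have ms2 : measurable_fun (box a l) (fun x => (l ^+ n)%:E * d x) by exact: measurable_funeM.
have eK' : 0 <= (e / K)%:E by rewrite lee_fin ltW.
have ms3 : measurable_fun (box a l) (fun x => (l ^+ n)%:E * d x + (e / K)%:E) by apply: emeasurable_funD.
have i0 x : 0 <= \int[mu]_(y in box a l) G2 (x, y) by apply: integral_ge0.
have s0 x : 0 <= (l ^+ n)%:E * d x + (e / K)%:E by rewrite adde_ge0// mule_ge0.
rewrite ge0_integralD//.
have s1 x : 0 <= (l ^+ n)%:E * d x by rewrite mule_ge0.
have -> : \int[mu]_(x in box a l) ((l ^+ n)%:E * d x + (e / K)%:E) =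
    \int[mu]_(x in box a l) ((l ^+ n)%:E * d x) + \int[mu]_(x in box a l) (e / K)%:E.
  by rewrite ge0_integralD.
rewrite integral_box_ecst// ge0_integralZl_EFin ?exprn_ge0//.
have P := poincare_box a l0 (smooth_axis_C1 (test_smooth tphi)).
have S : \sum_(i < n) \int[mu]_(x in box a l) (`|partial i phi x|%R)%:E <= (n%:R * (C + e / K))%:E.
  rewrite (_ : (n%:R * (C + e / K))%:E = \sum_(i < n) (C + e / K)%:E); last first.
    by rewrite sumEFin sumr_const card_ord mulr_natl.
  apply: lee_sum => i _; rewrite EFinD.
  have mGi : measurable_fun (box a l) (fun x => (`|G x ord0 i|%R)%:E).
    apply/measurable_EFinP; apply: measurableT_comp => //; apply: measurable_funS (lG i).1 => //.
  have mDi : measurable_fun (box a l) (fun x => (`|partial i phi x - G x ord0 i|%R)%:E).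
    apply/measurable_EFinP; apply: measurableT_comp => //; apply: measurable_funS (ldiffi i).1 => //.
  apply: le_trans (leeD (GC i) (E2 i)); rewrite -ge0_integralD//.
  apply: le_ge0_integral => x _; first by rewrite lee_fin.
  rewrite -EFinD lee_fin addrC -[X in (`|X| <= _)%R](subrK (G x ord0 i)).
  exact: ler_normD.
have lS : 0 <= (l ^+ n.+1)%:E by rewrite lee_fin exprn_ge0.
apply: le_trans (leeD (le_trans P (lee_wpmul2l lS S)) (leeD (lee_wpmul2l ln0 E1) (lexx _))) _.
rewrite -!EFinM -!EFinD lee_fin.
have eKK : (K * (e / K) = e)%R by rewrite mulrC divfK// gt_eqF.
rewrite -[in leRHS]eKK /K; set t := (e / _)%R.
rewrite -subr_ge0 (_ : (_ - _ = t)%R); first exact: ltW.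
ring.
Qed.

End poincare_sobolev.

Section local_dichotomy.
Context {R : realType} {n : nat}.
Variables (Omega : set 'rV[R]_n) (p : R).
Hypotheses (oO : open Omega) (bO : bounded_set Omega) (hp : 1 < p).
Local Notation mu := (@lebesgue_rV R n).
Local Notation test := (test_function Omega).
Local Notation Lp := (Lp mu Omega p).
Local Notation intg := (intg mu Omega).
Local Notation W0app := (W0app Omega p).
Local Notation nonneg := [set t : R | 0 <= t].
Let mO : measurable Omega := measurable_domain oO.
Let fO := finite_domain oO bO.
Let p0 : 0 < p. Proof. exact: lt_trans hp. Qed.
Variables (f : 'rV[R]_n -> R) (F : R) (lambda : R).
Hypotheses (mf : measurable_fun Omega f) (f0 : forall x, Omega x -> 0 <= f x)
  (fF : forall x, Omega x -> f x <= F).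
Variables (v : 'rV[R]_n -> R) (H : 'rV[R]_n -> 'rV[R]_n).
Hypotheses (hv : W0app nonneg v H) (sv : solves Omega p f lambda v H)
  (v0 : forall x, 0 <= v x).
Let lv : Lp v := W0app_Lp hv.
Let te (e t : R) : 0 < e -> 0 <= t -> 0 < t + e.
Proof. by move=> e0 t0; rewrite ltr_wpDl. Qed.

Lemma is_derive_shift_ln (e t : R) : 0 < t + e ->
  is_derive t (1 : R) (fun s => ln (s + e) + - ln e) ((t + e) `^ (-1)).
Proof.
move=> t0; have d1 := is_derive1_ln t0.
have d0 : is_derive t (1 : R) (fun s : R => s + e) 1.
  apply: (is_derive_eq (is_deriveD (is_derive_id t 1) (is_derive_cst e t 1))).
  exact: addr0.
have d2 := is_derive1_comp (f := fun s : R => ln s) (g := fun s : R => s + e) d1 d0.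
apply: (is_derive_eq (is_deriveD d2 (is_derive_cst (- ln e) t 1))).
by rewrite addr0 powR_inv1 ?(ltW t0)//; exact: mulr1.
Qed.

Lemma smooth_shift_ln (e : R) psi : 0 < e -> smooth psi -> (forall x : 'rV[R]_n, 0 <= psi x) ->
  smooth (fun x => ln (psi x + e) + - ln e) /\
  forall i, partial i (fun x => ln (psi x + e) + - ln e) =
    fun x => (psi x + e) `^ (-1) * partial i psi x.
Proof.
move=> e0 sp psi0; have pe x : 0 < psi x + e := te e0 (psi0 x).
split=> [|i].
  apply/smoothP => k; apply: CkD; last exact: Ck_cst.
  apply: Ck_ln => //; apply: CkD; last exact: Ck_cst.
  exact: (smoothP _).1.
have [_ ->] := partial_comp (h := fun s => ln (s + e) + - ln e) (h' := fun s => (s + e) `^ (-1)) i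
  (fun x => smooth_diff x sp) (fun x => is_derive_shift_ln (pe x)).
by [].
Qed.

Lemma measurable_shift_ln (e : R) : measurable_fun setT (fun s : R => ln (s + e) + - ln e).
Proof.
apply: measurable_funD => //; apply: (measurableT_comp (@measurable_ln R)).
exact: measurable_funD.
Qed.

(** Subtracting ln e makes the composed function vanish at 0, which keeps the approximants compactly
    supported; the constant disappears from the differences used later. *)
Lemma W0app_log e : 0 < e ->
  W0app setT (fun x => ln (v x + e) + - ln e) (fun x => (v x + e) `^ (-1) *: H x).
Proof.
move=> e0.
pose L1 := e `^ (-1); pose L2 := e `^ (- 2).
have L10 : 0 <= L1 := powR_ge0 _ _.
have L20 : 0 <= L2 := powR_ge0 _ _.
have hL1 : L1 <= L1 + L2 by rewrite lerDl.
have hL2 : L2 <= L1 + L2 by rewrite lerDr.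
have bk1 (t : R) : 0 <= t -> `|(t + e) `^ (-1)| <= L1.
  move=> t0; rewrite (ger0_norm (powR_ge0 _ _)).
  by apply: powR_antitone; rewrite ?lerDr// lerN10.
have bk2 (t : R) : 0 <= t -> `|(-1) * (t + e) `^ (-1 - 1)| <= L2.
  move=> t0; rewrite mulN1r normrN (ger0_norm (powR_ge0 _ _)) /L2.
  rewrite (_ : -1 - 1 = - 2 :> R); last by ring.
  by apply: powR_antitone; rewrite ?lerDr// oppr_le0.
have := W0app_chain oO bO hp (J := nonneg) (J' := setT) (eta := fun=> 1)
  (k := fun t => ln (t + e) + - ln e) (k' := fun t => (t + e) `^ (-1))
  (L := L1 + L2) (M := 1) (u := v) (G := H).
have -> : (fun x => (v x + e) `^ (-1) *: H x) =
    (fun x => \row_i (partial i (fun=> 1) x * (ln (v x + e) + - ln e)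
                      + 1 * (v x + e) `^ (-1) * H x ord0 i)).
  by apply/funext => x; apply/rowP => i; rewrite !mxE partial_cst mul0r add0r mul1r.
have -> : (fun x => ln (v x + e) + - ln e) = (fun x => 1 * (ln (v x + e) + - ln e)).
  by apply/funext => x; rewrite mul1r.
apply => //=.
- exact: addr_ge0.
- exact: smooth_cst.
- by move=> x; rewrite normr1.
- by move=> i x; rewrite partial_cst normr0.
- by right; rewrite add0r subrr.
- by move=> psi tpsi psi0; exact: (smooth_shift_ln e0 (test_smooth tpsi) psi0).
- move=> s t s0 t0; apply: le_trans (ler_wpM2r (normr_ge0 _) hL1).
  apply: (lip_derive_nng (g := fun t => ln (t + e) + - ln e)
    (g' := fun t => (t + e) `^ (-1))) => // x x0.
  exact: is_derive_shift_ln (te e0 x0).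
- by move=> t t0; exact: le_trans (bk1 t t0) hL1.
- move=> s t s0 t0; apply: le_trans (ler_wpM2r (normr_ge0 _) hL2).
  apply: (lip_derive_nng (g := fun t => (t + e) `^ (-1))
    (g' := fun t => (-1) * (t + e) `^ (-1 - 1))) => // x x0.
  exact: is_derive_shift_powR (te e0 x0).
- exact: measurable_shift_ln.
- exact: measurable_shift_powR.
Qed.

(** On {v = 0} times {v >= tau} the integrand is at least ln (tau + e) - ln e. *)
Lemma le_level_product (a : 'rV[R]_n) l tau (e : R) : 0 < e -> 0 < tau -> (0 <= l) ->
  box a l `<=` Omega ->
  ((ln (tau + e) - ln e)%:E * mu ([set x | v x = 0%R] `&` box a l) *
    mu ([set x | (tau <= v x)%R] `&` box a l) <=
  \int[mu]_(x in box a l) \int[mu]_(y in box a l)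
    (`|(ln (v x + e) + - ln e) - (ln (v y + e) + - ln e)|%R)%:E)%E.
Proof.
move=> e0 t0 l0 bo; have mb := measurable_box a l.
pose Z := [set x | v x = 0] `&` box a l; pose P := [set x | tau <= v x] `&` box a l.
have mvb : measurable_fun (box a l) v by apply: measurable_funS lv.1.
have mZ : measurable Z.
  have := mvb mb _ (measurable_set1 (0%R : R)); rewrite setIC; congr measurable.
have mP : measurable P.
  have := mvb mb _ (measurable_itv `[tau, +oo[%R); rewrite setIC; congr measurable.
  by apply/seteqP; split => x /=; rewrite in_itv/= andbT.
have M0 : 0 <= ln (tau + e) - ln e.
  by rewrite subr_ge0 ler_ln ?posrE ?lerDr ?(ltW t0)// te// ltW.
set M := ln (tau + e) - ln e in M0 *.
apply: (@le_trans _ _ (\int[mu]_(x in box a l) (M%:E * mu P * (\1_Z x)%:E))%E).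
  have mP0 : (0 <= mu P)%E by exact: measure_ge0.
  have MP0 : (0 <= M%:E * mu P)%E by rewrite mule_ge0// lee_fin.
  rewrite ge0_integralZl//; last first.
    by apply/measurable_EFinP; exact: measurable_indic.
  rewrite integral_indic// -setIA setIid -/Z -/P.
  by rewrite -muleA (muleC (mu Z)) muleA.
apply: le_ge0_integral => x Qx.
  by rewrite mule_ge0 ?lee_fin// mule_ge0 ?lee_fin// measure_ge0.
apply: (@le_trans _ _ (\int[mu]_(y in box a l) ((M * \1_Z x)%:E * (\1_P y)%:E))%E).
  rewrite ge0_integralZl_EFin//; last 2 first.
  - by apply/measurable_EFinP; exact: measurable_indic.
  - by rewrite mulr_ge0.
  rewrite integral_indic// -setIA setIid -/P EFinM.
  by rewrite -!muleA (muleC (mu P)).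
apply: le_ge0_integral => y Qy; first by rewrite mule_ge0 ?lee_fin// mulr_ge0.
rewrite -EFinM lee_fin !indicE.
have [xZ|_] := boolP (x \in Z); last by rewrite mulr0 mul0r.
have [yP|_] := boolP (y \in P); last by rewrite mulr0.
rewrite !mulr1; move: xZ yP; rewrite !inE => -[/= vx _] [/= vy _].
rewrite vx add0r subrr sub0r normrN /M; apply: le_trans (ler_norm _).
by rewrite lerD2r ler_ln ?posrE ?lerD2r// te// ltW.
Qed.

(** Solve (tau + e) / e = exp M. An explicit [e] with a prescribed logarithmic gap replaces a limit
    e -> 0. *)
Lemma ln_surj (tau M : R) : 0 < tau -> 0 < M -> exists2 e, 0 < e & ln (tau + e) - ln e = M.
Proof.
move=> t0 M0; have E0 : 0 < expR M - 1 by rewrite subr_gt0 expR_gt1.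
exists (tau / (expR M - 1)); first by rewrite divr_gt0.
have e0 : 0 < tau / (expR M - 1) by rewrite divr_gt0.
have -> : tau + tau / (expR M - 1) = expR M * (tau / (expR M - 1)).
  by field; rewrite gt_eqF.
by rewrite lnM ?posrE ?expR_gt0// expRK addrK.
Qed.

Lemma mu_level_product_eq0 (a : 'rV[R]_n) l tau (C : R) : 0 < tau -> 0 <= l ->
  box a l `<=` Omega ->
  (forall e, 0 < e -> (\int[mu]_(x in box a l) \int[mu]_(y in box a l)
    (`|(ln (v x + e) + - ln e) - (ln (v y + e) + - ln e)|%R)%:E <= C%:E)%E) ->
  mu ([set x | v x = 0] `&` box a l) = 0%E \/ mu ([set x | tau <= v x] `&` box a l) = 0%E.
Proof.
move=> t0 l0 bo h; have mb := measurable_box a l.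
have mvb : measurable_fun (box a l) v by apply: measurable_funS lv.1.
set Z := [set x | v x = 0] `&` box a l; set P := [set x | tau <= v x] `&` box a l.
have mZ : measurable Z.
  have := mvb mb _ (measurable_set1 (0%R : R)); rewrite setIC; congr measurable.
have mP : measurable P.
  have := mvb mb _ (measurable_itv `[tau, +oo[%R); rewrite setIC; congr measurable.
  by apply/seteqP; split => x /=; rewrite in_itv/= andbT.
have fin (A : set 'rV[R]_n) : measurable A -> A `<=` box a l -> mu A \is a fin_num.
  move=> mA AB; rewrite ge0_fin_numE ?measure_ge0//.
  have : (mu A <= mu (box a l))%E by apply: le_measure; rewrite ?inE.
  by rewrite mu_box// => /le_lt_trans; apply; rewrite ltry.
have fZ : mu Z \is a fin_num by apply: fin => // x [].
have fP : mu P \is a fin_num by apply: fin => // x [].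
suff : fine (mu Z) * fine (mu P) = 0.
  move=> /eqP; rewrite mulf_eq0 => /orP[] /eqP h0; [left|right].
    by rewrite -(fineK fZ) h0.
  by rewrite -(fineK fP) h0.
have zp : 0 <= fine (mu Z) * fine (mu P) by rewrite mulr_ge0// fine_ge0.
apply/eqP; rewrite eq_le zp andbT leNgt; apply/negP => zp0.
(* With this gap the lower bound of [le_level_product] equals |C| + 1, which exceeds the uniform
   upper bound [C]. *)
pose M := (`|C| + 1) / (fine (mu Z) * fine (mu P)).
have M0 : 0 < M by rewrite divr_gt0// ltr_wpDl.
have [e e0 eM] := ln_surj t0 M0.
have := le_trans (le_level_product e0 t0 l0 bo) (h e e0).
rewrite eM -/Z -/P -(fineK fZ) -(fineK fP) -!EFinM lee_fin /M -mulrA divfK ?gt_eqF//.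
by have := ler_norm C; lra.
Qed.

(** Where the bump t is at least [b], this turns the L^p bound of bump times slope into an L^1 bound
    of the slope s. *)
Lemma le_one_powR (b s t : R) : 0 < b -> b <= t -> 0 <= s -> s <= 1 + b `^ (- p) * (t * s) `^ p.
Proof.
move=> b0 bt s0; apply: le_trans (L1_le hp ltr01 s0) _.
rewrite powR1 mul1r lerD2l.
have E : s `^ p = b `^ (- p) * (b * s) `^ p.
  rewrite powRM ?(ltW b0)// mulrA -powRD ?addNr ?powRr0 ?mul1r//.
  by apply/implyP => _; rewrite gt_eqF.
rewrite E; apply: ler_wpM2l; first exact: powR_ge0.
have bs0 : 0 <= b * s by rewrite mulr_ge0// ltW.
have bts : b * s <= t * s by rewrite ler_wpM2r.
rewrite ge0_ler_powR ?nnegrE ?(ltW p0)//.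
exact: le_trans bts.
Qed.

Lemma local_dichotomy x0 : Omega x0 -> exists2 d, 0 < d &
  ae_on (ball x0 d) (fun y => v y = 0) \/ ae_on (ball x0 d) (fun y => 0 < v y).
Proof.
move=> Ox; have [r r0 rO] := open_sq_sub oO Ox.
(* So small that the box lies where sq <= r^2 / 2, well inside the support of the bump. *)
pose l := r / n.+1%:R; have n0 : 0 < n.+1%:R :> R by [].
have l0 : 0 < l by rewrite divr_gt0.
pose a := x0 - const_mx (l / 2).
have r2 : 0 < r ^+ 2 by rewrite exprn_gt0.
have bsq x : box a l x -> sq x0 x <= r ^+ 2 / 2.
  move=> bx; apply: (@le_trans _ _ (n%:R * (l / 2) ^+ 2)).
    apply: ball_sq => [|i]; first by rewrite divr_ge0// ltW.
    have := bx i; rewrite in_itv/= !mxE => /andP[h1 h2]; rewrite ler_distl; lra.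
  have ln : l * n.+1%:R = r by rewrite divfK// gt_eqF.
  have key (k N : R) : 0 <= N -> N * (k / 2) ^+ 2 <= (k * (N + 1)) ^+ 2 / 2.
    move=> N0; rewrite -subr_ge0.
    have -> : (k * (N + 1)) ^+ 2 / 2 - N * (k / 2) ^+ 2 = k ^+ 2 * (N ^+ 2 / 2 + 3 / 4 * N + 1 / 2).
      by field.
    by rewrite mulr_ge0 ?sqr_ge0// !addr_ge0 ?mulr_ge0 ?sqr_ge0.
  by have := key l n%:R (ler0n _ n); rewrite natr1 ln.
have bO' : box a l `<=` Omega.
  by move=> x /bsq h; apply: rO => /=; apply: le_trans h _; lra.
pose w x := r ^+ 2 - sq x0 x.
have sw : smooth w.
  apply/smoothP => k; apply: CkD; first exact: Ck_cst.
  by rewrite (_ : (fun x => - sq x0 x) = (fun x => (-1) * sq x0 x)) ?CkM//; [apply: CkM; [exact: Ck_cst|exact: Ck_sq]|apply/funext => x; rewrite mulN1r].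
have th : test (fun x => flat 0 1 (w x)) by exact: test_flat_sq.
have [C hC] := log_estimate oO bO hp f0 hv sv v0 ltr01 sw th.
(* The value of the bump at the least argument r^2 / 2 that it meets on the box. *)
pose b := expR (- 1 / (r ^+ 2 / 2)).
have b0 : 0 < b by exact: expR_gt0.
have hb x : box a l x -> b <= flat 0 1 (w x).
  move=> /bsq h; have wr : r ^+ 2 / 2 <= w x by rewrite /w; lra.
  have w0 : 0 < w x by apply: lt_le_trans wr; rewrite divr_gt0.
  rewrite flat_gt0E// powRr0 mul1r ler_expR !mulN1r lerN2 lef_pV2 ?posrE//.
  by rewrite divr_gt0.
pose C1 := fine (mu Omega) + b `^ (- p) * C.
have hG e : 0 < e -> forall i,
  (\int[mu]_(x in box a l) (`|((v x + e) `^ (-1) *: H x) ord0 i|%R)%:E <= C1%:E)%E.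
  move=> e0 i; pose T x := (flat 0 1 (w x) * log_slope v H e x) `^ p.
  have ls := log_slope_ge0 v H e.
  have iT : intg T.
    apply: (eq_intg mO _ (Lp_mul_test oO bO hp hv v0 e0 th).2) => x _.
    by rewrite ger0_norm// mulr_ge0// flat_ge0.
  have i1 : intg (fun=> 1) by exact: intg_cst.
  apply: (@le_trans _ _ (\int[mu]_(x in box a l) (1 * 1 + b `^ (- p) * T x)%:E)%E).
    apply: le_ge0_integral => x bx; first by rewrite lee_fin.
    rewrite lee_fin mul1r; apply: le_trans (le_one_powR b0 (hb x bx) (ls x)).
    rewrite mxE normrM (ger0_norm (powR_ge0 _ _)) /log_slope mulrC.
    by apply: ler_wpM2r; [exact: powR_ge0|exact: coord_le_enorm].
  have iQ : intg (fun x => 1 * 1 + b `^ (- p) * T x) := intgD mO (intgZ mO 1 i1) (intgZ mO _ iT).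
  have Q0 x : 0 <= 1 * 1 + b `^ (- p) * T x.
    by rewrite mul1r addr_ge0// mulr_ge0// powR_ge0.
  apply: le_trans (integral_box_le_I oO bO' iQ Q0) _.
  rewrite lee_fin (I_lincomb mO 1 _ i1 iT) mul1r /C1.
  apply: lerD; first by rewrite /Rintegral integral_cst// mul1e.
  by apply: ler_wpM2l; [exact: powR_ge0|exact: hC].
pose C2 := l ^+ n.+1 * (n%:R * C1).
have hP e (e0 : 0 < e) := poincare_W0app oO bO hp l0 bO' (W0app_log e0) (hG e e0).
have key tau (t0 : 0 < tau) := mu_level_product_eq0 t0 (ltW l0) bO' hP.
have mb := measurable_box a l.
have mvb : measurable_fun (box a l) v by apply: measurable_funS lv.1.
have bb : ball x0 (l / 2) `<=` box a l.
  move=> y [_ hy] i; have := hy ord0 i; rewrite /ball/= in_itv/= !mxE ltr_distlC => /andP[h1 h2].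
  lra.
exists (l / 2); first by rewrite divr_gt0.
have [Z0|Z0] := pselect (mu ([set x | v x = 0] `&` box a l) = 0%E).
  right; exists ([set x | v x = 0] `&` box a l); split => //.
    have := mvb mb _ (measurable_set1 (0%R : R)); rewrite setIC; congr measurable.
  move=> x /= /not_implyP[xb]; rewrite lt_neqAle v0 andbT => /negP/negPn/eqP vx.
  by split => //; exact: bb.
left.
(* If {v = 0} is not null in the box, then each {v >= tau} is, and {v > 0} is a countable union of
   these. *)
have hk (k : nat) : mu.-negligible ([set x | k.+1%:R^-1 <= v x] `&` box a l).
  have k0 : 0 < k.+1%:R^-1 :> R by rewrite invr_gt0.
  exists ([set x | k.+1%:R^-1 <= v x] `&` box a l); split => //.
    have := mvb mb _ (measurable_itv `[k.+1%:R^-1, +oo[%R); rewrite setIC; congr measurable.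
    by apply/seteqP; split => x /=; rewrite in_itv/= andbT.
  by have [/Z0|] := key _ k0.
apply: negligibleS (negligible_bigcup hk) => x /= /not_implyP[xb vx].
have vx0 : 0 < v x by rewrite lt_neqAle v0 andbT eq_sym; apply/eqP.
exists (Num.truncn (v x)^-1) => //; split; last exact: bb.
by rewrite /= invf_ple ?posrE// ltW// truncnS_gt.
Qed.

Lemma positive_dichotomy : connected Omega ->
  ae_on Omega (fun x => v x = 0) \/ ae_on Omega (fun x => 0 < v x).
Proof. by move=> cO; apply: connected_dichotomy => // x; exact: local_dichotomy. Qed.

End local_dichotomy.

(** * The barrier *)

Section barrier_constant.
Context {R : realType}.
Implicit Types p lam rr RR s t c m b N : R.

Lemma powRN2 t : 0 < t -> t `^ (- 2) = (t ^+ 2)^-1.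
Proof. by move=> t0; rewrite powRN powR_mulrn ?ltW. Qed.

Lemma powRD_gt0 t a b : 0 < t -> t `^ (a + b) = t `^ a * t `^ b.
Proof. by move=> t0; rewrite powRD// (gt_eqF t0) implybT. Qed.

Lemma dflat_factor a c t : 0 < t -> dflat a c t = flat a c t * ((a * t + c) / t ^+ 2).
Proof.
move=> t0; rewrite /dflat !flat_gt0E// (powRD_gt0 a (-1) t0) (powRD_gt0 a (-2) t0).
rewrite powR_inv1 ?(ltW t0)// powRN2//.
by move: (t `^ a) (expR _) => x y; field; rewrite gt_eqF.
Qed.

Lemma powR_inv_exp_le b p : 0 <= b -> 1 < p -> ((b + 1) `^ (p - 1)^-1) `^ (p - 1) = b + 1.
Proof.
move=> b0 p1; rewrite -powRrM mulVf ?powRr1//; last by rewrite subr_eq0 gt_eqF.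
by rewrite addr_ge0.
Qed.

(** The exponent will be (p - 2) / 2, of either sign; the lower bound is the value at the left or at
    the right end accordingly. *)
Lemma powR_between_gt0 rr RR a : 0 < rr -> rr <= RR -> exists2 k, 0 < k &
  forall s, rr <= s -> s < RR -> k <= s `^ a.
Proof.
move=> r0 rR; have R0 : 0 < RR := lt_le_trans r0 rR.
have [a0|a0] := leP 0 a.
  exists (rr `^ a); first exact: powR_gt0.
  move=> s rs _; rewrite ge0_ler_powR ?nnegrE ?(ltW r0)//.
  by rewrite ltW// (lt_le_trans r0).
exists (RR `^ a); first exact: powR_gt0.
move=> s rs sR; have s0 : 0 < s := lt_le_trans r0 rs.
rewrite -(opprK a) !(powRN _ (- a)) lef_pV2 ?posrE ?powR_gt0//.
by rewrite ge0_ler_powR ?nnegrE ?oppr_ge0 ?ltW.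
Qed.

(** With s = sq z x, the conclusion says that the divergence of the flux of W = m * flat 0 c (RR -
    s) exceeds lam W^(p-1) on the annulus rr <= s < RR. Relative to W^(p-1), the left side carries
    the factor (2 c / t^2)^(p-1) and a bracket that both grow with [c]. *)
Lemma barrier_constant p lam N rr RR : 1 < p -> 0 <= lam -> 0 <= N -> 0 < rr -> rr < RR ->
  exists2 c, 0 < c & forall m s t a d, 0 < m -> rr <= s -> s < RR ->
    t = RR - s -> a = - 2 * (p - 1) -> d = c * (p - 1) ->
    lam * (m * flat 0 c t) `^ (p - 1) <
    (2 * m * c) `^ (p - 1) * (s `^ ((p - 2) / 2) *
      (2 * s * dflat a d t - (N + p - 2) * flat a d t)).
Proof.
move=> p1 l0 N0 r0 rR; have p10 : 0 < p - 1 by rewrite subr_gt0.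
have RR0 : 0 < RR := lt_trans r0 rR.
have [k k0 hk] := powR_between_gt0 ((p - 2) / 2) r0 (ltW rR).
(* The (p-1)-th root of the size required of the factor; [k] is a lower bound of s^((p-2)/2). *)
pose B := (lam / k + 1) `^ (p - 1)^-1.
have B0 : 0 <= B := powR_ge0 _ _.
have lk : 0 <= lam / k by rewrite divr_ge0// ltW.
have BE : B `^ (p - 1) = lam / k + 1 by exact: powR_inv_exp_le.
have q0 : 0 < 2 * rr * (p - 1) by rewrite !mulr_gt0.
pose M := (N + p) * RR ^+ 2 / (2 * rr * (p - 1)).
have M0 : 0 <= M by rewrite divr_ge0 ?(ltW q0)// mulr_ge0 ?sqr_ge0// addr_ge0// ltW// (lt_trans _ p1).
(* The summands serve, in this order, to compensate the term - 2 t in a t + d = (p - 1) (c - 2 t),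
   to make the bracket at least 2, and to make 2 c / t^2 at least [B]. *)
pose c := 2 * RR + M + B * RR ^+ 2 / 2.
have BR : 0 <= B * RR ^+ 2 by rewrite mulr_ge0 ?sqr_ge0.
have c0 : 0 < c.
  by rewrite /c; lra.
exists c; first exact: c0.
move=> m s t a d m0 rs sR tE aE dE.
have s0 : 0 < s := lt_le_trans r0 rs.
have t0 : 0 < t by rewrite tE subr_gt0.
have tR : t < RR by rewrite tE; lra.
have t2 : 0 < t ^+ 2 by rewrite exprn_gt0.
have tR2 : t ^+ 2 <= RR ^+ 2.
  by rewrite ler_pXn2r ?nnegrE//; [exact: ltW|exact: ltW|exact: ltW].
have brk : 2 <= 2 * s * ((a * t + d) / t ^+ 2) - (N + p - 2).
  rewrite lerBrDr mulrA ler_pdivlMr// addrC subrK.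
  have NP : 0 <= N + p by rewrite addr_ge0// ltW// (lt_trans _ p1).
  apply: (@le_trans _ _ ((N + p) * RR ^+ 2)); first by rewrite ler_wpM2l.
  have -> : a * t + d = (p - 1) * (c - 2 * t) by rewrite aE dE; ring.
  have -> : (N + p) * RR ^+ 2 = M * (2 * rr * (p - 1)) by rewrite /M divfK// gt_eqF.
  have cM : M <= c - 2 * t by rewrite /c; lra.
  have ct0 : 0 <= c - 2 * t by exact: le_trans cM.
  apply: (@le_trans _ _ ((c - 2 * t) * (2 * rr * (p - 1)))).
    by rewrite ler_wpM2r// ltW.
  rewrite mulrC mulrA ler_wpM2r//. 
  by rewrite ler_wpM2r ?(ltW p10)// ler_wpM2l.
have flatE : flat a d t = (t ^+ 2)^-1 `^ (p - 1) * (flat 0 c t) `^ (p - 1).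
  rewrite flat_powR// mul0r !flat_gt0E// powRr0 mul1r -powRN2// -powRrM aE -dE.
  by congr (_ `^ _ * _); ring.
have F0 : 0 < flat 0 c t `^ (p - 1) by rewrite powR_gt0// flat_gt0.
have big : lam / k + 1 <= (2 * c) `^ (p - 1) * (t ^+ 2)^-1 `^ (p - 1).
  rewrite -BE -powRM ?invr_ge0 ?(ltW t2)//; last by rewrite mulr_ge0// ltW.
  have cB : B * RR ^+ 2 <= 2 * c by rewrite /c; lra.
  have h1 : B <= 2 * c / t ^+ 2.
    rewrite ler_pdivlMr//; apply: le_trans cB; exact: ler_wpM2l.
  by rewrite ge0_ler_powR ?nnegrE ?(ltW p10)// (le_trans B0).
rewrite (dflat_factor _ _ t0) flatE.
rewrite (powRM (p - 1) (ltW m0) (flat_ge0 _ _ _)).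
have -> : 2 * m * c = m * (2 * c) by ring.
have c20 : 0 <= 2 * c by rewrite mulr_ge0// ltW.
rewrite (powRM (p - 1) (ltW m0) c20).
have sk := hk s rs sR.
have m1 : 0 < m `^ (p - 1) by exact: powR_gt0.
have T0 : 0 <= (t ^+ 2)^-1 `^ (p - 1) by exact: powR_ge0.
have C0 : 0 <= (2 * c) `^ (p - 1) by exact: powR_ge0.
move: (flat 0 c t `^ (p - 1)) (m `^ (p - 1)) ((t ^+ 2)^-1 `^ (p - 1)) ((2 * c) `^ (p - 1))
  (s `^ ((p - 2) / 2)) ((a * t + d) / t ^+ 2) F0 m1 T0 C0 sk brk big => X Y T C S D X0 Y0 T0 C0 SK brk big.
have E : Y * C * (S * (2 * s * (T * X * D) - (N + p - 2) * (T * X))) =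
  (Y * X) * (S * (C * T) * (2 * s * D - (N + p - 2))) by ring.
rewrite E (_ : lam * (Y * X) = (Y * X) * lam); last by ring.
have YX : 0 < Y * X by rewrite mulr_gt0.
rewrite (ltr_pM2l YX).
move: (2 * s * D - (N + p - 2)) brk => D' brk.
have S0 : 0 < S := lt_le_trans k0 SK.
have lkE : k * (lam / k) = lam by rewrite mulrC divfK// gt_eqF.
have h1 : lam + k <= S * (C * T).
  have -> : lam + k = k * (lam / k + 1) by rewrite mulrDr mulr1 lkE.
  apply: ler_pM => //; [exact: ltW | exact: addr_ge0].
have h2 : S * (C * T) <= S * (C * T) * D'.
  apply: ler_peMr; [exact: le_trans (addr_ge0 l0 (ltW k0)) h1|lra].
lra.
Qed.

End barrier_constant.

Section barrier.
Context {R : realType} {n : nat}.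
Variables (Omega : set 'rV[R]_n) (p : R).
Hypotheses (oO : open Omega) (bO : bounded_set Omega) (hp : 1 < p).
Local Notation mu := (@lebesgue_rV R n).
Local Notation test := (test_function Omega).
Local Notation Lp := (Lp mu Omega p).
Local Notation intg := (intg mu Omega).
Local Notation W0app := (W0app Omega p).
Local Notation I f := (\int[mu]_(x in Omega) f x).
Local Notation aeO P := {ae mu, forall x, Omega x -> P x}.
Local Notation nonneg := [set t : R | 0 <= t].
Let mO : measurable Omega := measurable_domain oO.
Let p0 : 0 < p. Proof. exact: lt_trans hp. Qed.
Let p10 : 0 < p - 1. Proof. by rewrite subr_gt0. Qed.

Section field.
Variables (z : 'rV[R]_n) (rr RR K a d : R).
Hypotheses (rr0 : 0 < rr) (d0 : 0 < d).

(* [sq z] modified near [z], so that its real powers are smooth. *)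
Definition lifted_sq (x : 'rV[R]_n) : R := sq z x + flat 0 1 (rr - sq z x).

(* With [a = - 2 (p - 1)] and [d = c (p - 1)], this is [|grad W|^{p-2} grad W] off
   the ball [sq z < rr], where [W := m * flat 0 c (RR - sq z)]; see [barrier_flux]. *)
Definition barrier_field (i : 'I_n) (x : 'rV[R]_n) : R :=
  - K * (x ord0 i - z ord0 i) * lifted_sq x `^ ((p - 2) / 2) * flat a d (RR - sq z x).

Lemma smooth_shift_sq (r : R) : smooth (fun x => r - sq z x).
Proof.
have -> : (fun x => r - sq z x) = (fun x => r + (-1) * sq z x).
  by apply/funext => x; rewrite mulN1r.
by apply: smoothD; [exact: smooth_cst|apply: smoothM; [exact: smooth_cst|exact: smooth_sq]].
Qed.

Lemma partial_shift_sq (r : R) i : partial i (fun x => r - sq z x) =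
  fun x : 'rV[R]_n => - 2 * (x ord0 i - z ord0 i).
Proof.
have ds (x : 'rV[R]_n) := smooth_diff x (smooth_sq z).
have dc (x : 'rV[R]_n) := smooth_diff x (@smooth_cst R n (-1)).
have dcr (x : 'rV[R]_n) := smooth_diff x (@smooth_cst R n r).
have -> : (fun x => r - sq z x) = (fun x => r + (-1) * sq z x).
  by apply/funext => x; rewrite mulN1r.
rewrite partialD//; last by move=> x; apply: smooth_diff; apply: smoothM; [exact: smooth_cst|exact: smooth_sq].
apply/funext => x; rewrite partial_cst add0r partialM// partial_cst mulr0 addr0.
by rewrite partial_sq mulN1r mulNr.
Qed.

Lemma lifted_sqE x : rr <= sq z x -> lifted_sq x = sq z x.
Proof. by move=> h; rewrite /lifted_sq flat_le0 ?addr0// subr_le0. Qed.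

Lemma lifted_sq_gt0 x : 0 < lifted_sq x.
Proof.
have [h|h] := leP rr (sq z x); first by rewrite lifted_sqE// (lt_le_trans rr0).
by rewrite ltr_wpDl ?sq_ge0// flat_gt0// subr_gt0.
Qed.

Lemma smooth_lifted_sq : smooth lifted_sq.
Proof.
apply: smoothD; first exact: smooth_sq.
exact: (smooth_flat_comp 0 ltr01 (smooth_shift_sq rr)).1.
Qed.

Lemma partial_lifted_sq i x : rr <= sq z x ->
  partial i lifted_sq x = 2 * (x ord0 i - z ord0 i).
Proof.
move=> h; rewrite /lifted_sq.
have [sf df] := smooth_flat_comp 0 (@ltr01 R) (smooth_shift_sq rr).
rewrite partialD => [|y|y]; [|exact: smooth_diff (smooth_sq z)|exact: smooth_diff sf].
by rewrite partial_sq df /dflat !flat_le0 ?subr_le0// !mulr0 addr0 mul0r addr0.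
Qed.

Lemma smooth_lifted_powR b : smooth (fun x => lifted_sq x `^ b).
Proof.
by apply/smoothP => k; apply: Ck_powR; [exact: lifted_sq_gt0|exact: (smoothP _).1 smooth_lifted_sq k].
Qed.

Lemma partial_lifted_powR b i x : rr <= sq z x ->
  partial i (fun x => lifted_sq x `^ b) x =
  b * sq z x `^ (b - 1) * (2 * (x ord0 i - z ord0 i)).
Proof.
move=> h.
have [_ ->] := partial_comp (h := fun s => s `^ b) (h' := fun s => b * s `^ (b - 1)) i
  (fun x => smooth_diff x smooth_lifted_sq) (fun x => is_derive1_powR b (lifted_sq_gt0 x)).
by rewrite lifted_sqE// partial_lifted_sq.
Qed.

Lemma smooth_coord_shift i : smooth (fun x : 'rV[R]_n => x ord0 i - z ord0 i).
Proof. by apply/smoothP => k; apply: CkD; [exact: Ck_coord|exact: Ck_cst]. Qed.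

Lemma partial_coord_shift i x :
  partial i (fun x : 'rV[R]_n => x ord0 i - z ord0 i) x = 1.
Proof.
have dc (y : 'rV[R]_n) : differentiable (fun y : 'rV[R]_n => y ord0 i) y.
  by apply: (@Ck_diff _ _ 0); exact: Ck_coord.
have dz (y : 'rV[R]_n) := smooth_diff y (@smooth_cst R n (- z ord0 i)).
rewrite (partialD i dc dz).
by rewrite partial_coord eqxx partial_cst addr0.
Qed.

Lemma test_barrier_field i : [set x | sq z x <= RR] `<=` Omega -> test (barrier_field i).
Proof.
move=> h; apply: testM; last exact: test_flat_sq.
apply: smoothM; last exact: smooth_lifted_powR.
by apply: smoothM; [exact: smooth_cst|exact: smooth_coord_shift].
Qed.

Lemma partial_barrier_field i x : rr <= sq z x ->
  partial i (barrier_field i) x =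
  - K * (sq z x `^ ((p - 2) / 2) * flat a d (RR - sq z x)
   + (x ord0 i - z ord0 i) ^+ 2 *
     ((p - 2) * sq z x `^ ((p - 2) / 2 - 1) * flat a d (RR - sq z x)
      - 2 * sq z x `^ ((p - 2) / 2) * dflat a d (RR - sq z x))).
Proof.
move=> h; have sK := @smooth_cst R n (- K); have sX := smooth_coord_shift i.
have sS := smooth_lifted_powR ((p - 2) / 2).
have [sQ dQ] := smooth_flat_comp a d0 (smooth_shift_sq RR).
have sKX := smoothM sK sX; have sKXS := smoothM sKX sS.
rewrite /barrier_field partialM; [|by move=> y; exact: smooth_diff sKXS|by move=> y; exact: smooth_diff sQ].
rewrite dQ partial_shift_sq partialM; [|by move=> y; exact: smooth_diff sKX|by move=> y; exact: smooth_diff sS].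
rewrite partial_lifted_powR// partialM; [|by move=> y; exact: smooth_diff sK|by move=> y; exact: smooth_diff sX].
rewrite partial_cst partial_coord_shift lifted_sqE//.
move: (sq z x `^ _) (sq z x `^ _) (flat _ _ _) (dflat _ _ _) (x ord0 i) (z ord0 i) => A B C D X Z.
by field.
Qed.

(** Summation turns the squares of the coordinates into sq z x, and the result has the form
    estimated in [barrier_constant]. *)
Lemma div_barrier_field x : rr <= sq z x ->
  \sum_i partial i (barrier_field i) x =
  K * (sq z x `^ ((p - 2) / 2) * (2 * sq z x * dflat a d (RR - sq z x)
    - (n%:R + p - 2) * flat a d (RR - sq z x))).
Proof.
move=> h; rewrite (eq_bigr _ (fun i _ => partial_barrier_field i h)).
rewrite -mulr_sumr big_split/= sumr_const card_ord -mulr_suml -/(sq z x).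
have s0 : 0 < sq z x := lt_le_trans rr0 h.
have -> : sq z x `^ ((p - 2) / 2 - 1) = sq z x `^ ((p - 2) / 2) * (sq z x)^-1.
  by rewrite (powRD_gt0 _ (-1) s0) powR_inv1// ltW.
rewrite -[_ *+ n]mulr_natl.
move: s0 (sq z x `^ _) (flat _ _ _) (dflat _ _ _) (n%:R : R) => s0 A B C N.
by field; rewrite gt_eqF.
Qed.

End field.

Section with_nonneg_solution.
Variables (f : 'rV[R]_n -> R) (lambda : R).
Hypotheses (f0 : forall x, Omega x -> 0 <= f x).
Variables (v : 'rV[R]_n -> R) (H : 'rV[R]_n -> 'rV[R]_n).
Hypotheses (hv : W0app nonneg v H) (sv : solves Omega p f lambda v H)
  (v0 : forall x, 0 <= v x).
Let lv : Lp v := W0app_Lp hv.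
Let lH : LpV Omega p H := W0app_LpV hv.

Lemma gradient_barrier (z : 'rV[R]_n) c m RR x : 0 < c ->
  gradient (fun x => m * flat 0 c (RR - sq z x)) x =
  - (2 * m * c * flat (-2) c (RR - sq z x)) *: (x - z).
Proof.
move=> c0; apply/rowP => i; rewrite !mxE.
have [sQ dQ] := smooth_flat_comp 0 c0 (smooth_shift_sq z RR).
have dm (y : 'rV[R]_n) := smooth_diff y (@smooth_cst R n m).
rewrite (partialM i dm (fun y => smooth_diff y sQ)) partial_cst mulr0 addr0.
rewrite dQ partial_shift_sq /dflat mul0r add0r sub0r.
by move: (flat _ _ _) => q; ring.
Qed.

Lemma enorm_sq (z x : 'rV[R]_n) : enorm (x - z) = sq z x `^ 2^-1.
Proof.
rewrite powR12_sqrt ?sq_ge0// /enorm /dotp /sq; congr Num.sqrt.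
by apply: eq_bigr => i _; rewrite !mxE expr2.
Qed.

(** The gradient of W is - 2 m c * flat (-2) c times x - z. Its norm to the power p - 2, times one
    more such factor, gives the (p-1)-th power of [flat (-2) c]; this is where the two parameters of
    the field come from. *)
Lemma barrier_flux (z : 'rV[R]_n) c m rr RR x w : 0 < c -> 0 < m -> rr <= sq z x ->
  enorm (gradient (fun x => m * flat 0 c (RR - sq z x)) x) `^ (p - 2) *
    dotp (gradient (fun x => m * flat 0 c (RR - sq z x)) x) w =
  \sum_i w ord0 i * barrier_field z rr RR ((2 * m * c) `^ (p - 1)) (- 2 * (p - 1)) (c * (p - 1)) i x.
Proof.
move=> c0 m0 h; rewrite gradient_barrier// dotpC dotpZr mulrA enormZ normrN.
have q0 := flat_ge0 (-2) c (RR - sq z x).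
have mc0 : 0 <= 2 * m * c by rewrite !mulr_ge0// ltW.
rewrite (ger0_norm (mulr_ge0 mc0 q0)) enorm_sq.
rewrite (powRM (p - 2) (mulr_ge0 mc0 q0) (powR_ge0 _ _)) -powRrM.
have -> : 2^-1 * (p - 2) = (p - 2) / 2 by rewrite mulrC.
rewrite /dotp mulr_sumr; apply: eq_bigr => i _.
rewrite /barrier_field lifted_sqE// -flat_powR// !mxE.
have E := powR1_mul hp (mulr_ge0 mc0 q0).
rewrite (powRM (p - 1) mc0 q0) in E.
move: E; move: (2 * m * c * flat (-2) c (RR - sq z x)) => Z E.
move: (sq z x `^ _) (Z `^ (p - 2)) ((2 * m * c) `^ (p - 1)) (flat (-2) c (RR - sq z x) `^ (p - 1)) E
  => A B k q E.
have -> : w ord0 i * (- k * (x ord0 i - z ord0 i) * A * q) =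
  - (k * q) * (A * (w ord0 i * (x ord0 i - z ord0 i))) by ring.
by rewrite -E; ring.
Qed.

(* Test with [(W - v)^+], where [W] is the left-hand side of the conclusion. *)
Lemma barrier_le (z : 'rV[R]_n) rr RR m : 0 < rr -> rr < RR -> 0 < m ->
  [set x | sq z x <= RR] `<=` Omega ->
  aeO (fun x => sq z x < rr -> m <= v x) ->
  exists2 c, 0 < c & aeO (fun x => m * flat 0 c (RR - sq z x) <= v x).
Proof.
move=> rr0 rR m0 hO hm.
have [c c0 hc] := barrier_constant hp (normr_ge0 lambda) (ler0n R n) rr0 rR.
exists c => //.
pose a := - 2 * (p - 1); pose d := c * (p - 1).
have d0 : 0 < d by exact: mulr_gt0.
pose K := (2 * m * c) `^ (p - 1).
(* Since [flat 0 c] is at most 1, W <= m, so W does not exceed v a.e. on the inner ball. *)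
pose W x := m * flat 0 c (RR - sq z x).
have W0 x : 0 <= W x by rewrite mulr_ge0 ?flat_ge0// ltW.
have Wm x : W x <= m.
  rewrite /W -[leRHS]mulr1 ler_wpM2l ?(ltW m0)//.
  have [t0|t0] := leP (RR - sq z x) 0; first by rewrite flat_le0.
  rewrite flat_gt0E// powRr0 mul1r -expR0 ler_expR mulNr oppr_le0.
  by rewrite divr_ge0// ltW.
have tW : test W by apply: testZ; exact: test_flat_sq.
pose Y := barrier_field z rr RR K a d.
have tY i : test (Y i) by exact: test_barrier_field.
have hW := test_W0app oO bO hp (J := setT) tW (fun=> Logic.I).
have hD := W0appD oO bO hp 1 (-1) hW (W0appS (@subsetT _ _) hv).
have hw := W0appS (@subsetT _ _) (W0app_pos oO bO hp hD).
move: hw; set w := (fun x => Num.max _ 0); set G := (fun x => if _ then _ else _) => hw.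
have lw := W0app_Lp hw; have lG := W0app_LpV hw.
have lgW := W0app_LpV hW.
have w0 x : 0 <= w x := max0_ge0 _.
have wE x : w x = 0 \/ (v x < W x /\ 0 < w x).
  rewrite /w mul1r mulN1r; case: (leP (W x - v x) 0) => h; first by left.
  by right; split => //; rewrite -subr_gt0.
have wle x : w x = 0 -> W x <= v x.
  rewrite /w mul1r mulN1r; case: (leP (W x - v x) 0) => [h _|h h']; first by rewrite -subr_le0.
  by move: h; rewrite h' ltxx.
(* Only the annulus matters: W <= m <= v inside it, and W = 0 <= v outside. *)
have hwW x : Omega x -> (sq z x < rr -> m <= v x) -> v x < W x -> rr <= sq z x /\ sq z x < RR.
  move=> Ox hx vW; split.
    rewrite leNgt; apply/negP => /hx mv; have := lt_le_trans vW (Wm x).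
    by move=> /lt_le_trans/(_ mv); rewrite ltxx.
  rewrite ltNge; apply/negP => h; move: vW; rewrite /W flat_le0 ?subr_le0// mulr0.
  by rewrite ltNge v0.
(* Where w > 0 its gradient is grad W - H, so the flux is monotone along it; elsewhere G is 0. *)
have mono : I (fun x => enorm (H x) `^ (p - 2) * dotp (H x) (G x)) <=
    I (fun x => enorm (gradient W x) `^ (p - 2) * dotp (gradient W x) (G x)).
  apply: (I_le mO); [exact: (intg_flux oO bO hp lH lG)|exact: (intg_flux oO bO hp lgW lG)|].
  move=> x _; rewrite /G; case: (0 < _); last by rewrite !dotp0r !mulr0.
  rewrite scale1r scaleN1r -subr_ge0; exact: flux_monotone.
(* The field agrees with the flux of W off the inner ball, and inside that ball G vanishes a.e. *)
have EY : I (fun x => enorm (gradient W x) `^ (p - 2) * dotp (gradient W x) (G x)) =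
    I (fun x => \sum_i G x ord0 i * Y i x).
  apply: (I_ae_eq mO).
  - exact: (measurable_flux lgW lG).
  - apply: measurable_sum => i; apply: measurable_funM; first exact: (lG i).1.
    exact: test_measurable.
  - apply: filterS hm => x hx Ox; have {}hx := hx Ox.
    have [h|h] := leP (W x) (v x).
      have -> : G x = 0 by rewrite /G mul1r mulN1r subr_gt0 ltNge h.
      by rewrite dotp0r mulr0 big1// => i _; rewrite mxE mul0r.
    by have [h1 _] := hwW x Ox hx h; exact: barrier_flux.
have iGY i : intg (fun x => G x ord0 i * Y i x) := intg_mul_test oO bO hp (lG i) (tY i).
have iwY i : intg (fun x => w x * partial i (Y i) x) :=
  intg_mul_test oO bO hp lw (test_partial i (tY i)).
pose D x := w x * \sum_i partial i (Y i) x.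
have iD : intg D.
  by apply: (eq_intg mO _ (intg_sum mO (index_enum _) iwY)) => x _; rewrite /D mulr_sumr.
(* The field is made of test functions, so the definition of the weak gradient of w moves the
   derivative onto it. *)
have ED : I (fun x => \sum_i G x ord0 i * Y i x) = - I D.
  rewrite (I_sum mO _ iGY) -[LHS]opprK; congr (- _).
  rewrite -sumrN (eq_bigr (fun i => I (fun x => w x * partial i (Y i) x))); last first.
    by move=> i _; rewrite -(W0app_weak oO bO hp i hw (tY i)).
  rewrite -(I_sum mO _ iwY); apply: eq_Rintegral => x _; by rewrite /D mulr_sumr.
pose B x := flat 0 d (RR - sq z x).
have tB : test B by exact: test_flat_sq.
have WE x : W x `^ (p - 1) = m `^ (p - 1) * B x.
  by rewrite /W (powRM _ (ltW m0) (flat_ge0 _ _ _)) flat_powR// mul0r.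
have iwB : intg (fun x => w x * B x) := intg_mul_test oO bO hp lw tB.
pose A x := `|lambda| * m `^ (p - 1) * (w x * B x).
have iA : intg A := intgZ mO _ iwB.
have AE x : A x = w x * (`|lambda| * W x `^ (p - 1)) by rewrite /A WE; ring.
(* Where w > 0 one has v < W, hence lambda v^(p-1) >= - |lambda| W^(p-1). *)
have le1 : I (fun x => - 1 * A x) <= lambda * I (fun x => `|v x| `^ (p - 2) * v x * w x).
  have ivw := intg_power_term oO hp lv lw.
  rewrite -(RintegralZl lambda mO ivw).
  apply: (I_le mO); [exact: intgZ|exact: intgZ|].
  move=> x _; rewrite (ger0_norm (v0 x)) (powR1_mul hp (v0 x)) AE.
  have [->|[vW _]] := wE x; first by rewrite !mulr0 mul0r mulr0.
  have vWp : v x `^ (p - 1) <= W x `^ (p - 1).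
    by rewrite ge0_ler_powR ?nnegrE ?(ltW p10)// ltW.
  have h1 := ler_wpM2l (normr_ge0 lambda) vWp.
  have h2 : - `|lambda| <= lambda by rewrite lerNl -normrN ler_norm.
  have h3 := ler_wpM2r (powR_ge0 (v x) (p - 1)) h2.
  have h4 : - (`|lambda| * W x `^ (p - 1)) <= lambda * v x `^ (p - 1).
    by rewrite mulNr in h3; apply: le_trans h3; rewrite lerN2.
  rewrite mulN1r -mulrN mulrA mulrC; exact: ler_wpM2r.
have src : 0 <= I (fun x => f x * w x).
  by apply: Rintegral_ge0 => x Ox; rewrite mulr_ge0// f0.
(* T is w times the excess of the divergence over |lambda| W^(p-1): a.e. positive where w > 0 by the
   choice of [c], while the equation makes its integral nonpositive. Hence w = 0 a.e. *)
pose T x := 1 * D x + (-1) * A x.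
have iT : intg T := intgD mO (intgZ mO 1 iD) (intgZ mO (-1) iA).
have T_le0 : I T <= 0.
  rewrite (I_lincomb mO 1 (-1) iD iA).
  rewrite (RintegralZl (-1) mO iA) in le1.
  have := sv hw; move: mono le1 src; rewrite EY ED.
  move: (I D) (I A) (I _) (lambda * _) (I _) => a1 a2 a3 a4 a5; lra.
have hT : aeO (fun x => 0 <= T x /\ (T x = 0 -> w x = 0)).
  apply: filterS hm => x hx Ox; have {}hx := hx Ox.
  have [w00|[vW wp]] := wE x.
    by rewrite /T /D AE w00 !mul0r !mulr0 addr0.
  have [h1 h2] := hwW x Ox hx vW.
  have := hc m (sq z x) (RR - sq z x) a d m0 h1 h2 erefl erefl erefl.
  rewrite -(div_barrier_field RR K a rr0 d0 h1) => hlt.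
  have Tp : 0 < T x.
    by rewrite /T /D AE mul1r mulN1r subr_gt0 ltr_pM2l.
  by split; [exact: ltW|move=> T0; move: Tp; rewrite T0 ltxx].
have iTa := intg_abs iT.
have ET : I (fun x => `|T x|) = I T.
  apply: (I_ae_eq mO (intg_measurable iTa) (intg_measurable iT)).
  by apply: filterS hT => x + Ox => /(_ Ox)[h _]; rewrite ger0_norm.
have ET0 : I (fun x => `|T x|) = 0.
  by apply/eqP; rewrite eq_le ET T_le0 -ET Rintegral_ge0.
have := I_eq0 mO iTa (fun x _ => normr_ge0 _) ET0.
apply: filterS2 hT => x h1 h2 Ox; apply: wle; apply: (h1 Ox).2.
by apply/eqP; rewrite -normr_eq0; apply/eqP; exact: h2.
Qed.

End with_nonneg_solution.

End barrier.

(** * Nontriviality of solutions and positivity at every point *)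

Section positivity.
Context {R : realType} {n : nat}.
Variables (Omega : set 'rV[R]_n) (p : R).
Hypotheses (oO : open Omega) (bO : bounded_set Omega) (hp : 1 < p).
Local Notation mu := (@lebesgue_rV R n).
Local Notation test := (test_function Omega).
Local Notation Lp := (Lp mu Omega p).
Local Notation W0app := (W0app Omega p).
Local Notation I f := (\int[mu]_(x in Omega) f x).
Local Notation aeO P := {ae mu, forall x, Omega x -> P x}.
Local Notation nonneg := [set t : R | 0 <= t].
Let mO : measurable Omega := measurable_domain oO.
Variables (f : 'rV[R]_n -> R) (F : R) (lambda : R).
Hypotheses (mf : measurable_fun Omega f) (f0 : forall x, Omega x -> 0 <= f x)
  (fF : forall x, Omega x -> f x <= F).

Lemma ball_lt_sq (z x : 'rV[R]_n) r : 0 < r -> ball z (r / n.+1%:R) x -> sq z x < r ^+ 2.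
Proof.
move=> r0 [_ hx]; have n0 : 0 < n.+1%:R :> R by [].
have e0 : 0 < r / n.+1%:R by rewrite divr_gt0.
apply: (@le_lt_trans _ _ (n%:R * (r / n.+1%:R) ^+ 2)).
  apply: ball_sq => [|i]; first exact: ltW.
  by have := hx ord0 i; rewrite /ball/= distrC => /ltW.
have E : r / n.+1%:R * (n%:R + 1) = r by rewrite natr1 divfK// gt_eqF.
have key (k N : R) : 0 < k -> 0 <= N -> N * k ^+ 2 < (k * (N + 1)) ^+ 2.
  move=> k0 N0; rewrite exprMn mulrC ltr_pM2l ?exprn_gt0//.
  by rewrite sqrrD1; have := sqr_ge0 N; lra.
by have := key _ _ e0 (ler0n R n); rewrite E.
Qed.

Lemma sq_lt_ball (z x : 'rV[R]_n) r : 0 < r -> sq z x < r ^+ 2 -> ball z r x.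
Proof.
move=> r0 h; split => // a i; rewrite ord1 /ball/= distrC.
have := le_lt_trans (le_sq z x i) h.
by rewrite -real_normK ?num_real// ltr_pXn2r ?nnegrE// ltW.
Qed.

(** If u = 0 a.e., the energy identity kills the gradient and the equation reduces to int f phi = 0
    for every test function; bumps around each point then force f = 0 a.e. nearby. *)
Lemma solution_nonzero u G : sol Omega p f lambda u G -> ~ aeO (fun x => f x = 0) ->
  ~ aeO (fun x => u x = 0).
Proof.
move=> hs fn u0; have [hu su] := hs.
have lu := W0app_Lp hu; have lG := W0app_LpV hu.
have i00 : I (fun=> 0) = 0 by rewrite Rintegral_cst// mul0r.
have pt0 w : Lp w -> I (fun x => `|u x| `^ (p - 2) * u x * w x) = 0.
  move=> lw; rewrite -[RHS]i00; apply: (I_ae_eq mO) => //.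
    exact: (measurable_power_term lu lw).
  by apply: filterS u0 => x h Ox; rewrite (h Ox) mulr0 mul0r.
have sr0 : I (fun x => f x * u x) = 0.
  rewrite -[RHS]i00; apply: (I_ae_eq mO) => //.
    by apply: measurable_funM => //; exact: lu.1.
  by apply: filterS u0 => x h Ox; rewrite (h Ox) mulr0.
have G0 : aeO (fun x => G x = 0).
  apply: (energy_eq0 oO bO hp lG).
  rewrite (solves_self hp hs) sr0 addr0 -(power_term_self Omega hp u).
  by rewrite (pt0 u lu) mulr0.
have fphi phi : test phi -> I (fun x => f x * phi x) = 0.
  move=> tphi; have hphi := test_W0app oO bO hp (J := setT) tphi (fun=> Logic.I).
  have := su _ _ hphi; rewrite (pt0 _ (W0app_Lp hphi)) mulr0 add0r => <-.
  rewrite -[RHS]i00; apply: (I_ae_eq mO) => //.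
    exact: (measurable_flux lG (W0app_LpV hphi)).
  by apply: filterS G0 => x h Ox; rewrite (h Ox) dotp0l mulr0.
apply: fn; apply: ae_local => x Ox.
have [r r0 rO] := open_sq_sub oO Ox.
pose phi y := flat 0 1 (r ^+ 2 - sq x y).
have tphi : test phi by exact: test_flat_sq.
have lphi := test_Lp oO bO hp tphi.
have := I_eq0 mO (intg_source oO bO hp mf f0 fF lphi) _ (fphi _ tphi).
move=> /(_ (fun y Oy => mulr_ge0 (f0 Oy) (flat_ge0 _ _ _))) h.
exists (r / n.+1%:R); first by rewrite divr_gt0.
apply: filterS h => y hy /(ball_lt_sq r0) xy.
have := hy (rO y (ltW xy)) => /eqP; rewrite mulf_eq0 => /orP[/eqP//|].
by rewrite gt_eqF// flat_gt0// subr_gt0.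
Qed.

Section continuous_representative.
Variables (v : 'rV[R]_n -> R) (H : 'rV[R]_n -> 'rV[R]_n).
Hypotheses (hv : W0app nonneg v H) (sv : solves Omega p f lambda v H)
  (v0 : forall x, 0 <= v x) (vpos : aeO (fun x => 0 < v x)).

(** Positivity at [x0] is not known beforehand, so the barrier is centred at a nearby y with g y = v
    y > 0 and reaches far enough to be positive at [x0]. If g x0 <= 0, continuity gives W > g near
    [x0], against W <= v = g a.e. *)
Lemma continuous_positive (g : 'rV[R]_n -> R) : {in Omega, continuous g} ->
  aeO (fun x => g x = v x) -> forall x, Omega x -> 0 < g x.
Proof.
move=> cg gv x0 Ox0.
have [del /= del0 delO] : nbhs_ball x0 Omega by apply/nbhs_ballP/open_nbhs_nbhs.
have [r r0 rE] : exists2 r, 0 < r & del = 4 * r.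
  by exists (del / 4); [rewrite divr_gt0|rewrite mulrC divfK].
(* If the centre y is within [e] of [x0], the ball sq y <= r^2 stays in [Omega] and [x0] is interior
   to it. *)
pose e := r / n.+1%:R; have e0 : 0 < e by rewrite divr_gt0.
have er : e <= r by rewrite ler_pdivrMr// ler_peMr ?(ltW r0)// ler1n.
have subO (w x : 'rV[R]_n) : ball x0 e w -> sq w x <= r ^+ 2 -> Omega x.
  move=> [_ hw] hx; apply: delO; split => // i j; rewrite ord1 /ball/=.
  have h1 := hw ord0 j; rewrite /ball/= in h1.
  have h2 : `|x ord0 j - w ord0 j| <= r.
    by have := le_trans (le_sq w x j) hx; rewrite -real_normK ?num_real// ler_pXn2r// nnegrE ltW.
  have -> : x0 ord0 j - x ord0 j = (x0 ord0 j - w ord0 j) - (x ord0 j - w ord0 j) by ring.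
  apply: le_lt_trans (ler_normB _ _) _.
  by rewrite rE; lra.
have beO : ball x0 e `<=` Omega.
  move=> x hx; apply: (subO x x hx); rewrite /sq big1 ?sqr_ge0// => i _.
  by rewrite subrr expr0n.
have [y xy [gy vy]] : exists2 y, ball x0 e y & g y = v y /\ 0 < v y.
  by apply: ae_on_exists => //; apply: ae_onI; [exact: ae_onS gv|exact: ae_onS vpos].
have Oy := beO _ xy.
pose m := g y / 2.
have gy0 : 0 < g y by rewrite gy.
have m0 : 0 < m by rewrite divr_gt0.
have my : m < g y by rewrite /m; lra.
have [eta /= eta0 etam] : nbhs_ball y [set x | m < g x].
  apply/nbhs_ballP; apply: (cg y (mem_set Oy) [set t | m < t]).
  by apply: open_nbhs_nbhs; split; [exact: open_gt|].
(* The inner ball must lie where g > m and be strictly smaller than the outer one. *)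
pose rr := Num.min (eta ^+ 2) (r ^+ 2 / 2).
have rr0 : 0 < rr by rewrite lt_min exprn_gt0//= divr_gt0 ?exprn_gt0.
have rR : rr < r ^+ 2.
  rewrite gt_min; apply/orP; right.
  by rewrite ltr_pdivrMr// ltr_pMr ?exprn_gt0// ltr1n.
have hm : aeO (fun x => sq y x < rr -> m <= v x).
  apply: filterS gv => x gx Ox h; rewrite -(gx Ox) ltW//; apply: etam.
  by apply: sq_lt_ball => //; apply: lt_le_trans h _; rewrite ge_min lexx.
have hO : [set x | sq y x <= r ^+ 2] `<=` Omega by move=> x /=; exact: subO.
have [c c0 hc] := barrier_le oO bO hp f0 hv sv v0 rr0 rR m0 hO hm.
pose W x := m * flat 0 c (r ^+ 2 - sq y x).
have Wx0 : 0 < W x0.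
  rewrite mulr_gt0// flat_gt0// subr_gt0; apply: ball_lt_sq => //.
  exact: ball_sym.
rewrite ltNge; apply/negP => gx0.
have cW : {for x0, continuous W}.
  apply: smooth_continuous; apply: smoothM; first exact: smooth_cst.
  exact: (smooth_flat_comp 0 c0 (smooth_shift_sq y (r ^+ 2))).1.
have [k /= k0 hk] : nbhs_ball x0 [set x | 0 < W x - g x].
  apply/nbhs_ballP.
  have cWg : {for x0, continuous (fun x => W x - g x)}.
    by apply: continuousB => //; exact: (cg x0 (mem_set Ox0)).
  apply: (cWg [set t | 0 < t]).
  apply: open_nbhs_nbhs; split; first exact: open_gt.
  by rewrite /= subr_gt0; exact: le_lt_trans Wx0.
pose k' := Num.min k e.
have k'0 : 0 < k' by rewrite lt_min k0.
have bk : ball x0 k' `<=` Omega.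
  by apply: subset_trans beO; apply: le_ball; rewrite ge_min lexx orbT.
have [x xk [gvx Wvx]] : exists2 x, ball x0 k' x & g x = v x /\ W x <= v x.
  by apply: ae_on_exists => //; apply: ae_onI; [exact: ae_onS gv|exact: ae_onS hc].
have : ball x0 k x by apply: le_ball xk; rewrite ge_min lexx.
move=> /hk /=; rewrite subr_gt0 gvx.
by rewrite ltNge Wvx.
Qed.

End continuous_representative.

End positivity.

Lemma solves_positive_representative (R : realType) (n : nat) (Omega : set 'rV[R]_n) (p : R)
    (oO : open Omega) (bO : bounded_set Omega) (hp : 1 < p) (f : 'rV[R]_n -> R) (lambda : R)
    (u : 'rV[R]_n -> R) (G : 'rV[R]_n -> 'rV[R]_n) :
  connected Omega -> (forall x, Omega x -> 0 <= f x) -> sol Omega p f lambda u G ->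
  {ae lebesgue_rV n, forall x, Omega x -> 0 <= u x} ->
  ~ {ae lebesgue_rV n, forall x, Omega x -> u x = 0} ->
  exists v H, [/\ W0app Omega p [set t | 0 <= t] v H, solves Omega p f lambda v H,
    forall x, 0 <= v x, {ae lebesgue_rV n, forall x, Omega x -> 0 < v x} &
    {ae lebesgue_rV n, forall x, Omega x -> v x = u x}].
Proof.
move=> cO f0 hs u0 nz.
have [v [H [hv sv v0 vu]]] := solves_nonneg_representative oO bO hp hs u0.
exists v, H; split => //.
have [vz|//] := positive_dichotomy oO bO hp f0 hv sv v0 cO.
have {}vz : {ae lebesgue_rV n, forall x, Omega x -> v x = 0} := vz.
exfalso; apply: nz; apply: filterS2 vz vu => x h1 h2 Ox.
by rewrite -h2// h1.
Qed.

(** * Passage to a pointwise bounded source, and conclusion *)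

Section bounded_source.
Context {R : realType} {n : nat}.
Variables (Omega : set 'rV[R]_n) (p : R).
Hypotheses (oO : open Omega) (bO : bounded_set Omega) (hp : 1 < p).
Local Notation mu := (@lebesgue_rV R n).
Local Notation aeO P := {ae mu, forall x, Omega x -> P x}.
Local Notation I f := (\int[mu]_(x in Omega) f x).
Let mO : measurable Omega := measurable_domain oO.

Lemma essentially_bounded (f : 'rV[R]_n -> R) : in_Lspace Omega +oo%E f ->
  exists F, aeO (fun x => `|f x| <= F).
Proof.
move=> [_]; rewrite /finite_norm Lnorm.unlock; case: ifPn => [_|].
  set s := ess_sup _ _ => hs.
  have h : \forall x \ae mu, ((abse \o (EFin \o f \_ Omega)) x <= s)%E := ess_sup_ge _ _.
  have [F sF] : exists F : R, (s <= F%:E)%E.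
    by case: s hs {h} => [r| |] //= _; [exists r|exists 0; rewrite leNye].
  exists F; apply: filterS h => x /= + Ox; rewrite patchE mem_set// => hx.
  by rewrite -lee_fin; exact: le_trans sF.
(* The remaining branch of the definition of the norm: the whole space is null, and any property
   holds a.e. *)
rewrite -leNgt => h0 _; exists 0; exists setT; split => //.
by apply/eqP; rewrite eq_le h0/= measure_ge0.
Qed.

(** The a.e. bounds on the source become pointwise ones on [Omega], so that the arguments above
    handle no null sets for it. *)
Lemma truncated_source (f : 'rV[R]_n -> R) : in_Lspace Omega +oo%E f ->
  aeO (fun x => 0 <= f x) ->
  exists (g : 'rV[R]_n -> R) F, [/\ measurable_fun Omega g, forall x, Omega x -> 0 <= g x,
    forall x, Omega x -> g x <= F & aeO (fun x => f x = g x)].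
Proof.
move=> hf f0; have [F hF] := essentially_bounded hf; have mf := hf.1.
pose g x := Num.min (Num.max (f x) 0) `|F|.
exists g, `|F|; split.
- have mm : measurable_fun Omega (fun x => Num.max (f x) 0).
    by apply: measurable_maxr => //; exact: measurable_cst.
  by apply: measurable_minr => //; exact: measurable_cst.
- by move=> x _; rewrite le_min max0_ge0 normr_ge0.
- by move=> x _; rewrite ge_min lexx orbT.
- apply: filterS2 f0 hF => x h1 h2 Ox; rewrite /g max_l ?h1// min_l//.
  apply: le_trans (ler_norm _) _; apply: le_trans (h2 Ox) _; exact: ler_norm.
Qed.

Variables (f g : 'rV[R]_n -> R) (F : R).
Hypotheses (mf : measurable_fun Omega f) (mg : measurable_fun Omega g)
  (g0 : forall x, Omega x -> 0 <= g x) (gF : forall x, Omega x -> g x <= F)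
  (fg : aeO (fun x => f x = g x)).

Lemma source_eq (u : 'rV[R]_n -> R) : measurable_fun Omega u ->
  I (fun x => f x * u x) = I (fun x => g x * u x).
Proof.
move=> mu_; apply: (I_ae_eq mO); [exact: measurable_funM|exact: measurable_funM|].
by apply: filterS fg => x h Ox; rewrite h.
Qed.

Lemma W0_measurable (u : W0 Omega p) : measurable_fun Omega u.
Proof. exact: (W0_Lp u).1. Qed.

Lemma lambda_star_eq : lambda_star Omega p f = lambda_star Omega p g.
Proof.
rewrite /lambda_star; congr ereal_inf; apply/seteqP; split => _ [u [fu nu] <-] /=;
  exists u => //; split => //.
  by rewrite -(source_eq (W0_measurable u)).
by rewrite (source_eq (W0_measurable u)).
Qed.

Lemma weak_solution_sol lambda (u : W0 Omega p) : weak_solution f lambda u ->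
  sol Omega p g lambda u (grad u).
Proof.
move=> hu; split; first exact: record_W0app.
move=> phi H hphi; have [w [<- <-]] := W0app_record oO bO hp hphi.
by rewrite (hu w) (source_eq (W0_measurable w)).
Qed.

Lemma E_functional_self lambda (u : W0 Omega p) : weak_solution f lambda u ->
  E_functional f lambda u = (p^-1 - 1) * I (fun x => g x * u x).
Proof.
move=> hu; have := solves_self hp (weak_solution_sol hu).
rewrite /E_functional /H_functional -(source_eq (W0_measurable u)).
rewrite /grad_energy /mass /energy => ->.
by rewrite (addrC (lambda * _)) addrK mulrBl mul1r.
Qed.

End bounded_source.

Theorem proposition1p3 (R : realType) (N : nat) (hN : (1 <= N)%N)
  (p delta : R) (hp : 1 < p) (hdelta : 0 < delta < 1)
  (Omega : set 'rV[R]_N) (hOmega : bounded_C1_hoelder_domain delta Omega)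
  (f : 'rV[R]_N -> R) (hf : in_Lspace Omega +oo%E f)
  (hf0 : {ae lebesgue_rV N, forall x, Omega x -> 0 <= f x})
  (hfn0 : ~ {ae lebesgue_rV N, forall x, Omega x -> f x = 0})
  (lambda : R) :
  [/\ (lambda%:E < lambda_star Omega p f)%E ->
        ~ exists u : W0 Omega p,
            weak_solution f lambda u /\ E_functional f lambda u = 0,
      (lambda%:E < lambda1 Omega p)%E ->
        forall u : W0 Omega p, weak_solution f lambda u ->
          positive_in Omega u /\ E_functional f lambda u < 0 &
      (lambda1 Omega p < lambda%:E)%E ->
      (lambda%:E < lambda_star Omega p f)%E ->
        forall u : W0 Omega p, weak_solution f lambda u ->
          0 < E_functional f lambda u].
Proof.
have [oO cO _ bO _] := hOmega.
have [g [F [mg g0 gF fg]]] := truncated_source hf hf0.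
have gn0 : ~ {ae lebesgue_rV N, forall x, Omega x -> g x = 0}.
  by move=> h; apply: hfn0; apply: filterS2 fg h => x h1 h2 Ox; rewrite h1// h2.
have toSol u := @weak_solution_sol R N Omega p oO bO hp f g hf.1 mg fg lambda u.
have EE u := @E_functional_self R N Omega p oO bO hp f g hf.1 mg fg lambda u.
rewrite (lambda_star_eq p oO hf.1 mg fg).
have pneg : p^-1 - 1 < 0 by rewrite subr_lt0 invf_lt1// (lt_trans _ hp).
have nz (u : W0 Omega p) : weak_solution f lambda u ->
    ~ {ae lebesgue_rV N, forall x, Omega x -> u x = 0}.
  by move=> hu; apply: (solution_nonzero oO bO hp mg g0 gF (toSol u hu) gn0).
split.
- move=> hl [u [hu Eu0]].
  have gu : \int[lebesgue_rV N]_(x in Omega) (g x * u x) = 0.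
    by move: Eu0; rewrite (EE u hu) => /eqP; rewrite mulf_eq0 (lt_eqF pneg) => /eqP.
  have := lambda_star_lt oO bO hp hl (record_W0app oO bO hp u) (nz u hu) gu.
  by rewrite (solves_self hp (toSol u hu)) gu addr0 ltxx.
- move=> hl u hu; have hs := toSol u hu.
  have u0 := solves_nonneg_below_lambda1 oO bO hp g0 hs hl.
  have [v [H [hv sv v0 vpos vu]]] :=
    solves_positive_representative oO bO hp cO g0 hs u0 (nz u hu).
  split; first split.
  + by apply: filterS2 vpos vu => x h1 h2 Ox; rewrite -h2// h1.
  + move=> w cw wu; apply: (continuous_positive oO bO hp g0 hv sv v0 vpos) => //.
    by apply: filterS2 wu vu => x h1 h2 Ox; rewrite h1// h2.
  + have := lambda1_lt oO bO hp hl (record_W0app oO bO hp u) (nz u hu).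
    rewrite (EE u hu) (solves_self hp hs) ltrDl => gu.
    by rewrite nmulr_rlt0.
- move=> hl1 hl u hu; have hs := toSol u hu.
  rewrite (EE u hu) nmulr_rgt0// ltNge; apply/negP => gu.
  have u0 := solves_nonneg_below_lambda_star oO bO hp mg g0 gF hs hl gu.
  have [v [H [hv sv v0 vpos vu]]] :=
    solves_positive_representative oO bO hp cO g0 hs u0 (nz u hu).
  (* As lambda_1 < lambda, some w has a Rayleigh quotient below lambda, against Picone's inequality
     extended by density. The quotient is nonnegative, which gives the sign of lambda required
     there. *)
  have [_ [w nw <-]] := ereal_inf_lt hl1; rewrite lte_fin => wl.
  have hw := record_W0app oO bO hp w.
  have mw : 0 < mass w := Np_gt0 oO (W0app_Lp hw) nw.
  have l0 : 0 <= lambda.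
    apply: le_trans (ltW wl); apply: divr_ge0; last exact: ltW.
    exact: energy_ge0.
  have := density_mass_energy oO bO hp l0 (picone_test oO bO hp g0 hv sv v0 vpos) hw.
  by rewrite leNgt -ltr_pdivrMr// wl.
Qed.
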